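(* Let $n\ge1$ be an integer, $s\in(0,1)$, let $\Omega\subset\mathbb{R}^n$ be a bounded Lipschitz domain, let $V\in L^\infty(\Omega)$ and $f\in(\mathcal{H}^{s+\mathrm{Log}}_0(\Omega))^*$, and consider the Poisson problem $$(-\Delta)^{s+\mathrm{Log}}u+V(x)u=f\ \text{ in }\Omega,\qquad u=0\ \text{ in }\Omega^c. \tag{P}$$ Fix $r\in(0,e^{-|b_{n,s}|/2})$ and set $\alpha_r:=1-\frac{|b_{n,s}|}{2\ln(1/r)}>0$. (i) Assume that $$\operatorname*{ess\,inf}_\Omega V\ \ge\ \frac{c_{n,s}|\mathbb{S}^{n-1}|}{s^2}+\frac{|b_{n,s}|\,c_{n,s}}{s}\,|\mathbb{S}^{n-1}|\,r^{-2s}.$$ Then (P) admits a unique weak solution $u\in\mathcal{H}^{s+\mathrm{Log}}_0(\Omega)$. Moreover, the solution satisfies $$\|u\|_{\mathcal{H}^{s+\mathrm{Log}}_0(\Omega)}\le\frac1{\alpha_r}\,\|f\|_{(\mathcal{H}^{s+\mathrm{Log}}_0(\Omega))^*}.$$ (ii) Let $u$ be a weak solution of (P). If $f\in L^q(\Omega)$ for some $q>\frac{n}{2s}$, then $u\in L^\infty(\Omega)$.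
   Context: Functions are real-valued. Notation: $a_\pm:=\max\{0,\pm a\}$; $c_{n,s}=2^{2s}\pi^{-n/2}s\frac{\Gamma((n+2s)/2)}{\Gamma(1-s)}$; $b_{n,s}=\ln4+\frac1s+\psi(1-s)+\psi(\frac{n+2s}{2})$ with $\psi=\Gamma'/\Gamma$; $|\mathbb{S}^{n-1}|$ is the surface measure of the unit sphere; $\mathbf{k}_{s+\mathrm{Log},\pm}(z):=c_{n,s}|z|^{-n-2s}(-\ln|z|)_\pm$ for $z\ne0$. Forms: $\mathcal{E}_\pm(u,w):=\iint_{\mathbb{R}^n\times\mathbb{R}^n}(u(x)-u(y))(w(x)-w(y))\,\mathbf{k}_{s+\mathrm{Log},\pm}(x-y)\,dx\,dy$, $\mathcal{E}_s(u,w):=\iint_{\mathbb{R}^n\times\mathbb{R}^n}(u(x)-u(y))(w(x)-w(y))|x-y|^{-n-2s}\,dx\,dy$, $\mathcal{E}_{s+\mathrm{Log}}(u,w):=\mathcal{E}_+(u,w)-\mathcal{E}_-(u,w)+\frac{b_{n,s}c_{n,s}}{2}\mathcal{E}_s(u,w)$ (the quadratic form of the fractional-logarithmic Laplacian $(-\Delta)^{s+\mathrm{Log}}$). Space: $\mathcal{H}^{s+\mathrm{Log}}_0(\Omega):=\{u\in L^2(\mathbb{R}^n):\mathcal{E}_+(u,u)<\infty,\ u=0\text{ a.e. in }\Omega^c\}$, a Hilbert space with norm $\|u\|_{\mathcal{H}^{s+\mathrm{Log}}_0(\Omega)}:=\sqrt{\mathcal{E}_+(u,u)}$; $(\mathcal{H}^{s+\mathrm{Log}}_0(\Omega))^*$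 is its dual with the dual norm and $\langle\cdot,\cdot\rangle$ the duality pairing; $f\in L^q(\Omega)$ means that $\langle f,\varphi\rangle=\int_\Omega f\varphi\,dx$ for an $L^q$ function $f$. Weak solution: $u\in\mathcal{H}^{s+\mathrm{Log}}_0(\Omega)$ is a weak solution of (P) if $\mathcal{E}_{s+\mathrm{Log}}(u,\varphi)+\int_\Omega V u\varphi\,dx=\langle f,\varphi\rangle$ for every $\varphi\in\mathcal{H}^{s+\mathrm{Log}}_0(\Omega)$. *)

(* Defs.v *)
From HB Require Import structures.
From mathcomp Require Import all_boot all_order all_algebra.
From mathcomp Require Import all_classical all_reals all_analysis.
From mathcomp Require Import ess_sup_inf.

Set Implicit Arguments.
Unset Strict Implicit.
Unset Printing Implicit Defensive.

Import Order.TTheory GRing.Theory Num.Theory.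
Import numFieldNormedType.Exports.

Local Open Scope classical_set_scope.
Local Open Scope ring_scope.

(* R^n is the type 'rV[R]_n.  Its topology is the library's; its sigma-algebra
   is the one generated by the coordinates, i.e. the Borel sigma-algebra. *)

Definition rV_display : measure_display. Proof. exact. Qed.

Section measurable_rV.
Context {R : realType} {n : nat}.

Definition coord_rV (i : 'I_n) (x : 'rV[R]_n) : measurableTypeR R := x ord0 i.

Let rV_set0 : g_sigma_preimage coord_rV set0.
Proof. exact: sigma_algebra0. Qed.

Let rV_setC A : g_sigma_preimage coord_rV A -> g_sigma_preimage coord_rV (~` A).
Proof. exact: sigma_algebraC. Qed.

Let rV_bigcup (F : (set 'rV[R]_n)^nat) :
  (forall i, g_sigma_preimage coord_rV (F i)) ->
  g_sigma_preimage coord_rV (\bigcup_i (F i)).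
Proof. exact: sigma_algebra_bigcup. Qed.

HB.instance Definition _ := @isMeasurable.Build rV_display
  'rV[R]_n (g_sigma_preimage coord_rV) rV_set0 rV_setC rV_bigcup.

Lemma measurable_coord_rV (i : 'I_n) :
  measurable_fun [set: 'rV[R]_n] (coord_rV i).
Proof.
move=> _ Y mY; rewrite setTI; apply: sub_sigma_algebra => /=.
rewrite -bigcup_seq/=; exists i => /=; first by rewrite mem_index_enum.
by exists Y => //; rewrite setTI.
Qed.

Lemma measurable_fun_rVP d (T : measurableType d) (f : T -> 'rV[R]_n) :
  (forall i, measurable_fun [set: T] (coord_rV i \o f)) ->
  measurable_fun [set: T] f.
Proof.
move=> mf; suff fS : g_sigma_preimage (fun i => coord_rV i \o f) `<=` measurable.
  by move=> _ A mA; apply: fS; rewrite g_sigma_preimage_comp; exists A.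
apply: smallest_sub; first exact: sigma_algebra_measurable.
rewrite -bigcup_seq; apply: bigcup_sub => i _.
by move=> A [B mB <-]; exact: mf.
Qed.

End measurable_rV.

Section cons_rV.
Context {R : realType} {n : nat}.

Definition cons_rV (xt : measurableTypeR R * 'rV[R]_n) : 'rV[R]_n.+1 :=
  row_mx (xt.1 : R)%:M xt.2 : 'rV[R]_(1 + n).

Definition uncons_rV (v : 'rV[R]_n.+1) : measurableTypeR R * 'rV[R]_n :=
  (v ord0 ord0, rsubmx (v : 'rV[R]_(1 + n))).

Lemma cons_rV0 xt : cons_rV xt ord0 ord0 = xt.1.
Proof.
rewrite /cons_rV (_ : ord0 = lshift n (ord0 : 'I_1)); last exact: val_inj.
by rewrite (row_mxEl (xt.1%:M) xt.2) mxE eqxx.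
Qed.

Lemma cons_rVS xt (j : 'I_n) : cons_rV xt ord0 (lift ord0 j) = xt.2 ord0 j.
Proof.
rewrite /cons_rV (_ : lift ord0 j = rshift 1 j); last exact: val_inj.
by rewrite (row_mxEr (xt.1%:M) xt.2).
Qed.

Lemma cons_rVK : cancel cons_rV uncons_rV.
Proof.
move=> xt; rewrite /uncons_rV cons_rV0 /cons_rV row_mxKr.
by rewrite -surjective_pairing.
Qed.

Lemma measurable_cons_rV : measurable_fun [set: _ * _] cons_rV.
Proof.
apply: measurable_fun_rVP => i.
case: (unliftP ord0 i) => [j|] ->.
  rewrite (_ : _ \o _ = coord_rV j \o snd); last first.
    by apply/funext => xt /=; rewrite /coord_rV cons_rVS.
  by apply: measurableT_comp => //; exact: measurable_coord_rV.
rewrite (_ : _ \o _ = fst); first exact: measurable_fst.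
by apply/funext => xt /=; rewrite /coord_rV cons_rV0.
Qed.

Lemma measurable_uncons_rV : measurable_fun [set: 'rV[R]_n.+1] uncons_rV.
Proof.
apply/measurable_fun_pairP; split.
  exact: (measurable_coord_rV (ord0 : 'I_n.+1)).
apply: measurable_fun_rVP => j.
rewrite (_ : _ \o _ = coord_rV (lift ord0 j)).
  exact: measurable_coord_rV.
apply/funext => v /=; rewrite /coord_rV mxE; congr (v _ _); exact: val_inj.
Qed.

End cons_rV.

Section lebesgue_rV.
Context {R : realType}.

Section step.
Context {n : nat} (m : {sigma_finite_measure set 'rV[R]_n -> \bar R}).

Definition lebesgue_step : set 'rV[R]_n.+1 -> \bar R :=
  pushforward (@lebesgue_measure R \x m)%E cons_rV.

Let mpre A : measurable A -> measurable (cons_rV (R := R) (n := n) @^-1` A).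
Proof.
by move=> mA; rewrite -[X in measurable X]setTI; exact: measurable_cons_rV.
Qed.

Let step0 : lebesgue_step set0 = 0.
Proof. by rewrite /lebesgue_step /pushforward preimage_set0 measure0. Qed.

Let step_ge0 A : (0 <= lebesgue_step A)%E.
Proof. by rewrite /lebesgue_step /pushforward; exact: measure_ge0. Qed.

Let step_sigma_additive : semi_sigma_additive lebesgue_step.
Proof.
move=> F mF tF mUF; rewrite /lebesgue_step /pushforward preimage_bigcup.
apply: measure_semi_sigma_additive.
- by move=> k; exact: mpre.
- apply/trivIsetP => /= i j _ _ ij; rewrite -preimage_setI.
  by move/trivIsetP : tF => /(_ _ _ _ _ ij) ->//; rewrite preimage_set0.
- by rewrite -preimage_bigcup; exact: mpre.
Qed.

HB.instance Definition _ := isMeasure.Build _ _ _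
  lebesgue_step step0 step_ge0 step_sigma_additive.

Let lebesgue_step_sigma_finite : sigma_finite setT lebesgue_step.
Proof.
have /sigma_finiteP[F [TF ndF Foo]] := sigma_finiteT (@lebesgue_measure R).
have /sigma_finiteP[G [TG ndG Goo]] := sigma_finiteT m.
exists (fun k => uncons_rV @^-1` (F k `*` G k)).
  rewrite -preimage_bigcup (_ : \bigcup_k (F k `*` G k) = setT) ?preimage_setT//.
  rewrite -subTset => -[x y] _.
  have [i _ Fx] : (\bigcup_k F k) x by rewrite -TF.
  have [j _ Gy] : (\bigcup_k G k) y by rewrite -TG.
  exists (maxn i j) => //; split.
    by move: x Fx; exact/subsetPset/ndF/leq_maxl.
  by move: y Gy; exact/subsetPset/ndG/leq_maxr.
move=> k; have [? ?] := Foo k; have [? ?] := Goo k; split.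
  rewrite -[X in measurable X]setTI; apply: measurable_uncons_rV => //.
  exact: measurableX.
rewrite /lebesgue_step /pushforward -comp_preimage.
rewrite (_ : uncons_rV \o cons_rV = id) ?preimage_id//; last first.
  by apply/funext => x /=; rewrite cons_rVK.
by rewrite product_measure1E// lte_mul_pinfty// ge0_fin_numE.
Qed.

HB.instance Definition _ := Measure_isSigmaFinite.Build _ _ _
  lebesgue_step lebesgue_step_sigma_finite.

End step.

Fixpoint lebesgue_rV (n : nat) : {sigma_finite_measure set 'rV[R]_n -> \bar R} :=
  match n with
  | 0 => \d_(0 : 'rV[R]_0)
  | n'.+1 => lebesgue_step (lebesgue_rV n')
  end.

(* This determines lebesgue_rV n, boxes being a generating pi-system. *)
Lemma lebesgue_rV_box (n : nat) (A : 'I_n -> set (measurableTypeR R)) :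
  (forall i, measurable (A i)) ->
  lebesgue_rV n [set x | forall i, A i (x ord0 i)] =
  (\prod_(i < n) lebesgue_measure (A i))%E.
Proof.
elim: n A => [|n IH] A mA.
  rewrite big_ord0 /= diracE mem_set// => i; by case: i.
rewrite big_ord_recl -IH//.
have mB : measurable [set x : 'rV[R]_n | forall i, A (lift ord0 i) (x ord0 i)].
  rewrite (_ : [set _ | _] =
    \big[setI/setT]_(i < n) (coord_rV i @^-1` A (lift ord0 i))).
    apply: bigsetI_measurable => i _; rewrite -[X in measurable X]setTI.
    exact: measurable_coord_rV.
  rewrite -bigcap_seq; apply/seteqP; split=> x /=.
    by move=> xA i _; exact: xA.
  by move=> xA i; apply: xA; rewrite /= mem_index_enum.
rewrite -product_measure1E//; congr (product_measure1 _ _ _).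
apply/seteqP; split=> xt /=.
  move=> xA; split; first by rewrite -[xt.1]cons_rV0; exact: xA.
  by move=> i; rewrite -cons_rVS; exact: xA.
move=> [xA tA] i; case: (unliftP ord0 i) => [j|] ->.
  by rewrite cons_rVS; exact: tA.
by rewrite cons_rV0.
Qed.

End lebesgue_rV.
Arguments lebesgue_rV {R} n.

Section euclidean.
Context {R : realType} {n : nat}.
Implicit Types (x y e : 'rV[R]_n) (Omega : set 'rV[R]_n).
Local Notation mu := (lebesgue_rV n).

Definition dotv x y : R := \sum_i x ord0 i * y ord0 i.

(* The library norm `|x| on 'rV[R]_n is the sup norm. *)
Definition enorm x : R := Num.sqrt (dotv x x).

(* The surface measure of E, a subset of the unit sphere, is n times the
   Lebesgue measure of the cone {t x : x in E, 0 < t <= 1}. *)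
Definition surface_measure (E : set 'rV[R]_n) : R :=
  n%:R * fine (mu [set y | exists t x, [/\ 0 < t <= 1, E x & y = t *: x]]).

Definition unit_sphere : set 'rV[R]_n := [set x | enorm x = 1].

Definition domain Omega : Prop :=
  [/\ open Omega, connected Omega & Omega !=set0].

(* Near each boundary point, Omega is the region above the graph of a Lipschitz
   function gamma over the hyperplane orthogonal to a unit vector e (only the
   values of gamma on that hyperplane matter). *)
Definition lipschitz_boundary Omega : Prop :=
  forall x0, closure Omega x0 -> ~ Omega° x0 ->
  exists e (gamma : 'rV[R]_n -> R) (L rho : R),
    [/\ enorm e = 1, 0 < rho,
        forall y z, dotv y e = 0 -> dotv z e = 0 ->
          `|gamma y - gamma z| <= L * enorm (y - z) &
        forall x, enorm (x - x0) < rho ->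
          (Omega x <-> gamma (x - dotv x e *: e) < dotv x e)].

Definition bounded_lipschitz_domain Omega : Prop :=
  [/\ domain Omega, bounded_set Omega & lipschitz_boundary Omega].

(* L^q(Omega): the extension by zero is in L^q(R^n). *)
Definition Lq Omega (q : \bar R) (g : 'rV[R]_n -> R) : Prop :=
  patch (cst 0) Omega g \in Lfun mu q.

Definition ess_inf_on Omega (g : 'rV[R]_n -> R) : \bar R :=
  ess_inf mu (patch (cst +oo%E) Omega (EFin \o g)).

End euclidean.
Arguments unit_sphere : clear implicits.

Section special_functions.
Context {R : realType}.

Definition Gamma (x : R) : R :=
  \int[lebesgue_measure]_(t in `]0, +oo[) (t `^ (x - 1) * expR (- t)).

Definition digamma (x : R) : R := derive1 Gamma x / Gamma x.

End special_functions.

Section fractional_logarithmic_laplacian.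
Context {R : realType} (n : nat) (s : R).
Local Notation mu := (lebesgue_rV n).
Local Notation E := 'rV[R]_n.
Implicit Types (u w phi V : E -> R) (F : (E -> R) -> R) (Omega : set E).

Definition c_ns : R :=
  2 `^ (2 * s) * pi `^ (- (n%:R / 2)) * s
  * (Gamma ((n%:R + 2 * s) / 2) / Gamma (1 - s)).

Definition b_ns : R :=
  ln 4 + s^-1 + digamma (1 - s) + digamma ((n%:R + 2 * s) / 2).

(* The value of the kernels at z = 0 is irrelevant. *)
Definition kernel_plus (z : E) : R :=
  c_ns * enorm z `^ (- n%:R - 2 * s) * Num.max 0 (- ln (enorm z)).

Definition kernel_minus (z : E) : R :=
  c_ns * enorm z `^ (- n%:R - 2 * s) * Num.max 0 (ln (enorm z)).

Definition kernel_s (z : E) : R := enorm z `^ (- n%:R - 2 * s).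

Definition energy (k : E -> R) u w : \bar R :=
  (\int[(mu \x mu)%E]_z
     ((u z.1 - u z.2) * (w z.1 - w z.2) * k (z.1 - z.2))%:E)%E.

Definition form_plus u w : R := fine (energy kernel_plus u w).
Definition form_minus u w : R := fine (energy kernel_minus u w).
Definition form_s u w : R := fine (energy kernel_s u w).

Definition form_sLog u w : R :=
  form_plus u w - form_minus u w + b_ns * c_ns / 2 * form_s u w.

(* Elements of the space are represented by functions, up to equality a.e. *)
Definition H0sLog Omega u : Prop :=
  [/\ u \in Lfun mu 2%:E,
      (energy kernel_plus u u < +oo)%E &
      {ae mu, forall x, ~ Omega x -> u x = 0}].

Definition normH u : R := Num.sqrt (form_plus u u).

(* The values of F outside H0sLog Omega are irrelevant; F is compatible with
   equality a.e. by linearity and boundedness. *)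
Definition dualH Omega F : Prop :=
  (forall (a : R) u w, H0sLog Omega u -> H0sLog Omega w ->
     F (a *: u + w) = a * F u + F w) /\
  (exists C : R, forall u, H0sLog Omega u -> `|F u| <= C * normH u).

Definition dual_norm Omega F : R :=
  sup [set `|F u| | u in [set u | H0sLog Omega u /\ normH u <= 1]].

(* The functional F is given by integration against a function in
   L^q(Omega). *)
Definition dual_in_Lq Omega (q : \bar R) F : Prop :=
  exists2 g : E -> R, Lq Omega q g &
    forall phi, H0sLog Omega phi ->
      mu.-integrable Omega (fun x => (g x * phi x)%:E) /\
      F phi = \int[mu]_(x in Omega) (g x * phi x).

Definition weak_solution Omega V F u : Prop :=
  H0sLog Omega u /\
  forall phi, H0sLog Omega phi ->
    form_sLog u phi + \int[mu]_(x in Omega) (V x * u x * phi x) = F phi.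

End fractional_logarithmic_laplacian.

(* Main.v *)
Require Import Defs.
From mathcomp Require Import all_boot all_order all_algebra.
From mathcomp Require Import all_classical all_reals all_analysis.
From mathcomp Require Import measurable_realfun ess_sup_inf.
From mathcomp Require Import ring lra.

Set Implicit Arguments.
Unset Strict Implicit.
Unset Printing Implicit Defensive.

Import Order.TTheory GRing.Theory Num.Theory.
Import numFieldNormedType.Exports.

Local Open Scope classical_set_scope.
Local Open Scope ring_scope.

(* (i) Put [L := k_- + |b| c / 2 * |z|^(-n-2s) 1_(|z| > r)], nonnegative and integrable.
   For |z| <= r one has |z|^(-n-2s) <= k_+(z) / (c ln(1/r)), so the full kernel is at least
   [alpha_r k_+ - L], and the form of L is at most 4 (int L) |u|_2^2, where 4 (int L) is exactly
   the lower bound required of V.  Hence the form plus the potential is coercive on H with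
   constant alpha_r; with a Poincare inequality, H is complete and the Riesz representation
   theorem gives existence, uniqueness and the estimate.

   (ii) Let a(k) := |{u > k}| and test with T := min((u - k)_+, h - k).  The points outside
   {u > k} contribute to E_+(u, T) at least c0 a(k)^(-2s/n) times the integral of (u - k) T,
   because the k_+-mass of the complement of a small set A, seen from any point, is at least
   c0 |A|^(-2s/n).  For large k this absorbs the terms of order zero and gives
   a(h) <= C (k / (h - k))^2 a(k)^(1 + 2s/n - 1/q), so a vanishes at a finite level
   (Stampacchia).  If n < 2s, finiteness of E_+(u, u) alone gives such an inequality. *)

(** * Lebesgue measure on R^n *)

(** Positivity of the form is endangered by -E_- and, when b < 0, by the s-term. Both dangers are
    confined to L, which besides being integrable is bounded; so they act as terms of order zero. In
    (i) the potential pays for them. In (ii) V may have either sign, and the payment comes from the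
    smallness of the level sets: a(k)^(-2s/n) exceeds any constant once k is large. That bound on
    the k_+-mass plays the part of Sobolev's inequality; it draws on the power |z|^(-n-2s), the
    logarithm being bounded below by 1 near the origin. T is a monotone function of u, so (u x - u
    y)(T x - T y) >= 0 and pointwise bounds between kernels can be integrated. Its cap h - k bounds
    the integrals of T and f T by h - k times powers of a(k). The coupling of {u > k} with the rest
    of space through L is controlled by the boundedness of L and |u|_2 alone. The exponent 1 + 2s/n
    - 1/q exceeds 1 exactly when q > n/(2s). If n < 2s, such a q may lie below 1, and then the L^q
    bound on f says nothing about the integral of f T; hence the separate argument. *)

Section affine_1d.
Context {R : realType}.
Implicit Types t a : R.

Lemma measurable_affine t a :
  measurable_fun [set: measurableTypeR R] (fun x : measurableTypeR R => t * x + a : measurableTypeR R).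
Proof.
apply: measurable_funD; last exact: measurable_cst.
exact: mulrl_measurable.
Qed.

Definition affine_measure t a : {measure set (measurableTypeR R) -> \bar R} :=
  mscale (NngNum (normr_ge0 t)) (measure_function_pushforward__canonical__measure_function_Measure
    (@lebesgue_measure R) (measurable_affine t a)).

(** Uniqueness of Lebesgue measure given its values on the intervals ]c, d]. For t < 0 the preimage
    of such an interval is closed on the other side, which does not change its length. *)
Lemma lebesgue_measure_affine t a (A : set (measurableTypeR R)) : t != 0 ->
  measurable A ->
  (`|t|%:E * lebesgue_measure ((fun x : R => (t * x + a)%R) @^-1` A) = lebesgue_measure A)%E.
Proof.
move=> t0 mA.
apply/esym; apply: (@lebesgue_measure_unique R (affine_measure t a)) => // _ [[c d]] /= _ <-; rewrite /mscale /= /pushforward.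
have [tp|tn] := ltP 0 t.
  have -> : (fun x : R => t * x + a) @^-1` `]c, d]%classic = `](c - a) / t, (d - a) / t]%classic.
    apply/seteqP; split=> x /=; rewrite !in_itv/= ltr_pdivrMr// ler_pdivlMr// ltrBlDr lerBrDr mulrC//.
  rewrite !lebesgue_measure_itv/= !lte_fin ltr_pM2r ?invr_gt0// ltrD2r.
  case: ifPn => cd; last by rewrite mule0.
  rewrite -!EFinD -EFinM gtr0_norm//; congr (_%:E); field; by rewrite gt_eqF.
have tn' : t < 0 by rewrite lt_neqAle t0.
have -> : (fun x : R => t * x + a) @^-1` `]c, d]%classic = `[(d - a) / t, (c - a) / t[%classic.
  by apply/seteqP; split=> x /=; rewrite !in_itv/= ltr_ndivlMr// ler_ndivrMr// ltrBlDr lerBrDr mulrC andbC.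
rewrite !lebesgue_measure_itv/= !lte_fin ltr_nM2r ?invr_lt0// ltrD2r.
case: ifPn => cd; last by rewrite mule0.
rewrite -!EFinD -EFinM ltr0_norm//; congr (_%:E); field; by rewrite lt_eqF.
Qed.

Lemma ge0_integral_affine_R t a (f : R -> \bar R) : t != 0 ->
  measurable_fun [set: measurableTypeR R] f -> (forall x, 0 <= f x)%E ->
  (`|t|%:E * \int[lebesgue_measure]_x f (t * x + a)%R = \int[lebesgue_measure]_x f x)%E.
Proof.
move=> t0 mf f0; rewrite [RHS](eq_measure_integral (affine_measure t a)); last first.
  by move=> A mA _; exact/esym/lebesgue_measure_affine.
rewrite ge0_integral_mscale//= (ge0_integral_pushforward (measurable_affine t a))//=.
Qed.
End affine_1d.

Section affine_rV.
Context {R : realType}.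

Lemma measurable_affine_rV n (t : R) (a : 'rV[R]_n) :
  measurable_fun [set: 'rV[R]_n] (fun x => (t *: x + a)%R).
Proof.
apply: measurable_fun_rVP => i.
rewrite (_ : _ \o _ = (fun x : 'rV[R]_n => t * coord_rV i x + a ord0 i)); last first.
  by apply/funext => x; rewrite /= /coord_rV !mxE.
by apply: measurable_funD => //; apply: measurable_funM => //; exact: measurable_coord_rV.
Qed.

Lemma measurable_set_affine_rV n (t : R) (a : 'rV[R]_n) (A : set 'rV[R]_n) :
  measurable A -> measurable ((fun x => (t *: x + a)%R) @^-1` A).
Proof. by move=> mA; rewrite -[X in measurable X]setTI; exact: measurable_affine_rV. Qed.

(** Induction on the dimension by slicing: the one-dimensional formula moves the first coordinate,
    the induction hypothesis moves each slice. Taking t = 1 and t = -1 yields invariance under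
    translation and reflection. *)
Lemma lebesgue_rV_affine n (t : R) (a : 'rV[R]_n) (A : set 'rV[R]_n) : t != 0 ->
  measurable A ->
  ((`|t| ^+ n)%:E * lebesgue_rV n ((fun x => (t *: x + a)%R) @^-1` A) = lebesgue_rV n A)%E.
Proof.
move=> t0; elim: n a A => [|n IH] a A mA.
  rewrite expr0 mul1e; congr (lebesgue_rV 0 _); apply/seteqP; split=> x /=;
    by rewrite (thinmx0 (t *: x + a)) (thinmx0 x).
have mB : measurable (cons_rV (R := R) (n := n) @^-1` A).
  by rewrite -[X in measurable X]setTI; exact: measurable_cons_rV.
pose a0 := a ord0 ord0; pose a1 : 'rV[R]_n := \row_j a ord0 (lift ord0 j).
pose G y := lebesgue_rV n (xsection (cons_rV @^-1` A) y).
have mG : measurable_fun setT G by exact: measurable_fun_xsection.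
have -> : lebesgue_rV n.+1 A = (\int[lebesgue_measure]_x G x)%E by [].
rewrite -(ge0_integral_affine_R a0 t0 mG)// exprS EFinM -muleA; congr (_ * _)%E.
have mB' : measurable (cons_rV (R := R) (n := n) @^-1` ((fun x => (t *: x + a)%R) @^-1` A)).
  rewrite -[X in measurable X]setTI; apply: measurable_cons_rV => //; exact: measurable_set_affine_rV.
rewrite -[lebesgue_rV n.+1 _]/(\int[lebesgue_measure]_x (lebesgue_rV n \o (xsection (cons_rV @^-1` ((fun x => (t *: x + a)%R) @^-1` A)))) x)%E.
rewrite -ge0_integralZl//; last exact: measurable_fun_xsection.
apply: eq_integral => x _ /=; rewrite /G -[RHS](IH a1); last exact: measurable_xsection.
apply: (congr1 (fun B => (_ * lebesgue_rV n B)%E)); apply/seteqP; split => v /=; rewrite /xsection /= !inE /=.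
all: suff -> : t *: cons_rV (x, v) + a = cons_rV (t * x + a0, t *: v + a1) by [].
all: apply/rowP => j; rewrite [LHS]mxE [X in X + _]mxE; case: (unliftP ord0 j) => [k|] ->.
all: by rewrite ?cons_rVS ?cons_rV0 //= !mxE.
Qed.

Definition affine_rV_measure n (t : R) (a : 'rV[R]_n) : {measure set 'rV[R]_n -> \bar R} :=
  mscale (NngNum (exprn_ge0 n (normr_ge0 t)))
   (measure_function_pushforward__canonical__measure_function_Measure
    (lebesgue_rV n) (measurable_affine_rV t a)).

Lemma ge0_integral_affine n (t : R) (a : 'rV[R]_n) (f : 'rV[R]_n -> \bar R) : t != 0 ->
  measurable_fun [set: 'rV[R]_n] f -> (forall x, 0 <= f x)%E ->
  ((`|t| ^+ n)%:E * \int[lebesgue_rV n]_x f (t *: x + a)%R = \int[lebesgue_rV n]_x f x)%E.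
Proof.
move=> t0 mf f0; rewrite [RHS](eq_measure_integral (affine_rV_measure t a)); last first.
  by move=> A mA _; exact/esym/lebesgue_rV_affine.
by rewrite ge0_integral_mscale//= (ge0_integral_pushforward (measurable_affine_rV t a)).
Qed.

Lemma ge0_integral_translate n (a : 'rV[R]_n) (f : 'rV[R]_n -> \bar R) :
  measurable_fun [set: 'rV[R]_n] f -> (forall x, 0 <= f x)%E ->
  (\int[lebesgue_rV n]_x f (x + a)%R = \int[lebesgue_rV n]_x f x)%E.
Proof.
move=> mf f0; rewrite -(ge0_integral_affine a (oner_neq0 R) mf f0) normr1 expr1n mul1e.
by under [RHS]eq_integral do rewrite scale1r.
Qed.

Lemma ge0_integral_reflect n (a : 'rV[R]_n) (f : 'rV[R]_n -> \bar R) :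
  measurable_fun [set: 'rV[R]_n] f -> (forall x, 0 <= f x)%E ->
  (\int[lebesgue_rV n]_x f (a - x)%R = \int[lebesgue_rV n]_x f x)%E.
Proof.
move=> mf f0; rewrite -(@ge0_integral_affine _ (-1) a _ _ mf f0) ?oppr_eq0 ?oner_eq0//.
rewrite normrN1 expr1n mul1e.
by under [RHS]eq_integral do rewrite scaleN1r addrC.
Qed.

Lemma measurable_subr_rV n :
  measurable_fun [set: 'rV[R]_n * 'rV[R]_n] (fun z => z.1 - z.2).
Proof.
apply: measurable_fun_rVP => i.
rewrite (_ : _ \o _ = (fun z : 'rV[R]_n * 'rV[R]_n => coord_rV i z.1 - coord_rV i z.2)); last first.
  by apply/funext => x; rewrite /= /coord_rV !mxE.
by apply: measurable_funB; (apply: measurableT_comp; [exact: measurable_coord_rV|]).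
Qed.

Lemma measurable_enorm n : measurable_fun [set: 'rV[R]_n] (@enorm R n).
Proof.
apply: (@measurableT_comp _ _ _ _ _ _ (@Num.sqrt R)) => //.
  by apply: continuous_measurable_fun; exact: sqrt_continuous.
apply: measurable_sum => i; apply: measurable_funM; exact: measurable_coord_rV.
Qed.

(** Openness refers to the sup norm, measurability to the coordinates. An open set is the union of
    the cubes it contains with rational centre and radius 1/(m+1), and these are countably many. *)
Lemma open_measurable_rV n (U : set 'rV[R]_n) : open U -> measurable U.
Proof.
move=> oU.
pose box (p : 'rV[rat]_n * nat) : set 'rV[R]_n :=
  [set x | forall i, `|x ord0 i - ratr (p.1 ord0 i)| < p.2.+1%:R^-1].
have mbox p : measurable (box p).
  have -> : box p = \big[setI/setT]_(i < n)
     (coord_rV i @^-1` (ball (ratr (p.1 ord0 i) : R) (p.2.+1%:R^-1))); last first.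
    apply: bigsetI_measurable => i _; rewrite -[X in measurable X]setTI.
    by apply: measurable_coord_rV => //; exact: measurable_ball.
  rewrite -bigcap_seq; apply/seteqP; split=> x /=.
    by move=> xA i _ /=; rewrite /ball/= distrC; exact: xA.
  by move=> xA i; have := xA i; rewrite /= mem_index_enum /ball/= distrC; apply.
suff -> : U = \bigcup_(p in [set p | box p `<=` U]) box p.
  rewrite bigcup_mkcond; apply: countable_bigcupT_measurable => [|p]; first exact: countableP.
  by case: ifP.
apply/seteqP; split => [x Ux|x [p pU]]; last exact: pU.
move: (oU); rewrite openE => /(_ _ Ux) /nbhs_ballP[e /= e0 eU].
have [k ke] : exists k : nat, k.+1%:R^-1 < e / 2.
  have e2 : 0 < e / 2 by rewrite divr_gt0.
  by exists (Num.truncn (e / 2)^-1); rewrite invf_plt ?posrE// truncnS_gt.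
have /choice[q qP] : forall i : 'I_n, exists q : rat, `|x ord0 i - ratr q| < k.+1%:R^-1.
  move=> i; have /rat_in_itvoo[q] : x ord0 i - k.+1%:R^-1 < x ord0 i + k.+1%:R^-1 by rewrite ltrD2l gtrN.
  rewrite in_itv/= => /andP[q1 q2]; exists q; rewrite distrC ltr_distl; apply/andP; split=> //.
exists (\row_i q i, k) => /=; last by move=> i; rewrite /= mxE.
move=> y /= yb; apply: eU; split=> [//|i j]; rewrite (ord1 i) /ball/=.
have := yb j; rewrite mxE => yq.
have -> : x ord0 j - y ord0 j = (x ord0 j - ratr (q j)) - (y ord0 j - ratr (q j)) by ring.
rewrite (le_lt_trans (ler_normB _ _))// (lt_trans (ltrD (qP j) yq))//.
by rewrite [ltRHS]splitr ltrD.
Qed.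
End affine_rV.

(** * Radial integrals and the Gamma function *)

Section tail_integrals.
Context {R : realType}.
Implicit Types t p : R.

Lemma cvg_powRN p : 0 < p -> (fun x : R => x `^ (- p)) @ +oo --> 0.
Proof.
move=> p0; apply/cvgrPdist_lt => e e0; near=> x.
rewrite sub0r normrN ger0_norm ?powR_ge0// powRN invf_plt ?posrE ?powR_gt0//.
have ep : (e^-1 `^ (p^-1)) `^ p = e^-1.
  by rewrite -powRrM mulVf ?gt_eqF// powRr1// invr_ge0 ltW.
rewrite -ep gt0_ltr_powR ?nnegrE ?powR_ge0 ?ltW//.
Unshelve. all: by end_near. Qed.

Lemma continuous_powR_gt0 p x : 0 < x -> {for x, continuous (fun x : R => x `^ p)}.
Proof.
move=> x0; apply: differentiable_continuous; apply/derivable1_diffP.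
by apply: ex_derive; exact: is_derive1_powR.
Qed.

Lemma ge0_integral_tail_powR t p : 0 < t -> 0 < p ->
  (\int[lebesgue_measure]_(x in `[t, +oo[) (x `^ (- p - 1))%:E = (t `^ (- p) / p)%:E)%E.
Proof.
move=> t0 p0; pose F x : R := - p^-1 * x `^ (- p).
have dF (x : R) : 0 < x -> is_derive x 1 F (x `^ (- p - 1)).
  move=> x0; rewrite /F; have := is_derive1_powR (- p) x0 => dx.
  have dZ : is_derive x 1 (- p^-1 *: (fun x : R => x `^ (- p) : R^o)) (- p^-1 *: (- p * x `^ (- p - 1))) by exact: is_deriveZ.
  apply: (is_derive_eq dZ); rewrite /GRing.scale/=; field; by rewrite gt_eqF.
have cF (x : R) : 0 < x -> {for x, continuous F}.
  move=> x0; apply: differentiable_continuous; apply/derivable1_diffP.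
  by apply: ex_derive; exact: dF.
rewrite (@ge0_continuous_FTC2y R _ F t 0).
- by rewrite -EFinD /F; congr (_%:E); field; rewrite gt_eqF.
- by move=> x _; exact: powR_ge0.
- apply/continuous_within_itvcyP; split.
    by move=> x; rewrite in_itv/= andbT => tx; apply: continuous_powR_gt0; exact: lt_trans tx.
  by apply: cvg_at_right_filter; exact: continuous_powR_gt0.
- rewrite -(mulr0 (- p^-1)); apply: cvgMr; exact: cvg_powRN.
- by move=> x tx; apply: ex_derive; apply: dF; exact: lt_trans tx.
- by apply: cvg_at_right_filter; exact: cF.
- by move=> x; rewrite in_itv/= andbT => tx; rewrite derive1E; apply: derive_val; apply: dF; exact: lt_trans tx.
Qed.

Lemma ge0_integral_inv_ln t : 1 <= t ->
  (\int[lebesgue_measure]_(x in `[1%R, t]) (x `^ (-1))%:E = (ln t)%:E)%E.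
Proof.
rewrite (_ : \int[_]_(_ in _) _ = \int[lebesgue_measure]_(x in `[1%R, t]) (x^-1)%:E)%E; last first.
  apply: eq_integral => x; rewrite inE/= in_itv/= => /andP[x1 _].
  by rewrite powR_inv1// (le_trans _ x1).
rewrite le_eqVlt => /predU1P[<-|t1].
  by rewrite set_itv1 integral_set1 ln1.
have cinv (x : R) : 1 <= x -> {for x, continuous (fun x : R => x^-1)}.
  by move=> x1; apply: inv_continuous; rewrite gt_eqF// (lt_le_trans _ x1).
have cln (x : R) : 1 <= x -> {for x, continuous (@ln R)}.
  by move=> x1; apply: continuous_ln; rewrite (lt_le_trans _ x1).
rewrite (@continuous_FTC2 R _ (@ln R))// ?ln1 ?sube0//.
- apply: continuous_in_subspaceT => x; rewrite inE/= in_itv/= => /andP[x1 _]; exact: cinv.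
- split.
  + by move=> x; rewrite in_itv/= => /andP[x1 _]; apply: ex_derive; apply: is_derive1_ln; exact: lt_trans x1.
  + by apply: cvg_at_right_filter; exact: cln.
  + by apply: cvg_at_left_filter; apply: cln; exact: ltW.
- move=> x; rewrite in_itv/= => /andP[x1 _]; rewrite derive1E; apply: derive_val.
  by apply: is_derive1_ln; exact: lt_trans x1.
Qed.
End tail_integrals.

Section balls.
Context {R : realType}.

Lemma enorm_ge0 n (x : 'rV[R]_n) : 0 <= enorm x. Proof. exact: sqrtr_ge0. Qed.

Lemma enormZ n (t : R) (x : 'rV[R]_n) : enorm (t *: x) = `|t| * enorm x.
Proof.
rewrite /enorm -sqrtr_sqr -sqrtrM ?sqr_ge0//; congr (Num.sqrt _).
by rewrite /dotv mulr_sumr; apply: eq_bigr => i _; rewrite !mxE; ring.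
Qed.

Lemma coord_le_enorm n (x : 'rV[R]_n) i : `|x ord0 i| <= enorm x.
Proof.
rewrite -sqrtr_sqr ler_wsqrtr// /dotv (bigD1 i)//= expr2 lerDl.
by apply: sumr_ge0 => j _; rewrite -expr2 sqr_ge0.
Qed.

Lemma enorm_eq0 n (x : 'rV[R]_n) : enorm x = 0 -> x = 0.
Proof.
move=> x0; apply/rowP => i; rewrite mxE; apply/eqP; rewrite -normr_le0 -x0.
exact: coord_le_enorm.
Qed.

Lemma enorm_le_coord n (x : 'rV[R]_n) (a : R) : 0 <= a ->
  (forall i, `|x ord0 i| <= a) -> enorm x <= n%:R * a.
Proof.
move=> a0 xa.
rewrite /enorm -[leRHS]ger0_norm ?mulr_ge0// -sqrtr_sqr ler_wsqrtr//.
apply: (@le_trans _ _ (\sum_(i < n) a ^+ 2)).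
  apply: ler_sum => i _; rewrite -expr2 -real_normK ?num_real//.
  by rewrite lerXn2r ?nnegrE.
rewrite sumr_const card_ord exprMn -[leLHS]mulr_natl; apply: ler_wpM2r; first exact: sqr_ge0.
by rewrite -natrX ler_nat; case: (n) => // m; rewrite expnS leq_pmulr// expn_gt0.
Qed.

Definition eball n (t : R) : set 'rV[R]_n := [set x | enorm x <= t].
Arguments eball n t : clear implicits.

Lemma measurable_eball n t : measurable (eball n t).
Proof.
rewrite -[X in measurable X]setTI.
have := measurable_enorm (R := R) (n := n) measurableT (measurable_itv (`]-oo, t] : interval R)).
by congr (measurable (_ `&` _)); apply/seteqP; split=> x /=; rewrite in_itv.
Qed.

Lemma lebesgue_eball_scale n t : 0 < t ->
  (lebesgue_rV n (eball n t) = (t ^+ n)%:E * lebesgue_rV n (eball n 1))%E.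
Proof.
move=> t0; rewrite -(@lebesgue_rV_affine _ n t 0 (eball n t)) ?gt_eqF//; last exact: measurable_eball.
rewrite gtr0_norm//; congr (_ * _)%E; apply: (congr1 (lebesgue_rV n)).
apply/seteqP; split=> x /=; rewrite /eball /= addr0 enormZ gtr0_norm//;
  by rewrite -ler_pdivlMl// mulVf// gt_eqF.
Qed.

Lemma lebesgue_box n (a b : R) : a <= b ->
  lebesgue_rV n [set x | forall i, a <= x ord0 i <= b] = ((b - a) ^+ n)%:E.
Proof.
move=> ab.
have E : [set x : 'rV[R]_n | forall i, a <= x ord0 i <= b] = [set x | forall i, `[a, b]%classic (x ord0 i)].
  by apply/seteqP; split => x /= xab i; have := xab i; rewrite in_itv.
rewrite (congr1 (lebesgue_rV n) E) (@lebesgue_rV_box R n (fun=> `[a, b]%classic))// lebesgue_measure_itv/= lte_fin.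
have -> : (if a < b then (b%:E + (- a)%:E)%E else 0%E) = (b - a)%:E.
  case: ltgtP ab => // -> _; by rewrite subrr.
elim: n {E} => [|n IH]; first by rewrite big_ord0.
by rewrite big_ord_recl IH exprS EFinM.
Qed.

Lemma measurable_box n (a b : R) : measurable [set x : 'rV[R]_n | forall i, a <= x ord0 i <= b].
Proof.
rewrite (_ : mkset _ = \big[setI/setT]_(i < n) (coord_rV i @^-1` `[a, b])).
  apply: bigsetI_measurable => i _; rewrite -[X in measurable X]setTI.
  exact: measurable_coord_rV.
rewrite -bigcap_seq; apply/seteqP; split=> x /=.
  by move=> xA i _ /=; rewrite in_itv; exact: xA.
by move=> xA i; have := xA i; rewrite /= mem_index_enum in_itv; apply.
Qed.

Lemma lebesgue_eball1_gt0 n : (0 < lebesgue_rV n (eball n 1))%E.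
Proof.
apply: (@lt_le_trans _ _ (lebesgue_rV n [set x | forall i, 0 <= x ord0 i <= n.+1%:R^-1])).
  by rewrite lebesgue_box ?invr_ge0// subr0 lte_fin exprn_gt0// invr_gt0.
apply: le_measure; rewrite ?inE; [exact: measurable_box|exact: measurable_eball|].
move=> x /= xb; apply: (@le_trans _ _ (n%:R * n.+1%:R^-1)).
  apply: enorm_le_coord; rewrite ?invr_ge0// => i.
  by have /andP[x0 x1] := xb i; rewrite ger0_norm.
by rewrite ler_pdivrMr// mul1r ler_nat.
Qed.

Lemma lebesgue_eball_lty n t : (lebesgue_rV n (eball n t) < +oo)%E.
Proof.
have [t0|t0] := leP 0 t; last first.
  rewrite (_ : eball n t = set0) ?measure0//.
  by apply/seteqP; split=> x //=; rewrite /eball/= leNgt (lt_le_trans t0)// enorm_ge0.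
apply: (@le_lt_trans _ _ (lebesgue_rV n [set x | forall i, - t <= x ord0 i <= t])).
  apply: le_measure; rewrite ?inE; [exact: measurable_eball|exact: measurable_box|].
  by move=> x /= xt i; rewrite -ler_norml (le_trans (coord_le_enorm x i)).
by rewrite lebesgue_box ?ltry// lerNl (le_trans _ t0)// oppr_le0.
Qed.

Definition omega n : R := fine (lebesgue_rV n (eball n 1)).

Lemma omega_gt0 n : 0 < omega n.
Proof.
by rewrite fine_gt0// lebesgue_eball1_gt0 lebesgue_eball_lty.
Qed.

Lemma lebesgue_eball n t : 0 < t -> lebesgue_rV n (eball n t) = (omega n * t ^+ n)%:E.
Proof.
move=> t0; rewrite lebesgue_eball_scale// mulrC EFinM /omega fineK//.
by rewrite ge0_fin_numE ?lebesgue_eball_lty// measure_ge0.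
Qed.

Lemma lebesgue_rV_set1 n (x : 'rV[R]_n) : (0 < n)%N -> lebesgue_rV n [set x] = 0.
Proof.
move=> n0; have E : [set x] = [set y | forall i, [set x ord0 i] (y ord0 i)]; last first.
  rewrite (congr1 (lebesgue_rV n) E) (@lebesgue_rV_box R n (fun i => [set x ord0 i]))//.
  by case: n x n0 {E} => // n x _; rewrite big_ord_recl lebesgue_measure_set1 mul0e.
apply/seteqP; split=> [y -> //|y /= yx]; apply/rowP => i; exact: yx.
Qed.

(** The cone over the sphere is the unit ball without the origin, and a point is null since n >=
    1. *)
Lemma surface_measure_sphere n : (0 < n)%N ->
  surface_measure (unit_sphere R n) = n%:R * omega n.
Proof.
move=> n0; rewrite /surface_measure /omega; congr (_ * fine _).
have -> : [set y | exists t x, [/\ 0 < t <= 1, unit_sphere R n x & y = t *: x]] = eball n 1 `\ 0.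
  apply/seteqP; split=> [y [t [x [/andP[t0 t1] x1 ->]]]|y [/= y1 y0]].
    rewrite /eball/= enormZ x1 mulr1 gtr0_norm//; split=> //.
    move=> tx0; have : enorm (t *: x) = 0 by rewrite tx0 /enorm /dotv big1 ?sqrtr0// => i _; rewrite mxE mul0r.
    by rewrite enormZ x1 mulr1 gtr0_norm// => /eqP; rewrite gt_eqF.
  have ey : 0 < enorm y.
    by rewrite lt_neqAle enorm_ge0 andbT; apply/eqP => /esym/enorm_eq0.
  exists (enorm y), ((enorm y)^-1 *: y); split; first by rewrite ey.
    by rewrite /unit_sphere/= enormZ gtr0_norm ?invr_gt0// mulVf// gt_eqF.
  by rewrite scalerA divff ?gt_eqF// scale1r.
have m0 : measurable [set 0 : 'rV[R]_n].
  have -> : [set 0 : 'rV[R]_n] = eball n 0.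
    apply/seteqP; split=> [x ->|x]; rewrite /eball/=.
      by rewrite /enorm /dotv big1 ?sqrtr0// => i _; rewrite mxE mul0r.
    by move=> x0; apply: enorm_eq0; apply/eqP; rewrite eq_le x0 enorm_ge0.
  exact: measurable_eball.
rewrite measureD//; [|exact: measurable_eball|exact: lebesgue_eball_lty].
suff I0 : lebesgue_rV n (eball n 1 `&` [set 0]) = 0%E by rewrite [X in (_ - X)%E]I0 sube0.
apply/eqP; rewrite eq_le measure_ge0 andbT -(lebesgue_rV_set1 0 n0).
apply: le_measure; rewrite ?inE//; apply: measurableI => //; exact: measurable_eball.
Qed.
End balls.
Arguments eball {R} n t.
Arguments omega {R} n.

Section ge0_integral_real.
Context d (T : measurableType d) (R : realType) (m : {measure set T -> \bar R}).
Implicit Types (D : set T) (f g : T -> R).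

Lemma ge0_integralZl_R D f k : measurable D -> measurable_fun D f ->
  (forall x, D x -> 0 <= f x) -> 0 <= k ->
  (\int[m]_(x in D) (k%:E * (f x)%:E) = k%:E * \int[m]_(x in D) (f x)%:E)%E.
Proof.
by move=> mD mf f0 k0; rewrite ge0_integralZl ?lee_fin//; exact/measurable_EFinP.
Qed.

Lemma ge0_integralD_R D f g : measurable D ->
  measurable_fun D f -> (forall x, D x -> 0 <= f x) ->
  measurable_fun D g -> (forall x, D x -> 0 <= g x) ->
  (\int[m]_(x in D) (f x + g x)%:E = \int[m]_(x in D) (f x)%:E + \int[m]_(x in D) (g x)%:E)%E.
Proof.
move=> mD mf f0 mg g0; under eq_integral do rewrite EFinD.
by rewrite ge0_integralD//; exact/measurable_EFinP.
Qed.
End ge0_integral_real.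

Section radial.
Context {R : realType}.

(** Layer cake: max(|x|, t)^(-q) is the integral of q y^(-q-1) over y >= max(|x|, t). By Tonelli,
    its integral over x is that of q y^(-q-1) times the volume [omega n * y ^+ n] of a ball, over y
    >= t. The ball |x| <= t contributes the integral of [h], which is subtracted at the end. *)
Lemma ge0_integral_radial_tail n (p t : R) : 0 < p -> 0 < t ->
  (\int[lebesgue_rV n]_x (if (t < enorm x)%R then enorm x `^ (- n%:R - p) else 0)%:E
   = (n%:R * omega n * t `^ (- p) / p)%:E)%E.
Proof.
move=> p0 t0; set q := n%:R + p; have q0 : 0 < q by rewrite ltr_wpDl.
have qE : - n%:R - p = - q by rewrite /q opprD.
have qp : - q - 1 + n%:R = - p - 1 by rewrite /q; ring.
rewrite qE.
set f := fun x : 'rV[R]_n => if t < enorm x then enorm x `^ (- q) else 0.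
pose h (x : 'rV[R]_n) := if enorm x <= t then t `^ (- q) else 0.
pose g (z : 'rV[R]_n * measurableTypeR R) := (if (Num.max (enorm z.1) t <= z.2)%R then q * z.2 `^ (- q - 1) else 0)%:E.
have men : measurable_fun setT (enorm : 'rV[R]_n -> R) by exact: measurable_enorm.
have mf : measurable_fun setT f.
  apply: measurable_fun_ifT => //; first exact: measurable_fun_ltr.
  by apply: (measurableT_comp (measurable_powR _)).
have mh : measurable_fun setT h by apply: measurable_fun_ifT => //; exact: measurable_fun_ler.
have mg : measurable_fun setT g.
  apply/measurable_EFinP; apply: measurable_fun_ifT => //.
    by apply: measurable_fun_ler => //; apply: measurable_maxr => //; exact: measurableT_comp.
  by apply: measurable_funM => //; apply: (measurableT_comp (measurable_powR _)).
have g0 z : (0 <= g z)%E.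
  by rewrite /g; case: ifP => _; rewrite lee_fin// mulr_ge0 ?powR_ge0// ltW.
have f0 x : 0 <= f x by rewrite /f; case: ifP => // _; rewrite powR_ge0.
have h0 x : 0 <= h x by rewrite /h; case: ifP => // _; rewrite powR_ge0.
have J1 : (\int[lebesgue_rV n \x lebesgue_measure]_z g z = \int[lebesgue_rV n]_x (f x + h x)%:E)%E.
  rewrite fubini_tonelli1//; apply: eq_integral => x _; rewrite /fubini_F /g /=.
  have mx0 : 0 < Num.max (enorm x) t by rewrite lt_max t0 orbT.
  transitivity (\int[lebesgue_measure]_(y in `[Num.max (enorm x) t, +oo[) (q%:E * (y `^ (- q - 1))%:E))%E.
    rewrite [RHS]integral_mkcond; apply: eq_integral => y _; rewrite patchE mem_setE in_itv/= andbT.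
    by case: ifP => _; rewrite ?EFinM.
  rewrite ge0_integralZl_R; last 4 first.
  - by [].
  - apply: measurable_funTS; exact: measurable_powR.
  - by move=> *; rewrite ?powR_ge0.
  - by rewrite ltW.
  rewrite ge0_integral_tail_powR// -EFinM mulrCA divff ?gt_eqF// mulr1 /f /h /Num.max.
  by case: ltgtP => [ext|ext|->]; rewrite ?addr0 ?add0r.
have J2 : (\int[lebesgue_rV n \x lebesgue_measure]_z g z = (q * omega n * (t `^ (- p) / p))%:E)%E.
  rewrite fubini_tonelli2//.
  transitivity (\int[lebesgue_measure]_(y in `[t, +oo[) ((q * omega n)%:E * (y `^ (- p - 1))%:E))%E; last first.
    rewrite ge0_integralZl_R; last 4 first.
    - by [].
    - apply: measurable_funTS; exact: measurable_powR.
    - by move=> *; rewrite ?powR_ge0.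
    - by rewrite mulr_ge0 ?ltW// omega_gt0.
    by rewrite ge0_integral_tail_powR// -EFinM.
  rewrite [RHS]integral_mkcond; apply: eq_integral => y _; rewrite patchE mem_setE in_itv/= andbT /fubini_G /g/=.
  have [ty|ty] := leP t y; last first.
    rewrite integral0_eq// => x _; rewrite ge_max (leNgt t) ty andbF//.
  have y0 : 0 < y by exact: lt_le_trans ty.
  transitivity (\int[lebesgue_rV n]_x ((q * y `^ (- q - 1))%:E * (\1_(eball n y) x)%:E))%E.
    apply: eq_integral => x _; rewrite ge_max ty andbT indicE.
    by case: ifPn => [xy|/negP xy]; [rewrite mem_set//= mule1|rewrite memNset//= mule0].
  rewrite ge0_integralZl_R; last 4 first.
  - by [].
  - apply: measurable_indic; exact: measurable_eball.
  - by move=> *; rewrite ?powR_ge0.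
  - by rewrite mulr_ge0 ?powR_ge0// ltW.
  rewrite integral_indic//; last exact: measurable_eball.
  rewrite setIT [X in (_ * X)%E]lebesgue_eball// -EFinM; congr (_%:E).
  rewrite -qp [_ `^ (_ + n%:R)]powRD ?(gt_eqF y0) ?implybT// powR_mulrn ?ltW//; ring.
have J3 : (\int[lebesgue_rV n]_x (h x)%:E = (omega n * t `^ (- p))%:E)%E.
  transitivity (\int[lebesgue_rV n]_x ((t `^ (- q))%:E * (\1_(eball n t) x)%:E))%E.
    apply: eq_integral => x _; rewrite indicE /h.
    by case: ifPn => [xy|/negP xy]; [rewrite mem_set//= mule1|rewrite memNset//= mule0].
  rewrite ge0_integralZl_R; last 4 first.
  - by [].
  - apply: measurable_indic; exact: measurable_eball.
  - by move=> *; rewrite ?powR_ge0.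
  - by rewrite powR_ge0.
  rewrite integral_indic//; last exact: measurable_eball.
  rewrite setIT [X in (_ * X)%E]lebesgue_eball// -EFinM; congr (_%:E).
  have -> : - p = - q + n%:R by rewrite /q; ring.
  rewrite [_ `^ (_ + n%:R)]powRD ?(gt_eqF t0) ?implybT// powR_mulrn ?ltW//; ring.
move: J1; rewrite J2 ge0_integralD_R//.
rewrite [X in (_ + X)%E]J3 => J.
rewrite -[LHS](@addeK _ (omega n * t `^ (- p))%:E)// -J.
rewrite -EFinB; congr (_%:E); rewrite /q; field; by rewrite gt_eqF.
Qed.

(** As ln |x| is the integral of 1/y over [1, |x|], Tonelli reduces the claim to the tail formula at
    each radius y >= 1. *)
Lemma ge0_integral_radial_ln n (p : R) : 0 < p ->
  (\int[lebesgue_rV n]_x (if (1 < enorm x)%R then enorm x `^ (- n%:R - p) * ln (enorm x) else 0)%:E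
   = (n%:R * omega n / p ^+ 2)%:E)%E.
Proof.
move=> p0; set q := - n%:R - p.
pose g (z : 'rV[R]_n * measurableTypeR R) := (if (1 <= z.2)%R then (if (z.2 < enorm z.1)%R then enorm z.1 `^ q else 0) * z.2 `^ (-1) else 0)%:E.
have men : measurable_fun setT (enorm : 'rV[R]_n -> R) by exact: measurable_enorm.
have mg : measurable_fun setT g.
  apply/measurable_EFinP; apply: measurable_fun_ifT => //.
    exact: measurable_fun_ler.
  apply: measurable_funM => //; last exact: (measurableT_comp (measurable_powR _)).
  apply: measurable_fun_ifT => //; first by apply: measurable_fun_ltr => //; exact: measurableT_comp.
  apply: (measurableT_comp (measurable_powR _)); exact: measurableT_comp.
have g0 z : (0 <= g z)%E.
  by rewrite /g; case: ifP => _; rewrite lee_fin// mulr_ge0 ?powR_ge0//; case: ifP; rewrite ?powR_ge0.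
transitivity (\int[lebesgue_rV n \x lebesgue_measure]_z g z)%E.
  rewrite fubini_tonelli1//; apply: eq_integral => x _; rewrite /fubini_F /g /=.
  transitivity (\int[lebesgue_measure]_(y in `[1%R, enorm x[) ((enorm x `^ q)%:E * (y `^ (-1))%:E))%E; last first.
    rewrite integral_mkcond; apply: eq_integral => y _; rewrite patchE mem_setE in_itv/=.
    case: (leP 1 y) => //= y1; by case: ifP => _; rewrite ?mul0r// EFinM.
  case: ifPn => [x1|]; last first.
    by rewrite -leNgt => x1; rewrite set_itv_ge ?integral_set0// bnd_simp -leNgt.
  rewrite ge0_integralZl_R; last 4 first.
  - by [].
  - apply: measurable_funTS; exact: measurable_powR.
  - by move=> y _; rewrite powR_ge0.
  - by rewrite powR_ge0.
  rewrite integral_itv_bndo_bndc; last by apply/measurable_EFinP; apply: measurable_funTS; exact: measurable_powR.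
  by rewrite ge0_integral_inv_ln ?ltW.
rewrite fubini_tonelli2//.
transitivity (\int[lebesgue_measure]_(y in `[1%R, +oo[) ((n%:R * omega n / p)%:E * (y `^ (- p - 1))%:E))%E; last first.
  rewrite ge0_integralZl_R; last 4 first.
  - by [].
  - apply: measurable_funTS; exact: measurable_powR.
  - by move=> *; rewrite ?powR_ge0.
  - by rewrite divr_ge0 ?mulr_ge0 ?(ltW (omega_gt0 _)) ?(ltW p0).
  rewrite ge0_integral_tail_powR// -EFinM powR1; congr (_%:E); field; by rewrite gt_eqF.
rewrite [RHS]integral_mkcond; apply: eq_integral => y _; rewrite patchE mem_setE in_itv/= andbT /fubini_G /g/=.
have [y1|y1] := leP 1 y; last by rewrite integral0_eq.
have y0 : 0 < y by exact: lt_le_trans y1.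
transitivity (\int[lebesgue_rV n]_x ((y `^ (-1))%:E * (if (y < enorm x)%R then enorm x `^ q else 0)%:E))%E.
  by apply: eq_integral => x _; rewrite mulrC EFinM.
rewrite ge0_integralZl_R; last 4 first.
- by [].
- apply: measurable_fun_ifT => //; first exact: measurable_fun_ltr.
  by apply: (measurableT_comp (measurable_powR _)).
- by move=> x _; case: ifP; rewrite ?powR_ge0.
- by rewrite powR_ge0.
rewrite ge0_integral_radial_tail// -!EFinM; congr (_%:E).
rewrite powRD ?(gt_eqF y0) ?implybT//; field; by rewrite gt_eqF.
Qed.
End radial.

Section gamma.
Context {R : realType}.
Implicit Types x t : R.
Local Notation leb := (@lebesgue_measure R).

(** For x < 1, t^(x-1) is 1 plus the length of [1, t^(x-1)]. The condition y <= t^(x-1) reads t <=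
    y^(-1/(1-x)), so exchanging the integrals leaves a convergent tail: -1/(1-x) = -p-1 with p =
    x/(1-x). *)
Lemma ge0_integral_powR_01 x : 0 < x ->
  (\int[leb]_(t in `]0%R, 1%R]) (t `^ (x - 1))%:E < +oo)%E.
Proof.
move=> x0; have [x1|x1] := leP 1 x.
  apply: (@le_lt_trans _ _ (\int[leb]_(t in `]0%R, 1%R]) (cst 1 t))%E); last first.
    by rewrite integral_cst// mul1e [X in (X < _)%E]lebesgue_measure_itv/= lte01 ltry.
  apply: ge0_le_integral => //.
  - by move=> t _; rewrite lee_fin powR_ge0.
  - by apply/measurable_EFinP; apply: measurable_funTS; exact: measurable_powR.
  - move=> t; rewrite /= in_itv/= => /andP[t0 t1]; rewrite lee_fin [leRHS](_ : 1 = 1 `^ (x - 1)); last by rewrite powR1.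
    by rewrite ge0_ler_powR ?nnegrE ?subr_ge0// ltW.
set a := 1 - x; have a0 : 0 < a by rewrite subr_gt0.
pose p := x / a; have p0 : 0 < p by rewrite divr_gt0.
have pE : - p - 1 = - a^-1 by rewrite /p /a; field; rewrite gt_eqF.
pose g (z : measurableTypeR R * measurableTypeR R) := (if (0 < z.1)%R then if (1 <= z.2)%R then if (z.1 <= z.2 `^ (- p - 1))%R then 1 else 0 else 0 else 0 : R)%:E.
have mg : measurable_fun setT g.
  apply/measurable_EFinP; apply: measurable_fun_ifT => //; first exact: measurable_fun_ltr.
  apply: measurable_fun_ifT => //; first exact: measurable_fun_ler.
  apply: measurable_fun_ifT => //; apply: measurable_fun_ler => //.
  by apply: (measurableT_comp (measurable_powR _)).
have g0 z : (0 <= g z)%E by rewrite /g; repeat case: ifP.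
have mF : measurable_fun setT (fun t => \int[leb]_y g (t, y))%E by exact: measurable_fun_fubini_tonelli_F.
have F0 t : (0 <= \int[leb]_y g (t, y))%E by exact: integral_ge0.
apply: (@le_lt_trans _ _ (\int[leb]_(t in `]0%R, 1%R]) (cst 1 t + \int[leb]_y g (t, y)))%E).
  apply: ge0_le_integral => //.
  - by move=> t _; rewrite lee_fin powR_ge0.
  - by apply/measurable_EFinP; apply: measurable_funTS; exact: measurable_powR.
  - by apply: emeasurable_funD => //; exact: measurable_funTS.
  - move=> t; rewrite /= in_itv/= => /andP[t0 t1].
    have tx1 : 1 <= t `^ (x - 1).
      rewrite (_ : x - 1 = - a) ?powRN ?invf_ge1 ?powR_gt0 /a ?opprB//.
      rewrite [leRHS](_ : 1 = 1 `^ a); last by rewrite powR1.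
      by rewrite ge0_ler_powR ?nnegrE ?(ltW t0) ?(ltW a0).
    apply: (@le_trans _ _ (1 + \int[leb]_y (\1_(`[1%R, t `^ (x - 1)] : set R) y)%:E)%E).
      rewrite integral_indic// setIT [X in (_ + X)%E]lebesgue_measure_itv/= lte_fin.
      case: ltgtP tx1 => // [_ _|<- _]; last by rewrite adde0.
      by rewrite -EFinB -EFinD lee_fin; lra.
    apply: leeD => //; apply: ge0_le_integral => //.
    - by apply/measurable_EFinP; exact: measurable_indic.
    - by apply: measurableT_comp => //; exact: measurable_fun_pair2.
    - move=> y _; rewrite indicE; case: (boolP (y \in _)) => [|_]; last exact: g0.
      rewrite inE/= in_itv/= => /andP[y1 yt]; rewrite /g/= t0 y1.
      have y0 : 0 < y by exact: lt_le_trans y1.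
      suff -> : t <= y `^ (- p - 1) by [].
      rewrite pE powRN -[t]invrK lef_pV2 ?posrE ?powR_gt0 ?invr_gt0//.
      have -> : t^-1 = (t `^ (x - 1)) `^ a^-1.
        rewrite -powRrM (_ : (x - 1) * a^-1 = -1) ?powR_inv1 ?ltW//.
        by rewrite /a; field; rewrite subr_eq0 gt_eqF.
      by rewrite ge0_ler_powR ?nnegrE ?powR_ge0 ?invr_ge0 ?(ltW a0) ?(ltW y0).
rewrite ge0_integralD//; last exact: measurable_funTS.
apply: lte_add_pinfty; first by rewrite integral_cst// mul1e [X in (X < _)%E]lebesgue_measure_itv/= lte01 ltry.
apply: (@le_lt_trans _ _ (\int[leb]_t \int[leb]_y g (t, y))%E).
  by apply: ge0_subset_integral.
rewrite fubini_tonelli//.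
apply: (@le_lt_trans _ _ (\int[leb]_(y in `[1%R, +oo[) (y `^ (- p - 1))%:E)%E); last first.
  by rewrite ge0_integral_tail_powR// ltry.
rewrite [leRHS]integral_mkcond; apply: ge0_le_integral; first exact: measurableT.
- by move=> y _; exact: integral_ge0.
- exact: measurable_fun_fubini_tonelli_G.
- apply/(measurable_restrictT _ _).1 => //; apply/measurable_EFinP; apply: measurable_funTS; exact: measurable_powR.
- move=> y _; rewrite patchE mem_setE in_itv/= andbT /g/=.
  case: ifPn => y1; last by rewrite integral0_eq// => t _; case: ifP.
  apply: (@le_trans _ _ (\int[leb]_t (\1_(`]0%R, y `^ (- p - 1)] : set R) t)%:E)%E); last first.
    rewrite integral_indic// setIT [X in (X <= _)%E]lebesgue_measure_itv/= lte_fin powR_gt0 ?(lt_le_trans _ y1)//.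
    by rewrite sube0.
  apply: ge0_le_integral => //.
  - by move=> t _; repeat case: ifP.
  - apply/measurable_EFinP; apply: measurable_fun_ifT => //; first exact: measurable_fun_ltr.
    by apply: measurable_fun_ifT => //; exact: measurable_fun_ler.
  - by apply/measurable_EFinP; exact: measurable_indic.
  - move=> t _; rewrite indicE mem_setE in_itv/=.
    by case: ifP => // _; case: ifP.
Qed.

(** With m > |x + 1|, t^(x+1) <= t^m <= m^m e^t, because e^(t/m) >= t/m. The exponent [-1 - 1] is
    that of [ge0_integral_tail_powR] at p = 1. *)
Lemma powR_expRN_le x : exists C : R, 0 <= C /\ forall t, 1 <= t -> t `^ (x - 1) * expR (- t) <= C * t `^ (-1 - 1).
Proof.
pose m := (Num.truncn `|x + 1|).+1.
have m0 : 0 < m%:R :> R by rewrite ltr0n.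
exists (m%:R ^+ m); split; first exact: exprn_ge0.
move=> t t1; have t0 : 0 < t by exact: lt_le_trans t1.
have -> : x - 1 = (x + 1) + (-1 - 1) by ring.
rewrite powRD ?(gt_eqF t0) ?implybT// mulrAC ler_wpM2r ?powR_ge0//.
rewrite expRN ler_pdivrMr ?expR_gt0//.
apply: (@le_trans _ _ (t ^+ m)).
  rewrite -powR_mulrn ?(ltW t0)// ler_powR//; apply: (le_trans (ler_norm _)).
  by apply/ltW; exact: truncnS_gt.
have -> : expR t = expR (t / m%:R) ^+ m.
  by rewrite -expRM_natl mulrC divfK// gt_eqF.
rewrite -exprMn lerXn2r ?nnegrE ?mulr_ge0 ?expR_ge0 ?(ltW t0) ?(ltW m0)//.
rewrite -ler_pdivrMl// mulrC (le_trans _ (expR_ge1Dx _))// lerDr//.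
Qed.

(** This gives c_{n,s} > 0. [Gamma] is the [fine] part of an integral, hence 0 if the integral is
    infinite; so finiteness has to be proved along with positivity. If the integral vanished, the
    positive integrand would be zero almost everywhere on a half-line. *)
Lemma Gamma_gt0 x : 0 < x -> 0 < Gamma x.
Proof.
move=> x0; have [C [C0 HC]] := powR_expRN_le x.
pose f t := t `^ (x - 1) * expR (- t).
have f0 t : 0 <= f t by rewrite mulr_ge0 ?powR_ge0 ?expR_ge0.
have mf : measurable_fun setT f.
  apply: measurable_funM; first exact: measurable_powR.
  by apply: measurableT_comp => //.
have mfD (D : set (measurableTypeR R)) : measurable_fun D (EFin \o f) by apply/measurable_EFinP; exact: measurable_funTS.
have fin : (\int[leb]_(t in `]0%R, +oo[) (f t)%:E < +oo)%E.
  have -> : `]0%R, +oo[%classic = `]0%R, 1%R] `|` `]1%R, +oo[ :> set R.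
    by rewrite -itv_bndbnd_setU // ?bnd_simp.
  rewrite ge0_integral_setU//=; last 2 first.
  - by move=> t _; rewrite lee_fin.
  - apply/disj_setPS => y [] /=; rewrite !in_itv/= andbT => /andP[_ y1]; by rewrite ltNge y1.
  apply: lte_add_pinfty.
    apply: le_lt_trans (ge0_integral_powR_01 x0); apply: ge0_le_integral => //.
    - by move=> t _; rewrite lee_fin.
    - by apply/measurable_EFinP; apply: measurable_funTS; exact: measurable_powR.
    - move=> t; rewrite /= in_itv/= => /andP[t0 _]; rewrite lee_fin /f ler_piMr ?powR_ge0//.
      by rewrite -expR0 ler_expR oppr_le0 ltW.
  rewrite integral_itv_obnd_cbnd; last exact: mfD.
  apply: (@le_lt_trans _ _ (\int[leb]_(t in `[1%R, +oo[) (C%:E * (t `^ (-1 - 1))%:E))%E).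
    apply: ge0_le_integral => //.
    - by move=> t _; rewrite lee_fin.
    - by apply/measurable_EFinP; apply: measurable_funM => //; apply: measurable_funTS; exact: measurable_powR.
    - by move=> t; rewrite /= in_itv/= andbT => t1; rewrite -EFinM lee_fin; exact: HC.
  rewrite ge0_integralZl_R; last 4 first.
  - by [].
  - by apply: measurable_funTS; exact: measurable_powR.
  - by move=> *; rewrite powR_ge0.
  - by [].
  by rewrite ge0_integral_tail_powR// -EFinM ltry.
rewrite /Gamma /Rintegral; apply: fine_gt0; rewrite fin andbT.
have I1 : (0 <= \int[leb]_(t in `]0%R, +oo[) (f t)%:E)%E by apply: integral_ge0 => t _; rewrite lee_fin.
rewrite lt_neqAle [X in _ && X]I1 andbT.
apply/eqP => /esym I0.
have : (\int[leb]_(t in `]0%R, +oo[) `|(f t)%:E| = 0)%E.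
  by rewrite -[RHS]I0; apply: eq_integral => t _; rewrite gee0_abs ?lee_fin ?f0.
move/ae_eq_integral_abs => /(_ (measurable_itv _) (mfD _))[N [mN N0 subN]].
have : (leb `]0%R, +oo[ <= leb N)%E.
  apply: le_measure; rewrite ?inE// => t tD; apply: subN => /= /(_ tD)[].
  move: tD; rewrite /= in_itv/= andbT => t0; apply/eqP.
  by rewrite gt_eqF// mulr_gt0 ?expR_gt0// powR_gt0.
by rewrite [X in (_ <= X)%E]N0 [X in (X <= _)%E]lebesgue_measure_itv/= ltry.
Qed.
End gamma.

(** * The kernels *)

Section convolution.
Context {R : realType} (n : nat).
Local Notation E := 'rV[R]_n.
Local Notation mu := (lebesgue_rV n).
Implicit Types f k : E -> R.

Lemma measurable_fun_diff k : measurable_fun [set: E] k ->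
  measurable_fun [set: E * E] (fun z => k (z.1 - z.2)).
Proof. by move=> mk; apply: (measurableT_comp mk); exact: measurable_subr_rV. Qed.

Lemma measurable_fun_fst k : measurable_fun [set: E] k ->
  measurable_fun [set: E * E] (fun z => k z.1).
Proof. by move=> mk; apply: (measurableT_comp mk). Qed.

Lemma measurable_fun_snd k : measurable_fun [set: E] k ->
  measurable_fun [set: E * E] (fun z => k z.2).
Proof. by move=> mk; apply: (measurableT_comp mk). Qed.

Lemma ge0_integral_conv1 f k : measurable_fun setT f -> measurable_fun setT k ->
  (forall x, 0 <= f x) -> (forall x, 0 <= k x) ->
  (\int[mu \x mu]_z (f z.1 * k (z.1 - z.2))%:E =
   \int[mu]_x (f x)%:E * \int[mu]_x (k x)%:E)%E.
Proof.
move=> mf mk f0 k0; rewrite fubini_tonelli1//=; last 2 first.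
- by apply/measurable_EFinP; apply: measurable_funM; [exact: measurable_fun_fst|exact: measurable_fun_diff].
- by move=> z; rewrite lee_fin mulr_ge0.
rewrite -ge0_integralZr//; last 3 first.
- exact/measurable_EFinP.
- by move=> x _; rewrite lee_fin.
- by apply: integral_ge0 => x _; rewrite lee_fin.
apply: eq_integral => x _; rewrite /fubini_F /=.
rewrite -(ge0_integral_reflect x (f := fun y => (k y)%:E)); last 2 first.
- exact/measurable_EFinP.
- by move=> y; rewrite lee_fin.
rewrite -ge0_integralZl//; last 3 first.
- apply/measurable_EFinP; apply: (measurableT_comp mk).
  rewrite (_ : (fun y => _) = (fun y => (-1) *: y + x)); first exact: measurable_affine_rV.
  by apply/funext => y; rewrite scaleN1r addrC.
- by move=> y _; rewrite lee_fin.
- by rewrite lee_fin.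
Qed.

Lemma ge0_integral_conv2 f k : measurable_fun setT f -> measurable_fun setT k ->
  (forall x, 0 <= f x) -> (forall x, 0 <= k x) ->
  (\int[mu \x mu]_z (f z.2 * k (z.1 - z.2))%:E =
   \int[mu]_x (f x)%:E * \int[mu]_x (k x)%:E)%E.
Proof.
move=> mf mk f0 k0; rewrite fubini_tonelli2//=; last 2 first.
- by apply/measurable_EFinP; apply: measurable_funM; [exact: measurable_fun_snd|exact: measurable_fun_diff].
- by move=> z; rewrite lee_fin mulr_ge0.
rewrite -ge0_integralZr//; last 3 first.
- exact/measurable_EFinP.
- by move=> x _; rewrite lee_fin.
- by apply: integral_ge0 => x _; rewrite lee_fin.
apply: eq_integral => y _; rewrite /fubini_G /=.
rewrite -(ge0_integral_translate (- y) (f := fun y => (k y)%:E)); last 2 first.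
- exact/measurable_EFinP.
- by move=> x; rewrite lee_fin.
rewrite -ge0_integralZl//; last 3 first.
- apply/measurable_EFinP; apply: (measurableT_comp mk).
  rewrite (_ : (fun x => _) = (fun x => 1 *: x + (- y))); first exact: measurable_affine_rV.
  by apply/funext => x; rewrite scale1r.
- by move=> x _; rewrite lee_fin.
- by rewrite lee_fin.
Qed.
End convolution.

Section kernels.
Context {R : realType} (n : nat) (s : R).
Hypotheses (n_ge1 : (1 <= n)%N) (s_gt0 : 0 < s) (s_lt1 : s < 1).
Local Notation E := 'rV[R]_n.
Local Notation mu := (lebesgue_rV n).
Local Notation c := (c_ns n s).
Local Notation b := (b_ns n s).
Local Notation kp := (kernel_plus s : E -> R).
Local Notation km := (kernel_minus s : E -> R).
Local Notation ks := (kernel_s s : E -> R).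

Lemma c_ns_gt0 : 0 < c.
Proof.
rewrite /c_ns; apply: mulr_gt0; last apply: divr_gt0.
- by rewrite !mulr_gt0// powR_gt0// pi_gt0.
- by apply: Gamma_gt0; rewrite divr_gt0// ltr_pwDr// mulr_gt0.
- by apply: Gamma_gt0; rewrite subr_gt0.
Qed.

Lemma measurable_kernel_s : measurable_fun setT ks.
Proof. apply: (measurableT_comp (measurable_powR _)); exact: measurable_enorm. Qed.

Lemma measurable_kernel_minus : measurable_fun setT km.
Proof.
apply: measurable_funM; first by apply: measurable_funM => //; exact: measurable_kernel_s.
apply: measurable_maxr => //; apply: (measurableT_comp (@measurable_ln R)); exact: measurable_enorm.
Qed.

Lemma measurable_kernel_plus : measurable_fun setT kp.
Proof.
apply: measurable_funM; first by apply: measurable_funM => //; exact: measurable_kernel_s.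
apply: measurable_maxr => //; apply: measurable_funN.
apply: (measurableT_comp (@measurable_ln R)); exact: measurable_enorm.
Qed.

Lemma kernel_s_ge0 z : 0 <= ks z. Proof. exact: powR_ge0. Qed.

Lemma kernel_minus_ge0 z : 0 <= km z.
Proof.
apply: mulr_ge0; last by rewrite le_max lexx.
by apply: mulr_ge0; [exact: ltW c_ns_gt0|exact: powR_ge0].
Qed.

Lemma kernel_plus_ge0 z : 0 <= kp z.
Proof.
apply: mulr_ge0; last by rewrite le_max lexx.
by apply: mulr_ge0; [exact: ltW c_ns_gt0|exact: powR_ge0].
Qed.

Lemma kernel_s_le z (t : R) : 0 < t -> t <= enorm z -> ks z <= t `^ (- n%:R - 2 * s).
Proof.
move=> t0 tz; rewrite /kernel_s.
have -> : - n%:R - 2 * s = - (n%:R + 2 * s) by ring.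
rewrite !powRN lef_pV2 ?posrE ?powR_gt0//; last exact: lt_le_trans tz.
by rewrite ge0_ler_powR ?nnegrE ?enorm_ge0 ?(ltW t0) ?addr_ge0 ?mulr_ge0 ?(ltW s_gt0).
Qed.

Lemma kernel_s_ge z (t : R) : 0 < enorm z -> enorm z <= t -> t `^ (- n%:R - 2 * s) <= ks z.
Proof.
move=> z0 zt; have t0 : 0 < t by exact: lt_le_trans zt.
rewrite /kernel_s.
have -> : - n%:R - 2 * s = - (n%:R + 2 * s) by ring.
rewrite !powRN lef_pV2 ?posrE ?powR_gt0//.
by rewrite ge0_ler_powR ?nnegrE ?enorm_ge0 ?(ltW t0) ?addr_ge0 ?mulr_ge0 ?(ltW s_gt0).
Qed.

Lemma kernel_plus_ge z (t : R) : 0 < enorm z -> enorm z <= t -> t < 1 ->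
  c * t `^ (- n%:R - 2 * s) * (- ln t) <= kp z.
Proof.
move=> z0 zt t1; have t0 : 0 < t by exact: lt_le_trans zt.
have lt0 : 0 <= - ln t by rewrite oppr_ge0 ln_le0 ?ltW.
apply: ler_pM => //.
- by apply: mulr_ge0; [exact: ltW c_ns_gt0|exact: powR_ge0].
- by rewrite ler_pM2l ?c_ns_gt0//; exact: kernel_s_ge.
- by rewrite le_max lerN2 ler_ln ?posrE// zt orbT.
Qed.

Lemma kernel_plus_ge_s z (t : R) : 0 < enorm z -> enorm z <= t -> t < 1 ->
  c * (- ln t) * ks z <= kp z.
Proof.
move=> z0 zt t1; have t0 : 0 < t by exact: lt_le_trans zt.
rewrite mulrAC ler_wpM2l//.
  by apply: mulr_ge0; [exact: ltW c_ns_gt0|exact: kernel_s_ge0].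
by rewrite le_max lerN2 ler_ln ?posrE// zt orbT.
Qed.

Lemma kernel_minus_eq0 z : enorm z <= 1 -> km z = 0.
Proof.
move=> z1; rewrite /kernel_minus max_l ?mulr0//; exact: ln_le0.
Qed.

Definition kernel_far (r : R) (z : E) : R := if r < enorm z then ks z else 0.

(** The [L] of the overview; with |b| for b, it dominates the far part of the s-term whatever the
    sign of b. *)
Definition kernel_err (r : R) (z : E) : R := km z + `|b| * c / 2 * kernel_far r z.

(** A nonzero power of 0 is 0 by convention, so the singular kernel vanishes at the origin. This
    settles the diagonal in comparisons with k_+, which are stated for z nonzero. *)
Lemma kernel_s0 z : enorm z = 0 -> ks z = 0.
Proof.
move=> z0; rewrite /kernel_s z0 powR0//.
by rewrite -opprD oppr_eq0 gt_eqF// ltr_wpDl// mulr_gt0.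
Qed.

Lemma kernel_sLog_ge (r : R) z : 0 < r -> r < 1 ->
  (1 - `|b| / (2 * ln (1 / r))) * kp z - kernel_err r z <= kp z - km z + b * c / 2 * ks z.
Proof.
move=> r0 r1; have lr : 0 < - ln r by rewrite oppr_gt0 ln_lt0// r0.
rewrite div1r lnV ?posrE// /kernel_err /kernel_far.
have c0 := c_ns_gt0; have kp0 := kernel_plus_ge0 z; have ks0 := kernel_s_ge0 z.
have bn : - `|b| <= b by rewrite lerNl -normrN ler_norm.
have bcs : - (`|b| * c / 2 * ks z) <= b * c / 2 * ks z.
  by rewrite -!mulNr !ler_wpM2r ?invr_ge0 ?(ltW c0).
have bk : 0 <= `|b| / (2 * - ln r) * kp z.
  by rewrite mulr_ge0// divr_ge0// mulr_ge0// ltW.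
rewrite mulrBl mul1r.
case: ltP => [rz|zr]; first lra.
rewrite mulr0 addr0; suff : `|b| * c / 2 * ks z <= `|b| / (2 * - ln r) * kp z by lra.
have [z0|z0] := eqVneq (enorm z) 0; first by rewrite kernel_s0 ?mulr0.
have zp : 0 < enorm z by rewrite lt_neqAle eq_sym z0 enorm_ge0.
have H := kernel_plus_ge_s zp zr r1.
have -> : `|b| * c / 2 * ks z = `|b| / (2 * - ln r) * (c * (- ln r) * ks z).
  by field; rewrite -oppr_eq0 gt_eqF.
by rewrite ler_wpM2l// divr_ge0// mulr_ge0// ltW.
Qed.

Lemma measurable_kernel_far r : measurable_fun setT (kernel_far r).
Proof.
apply: measurable_fun_ifT => //; last exact: measurable_kernel_s.
by apply: measurable_fun_ltr => //; exact: measurable_enorm.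
Qed.

Lemma kernel_far_ge0 r z : 0 <= kernel_far r z.
Proof. by rewrite /kernel_far; case: ifP => // _; exact: kernel_s_ge0. Qed.

Lemma measurable_kernel_err r : measurable_fun setT (kernel_err r).
Proof.
apply: measurable_funD; first exact: measurable_kernel_minus.
by apply: measurable_funM => //; exact: measurable_kernel_far.
Qed.

Lemma bc_ge0 : 0 <= `|b| * c / 2.
Proof. by rewrite divr_ge0// mulr_ge0// ltW// c_ns_gt0. Qed.

Lemma kernel_err_ge0 r z : 0 <= kernel_err r z.
Proof. by rewrite addr_ge0 ?kernel_minus_ge0// mulr_ge0 ?bc_ge0 ?kernel_far_ge0. Qed.

(** For t > 1, ln t < t <= t^(n+2s). The resulting bound on [kernel_err] serves part (ii). *)
Lemma kernel_minus_le z : km z <= c.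
Proof.
have c0 := c_ns_gt0.
have [z1|z1] := leP (enorm z) 1; first by rewrite kernel_minus_eq0 ?(ltW c0).
have z0 : 0 < enorm z by exact: lt_trans z1.
rewrite /kernel_minus -mulrA ger_pMr// max_r; last by rewrite ln_ge0 ?ltW.
have -> : - n%:R - 2 * s = - (n%:R + 2 * s) by ring.
rewrite powRN ler_pdivrMl ?powR_gt0// mulr1.
apply: (@le_trans _ _ (enorm z)); first by rewrite ltW// ln_sublinear.
rewrite -[leLHS]powRr1 ?(ltW z0)// ler_powR ?(ltW z1)//.
by rewrite (@le_trans _ _ n%:R) ?ler1n// lerDl mulr_ge0// ltW.
Qed.

Lemma kernel_err_le r z : 0 < r -> kernel_err r z <= c + `|b| * c / 2 * r `^ (- n%:R - 2 * s).
Proof.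
move=> r0; rewrite lerD ?kernel_minus_le// ler_wpM2l ?bc_ge0//.
rewrite /kernel_far; case: ltP => [rz|_]; last exact: powR_ge0.
by apply: kernel_s_le => //; exact: ltW.
Qed.

Lemma integral_kernel_far r : 0 < r ->
  (\int[mu]_z (kernel_far r z)%:E = (n%:R * omega n * r `^ (- (2 * s)) / (2 * s))%:E)%E.
Proof. by move=> r0; rewrite -ge0_integral_radial_tail// mulr_gt0. Qed.

Lemma integral_kernel_minus :
  (\int[mu]_z (km z)%:E = (c * (n%:R * omega n / (2 * s) ^+ 2))%:E)%E.
Proof.
rewrite EFinM -ge0_integral_radial_ln ?mulr_gt0//.
rewrite -ge0_integralZl_R//; last 3 first.
- apply: measurable_fun_ifT => //; first by apply: measurable_fun_ltr => //; exact: measurable_enorm.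
  apply: measurable_funM; first exact: measurable_kernel_s.
  apply: (measurableT_comp (@measurable_ln R)); exact: measurable_enorm.
- by move=> z _; case: ifP => // z1; rewrite mulr_ge0 ?powR_ge0// ln_ge0 ?ltW.
- exact: ltW c_ns_gt0.
apply: eq_integral => z _; rewrite -EFinM; congr (_%:E).
case: ltP => z1; last by rewrite kernel_minus_eq0 ?mulr0.
by rewrite /kernel_minus max_r ?mulrA// ln_ge0// ltW.
Qed.

(* The right-hand side is the lower bound on the potential in part (i). *)
Lemma integral_kernel_err r : 0 < r ->
  (4%:E * \int[mu]_z (kernel_err r z)%:E =
   (c * (n%:R * omega n) / s ^+ 2 + `|b| * c / s * (n%:R * omega n) * r `^ (- (2 * s)))%:E)%E.
Proof.
move=> r0; rewrite ge0_integralD_R//; last 4 first.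
- exact: measurable_kernel_minus.
- by move=> z _; exact: kernel_minus_ge0.
- by apply: measurable_funM => //; exact: measurable_kernel_far.
- by move=> z _; rewrite mulr_ge0 ?bc_ge0 ?kernel_far_ge0.
under [X in (_ * (_ + X))%E]eq_integral do rewrite EFinM.
rewrite integral_kernel_minus ge0_integralZl_R//; last 3 first.
- exact: measurable_kernel_far.
- by move=> z _; rewrite kernel_far_ge0.
- exact: bc_ge0.
rewrite integral_kernel_far// -[X in (_ + X)%E]EFinM -EFinD -EFinM; congr (_%:E).
by field; rewrite gt_eqF.
Qed.
End kernels.
Arguments kernel_err {R n} s r z.
Arguments kernel_far {R n} s r z.

(** * Energy forms and the space H *)

Section Lfun_facts.
Context d (T : measurableType d) (R : realType) (m : {measure set T -> \bar R}).
Implicit Types f g : T -> R.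

Lemma Lfun_finiteE (q : R) f : 0 < q ->
  f \in Lfun m q%:E <->
  measurable_fun setT f /\ (\int[m]_x (`|f x| `^ q)%:E < +oo)%E.
Proof.
move=> q0; have E : (\int[m]_x (`|f x| `^ q)%:E = 'N[m]_q%:E[EFin \o f] `^ q)%E.
  by rewrite poweR_Lnorm ?gt_eqF//; apply: eq_integral => x _.
rewrite E inE; split.
  by move=> /andP[/[!inE]/= mf lf]; split=> //; exact: poweR_lty.
move=> [mf lf]; apply/andP; split; rewrite inE//=.
by apply: (@lty_poweRy _ _ q); rewrite ?gt_eqF.
Qed.

Lemma Lfun2E f : f \in Lfun m 2%:E <->
  measurable_fun setT f /\ (\int[m]_x (f x ^+ 2)%:E < +oo)%E.
Proof.
rewrite Lfun_finiteE//; under eq_integral do rewrite powR_mulrn// -normrX ger0_norm ?sqr_ge0//.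
by [].
Qed.

Lemma Lfun_ooP f : f \in Lfun m +oo%E ->
  measurable_fun setT f /\ exists M : R, 0 <= M /\ {ae m, forall x, `|f x| <= M}.
Proof.
rewrite inE => /andP[/[!inE]/= mf]; rewrite /finite_norm unlock /= => sf; split => //; move: sf.
(* On a null space the L^oo norm is 0 by definition and carries no information, but there every
   property holds almost everywhere. *)
case: ifPn => [m0 sup_lt|m0 _]; last first.
  exists 0; split => //; exists setT; split => //.
  by apply/eqP; rewrite eq_le measure_ge0 leNgt m0.
have [M supM] : exists M : R, (ess_sup m (abse \o (EFin \o f)) <= M%:E)%E.
  by case: (ess_sup _ _) sup_lt => [M _| |_] //; [exists M|exists 0; rewrite leNye].
exists (Num.max 0 M); split; first by rewrite le_max lexx.
have /ess_supP := supM; apply: filterS => x /=.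
by rewrite lee_fin le_max => ->; rewrite orbT.
Qed.

Lemma Lfun_ooI f (M : R) : measurable_fun setT f -> {ae m, forall x, `|f x| <= M} ->
  f \in Lfun m +oo%E.
Proof.
move=> mf fM; rewrite inE; apply/andP; split; rewrite inE//= /finite_norm unlock /=.
case: ifPn => // _; apply: (@le_lt_trans _ _ M%:E); last exact: ltry.
by apply/ess_supP; apply: filterS fM => x /=; rewrite lee_fin.
Qed.

Lemma ae_le_integrable f g : measurable_fun setT f ->
  {ae m, forall x, `|f x| <= g x} -> m.-integrable setT (EFin \o g) ->
  m.-integrable setT (EFin \o f).
Proof.
move=> mf fg /integrableP[mg ig]; apply/integrableP; split; first exact/measurable_EFinP.
apply: le_lt_trans ig; apply: ae_ge0_le_integral => //.
- by apply: measurableT_comp => //; exact/measurable_EFinP.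
- exact: measurableT_comp.
- by apply: filterS fg => x fgx _ /=; rewrite lee_fin (le_trans fgx)// ler_norm.
Qed.

Lemma ge0_integrable f : measurable_fun setT f -> (forall x, 0 <= f x) ->
  (\int[m]_x (f x)%:E < +oo)%E -> m.-integrable setT (EFin \o f).
Proof.
move=> mf f0 fi; apply/integrableP; split; first exact/measurable_EFinP.
apply: le_lt_trans fi; rewrite le_eqVlt; apply/orP; left; apply/eqP.
by apply: eq_integral => x _ /=; rewrite ger0_norm.
Qed.
End Lfun_facts.

Section energies.
Context {R : realType} (n : nat).
Local Notation E := 'rV[R]_n.
Local Notation mu := (lebesgue_rV n).
Implicit Types u w v k : E -> R.

Definition dprod u w (z : E * E) : R := (u z.1 - u z.2) * (w z.1 - w z.2).

Lemma measurable_dprod u w : measurable_fun setT u -> measurable_fun setT w ->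
  measurable_fun setT (dprod u w).
Proof.
move=> mu_ mw; apply: measurable_funM; apply: measurable_funB;
  first [exact: measurable_fun_fst|exact: measurable_fun_snd].
Qed.

Lemma measurable_dprod_kernel u w k : measurable_fun setT u -> measurable_fun setT w ->
  measurable_fun setT k ->
  measurable_fun setT (fun z : E * E => dprod u w z * k (z.1 - z.2)).
Proof.
move=> mu_ mw mk; apply: measurable_funM; first exact: measurable_dprod.
exact: measurable_fun_diff.
Qed.

Lemma dprod_ge0 u z : 0 <= dprod u u z.
Proof. by rewrite /dprod -expr2 sqr_ge0. Qed.

Lemma energyE k u w : energy k u w = (\int[mu \x mu]_z (dprod u w z * k (z.1 - z.2))%:E)%E.
Proof. by []. Qed.

Lemma energy_ge0 k u : (forall x, 0 <= k x) -> (0 <= energy k u u)%E.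
Proof. by move=> k0; apply: integral_ge0 => z _; rewrite lee_fin mulr_ge0 ?dprod_ge0. Qed.

Lemma energy_le k k' u w u' w' :
  measurable_fun setT u -> measurable_fun setT w -> measurable_fun setT k ->
  measurable_fun setT u' -> measurable_fun setT w' -> measurable_fun setT k' ->
  (forall z, 0 <= dprod u w z * k (z.1 - z.2) <= dprod u' w' z * k' (z.1 - z.2)) ->
  (energy k u w <= energy k' u' w')%E.
Proof.
move=> mu_ mw mk mu' mw' mk' H; apply: ge0_le_integral => //.
- by move=> z _; rewrite lee_fin; have /andP[] := H z.
- by apply/measurable_EFinP; exact: measurable_dprod_kernel.
- by apply/measurable_EFinP; exact: measurable_dprod_kernel.
- by move=> z _; rewrite lee_fin; have /andP[] := H z.
Qed.

(** From (a - b)^2 <= 2 a^2 + 2 b^2: each of the two terms integrates to |u|_2^2 times the integral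
    of k. The factor 4 is the one that enters the lower bound on V. *)
Lemma energy_le_L2 k u : measurable_fun setT u -> measurable_fun setT k ->
  (forall x, 0 <= k x) ->
  (energy k u u <= 4%:E * \int[mu]_x (k x)%:E * \int[mu]_x (u x ^+ 2)%:E)%E.
Proof.
move=> mu_ mk k0.
have mu2 : measurable_fun setT (fun x => u x ^+ 2) by exact: measurable_funX.
have u20 x : 0 <= u x ^+ 2 by exact: sqr_ge0.
have mk' := measurable_fun_diff mk.
have m1 : measurable_fun setT (fun z : E * E => u z.1 ^+ 2 * k (z.1 - z.2)).
  by apply: measurable_funM => //; exact: (measurable_fun_fst mu2).
have m2 : measurable_fun setT (fun z : E * E => u z.2 ^+ 2 * k (z.1 - z.2)).
  by apply: measurable_funM => //; exact: (measurable_fun_snd mu2).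
have p1 (z : E * E) : 0 <= u z.1 ^+ 2 * k (z.1 - z.2) by exact: mulr_ge0.
have p2 (z : E * E) : 0 <= u z.2 ^+ 2 * k (z.1 - z.2) by exact: mulr_ge0.
apply: (@le_trans _ _ (\int[mu \x mu]_z (2%:E * (u z.1 ^+ 2 * k (z.1 - z.2) + u z.2 ^+ 2 * k (z.1 - z.2))%:E))%E).
  apply: ge0_le_integral => //.
  - by move=> z _; rewrite lee_fin mulr_ge0 ?dprod_ge0.
  - by apply/measurable_EFinP; exact: measurable_dprod_kernel.
  - by apply/measurable_EFinP; apply: measurable_funM => //; exact: measurable_funD.
  - move=> z _; rewrite -EFinM lee_fin -mulrDl mulrA ler_wpM2r// /dprod.
    rewrite -subr_ge0 (_ : _ - _ = (u z.1 + u z.2) ^+ 2) ?sqr_ge0//; ring.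
rewrite ge0_integralZl_R//; last 2 first.
- exact: measurable_funD.
- by move=> z _; rewrite addr_ge0 ?p1 ?p2.
rewrite ge0_integralD_R//.
rewrite (ge0_integral_conv1 mu2 mk)// (ge0_integral_conv2 mu2 mk)//.
set A := (\int[mu]_x _)%E; set B := (\int[mu]_x (k x)%:E)%E.
rewrite (_ : (4%:E * B * A = 2%:E * (2%:E * (A * B)))%E); last first.
  by rewrite [RHS]muleA -EFinM (muleC A) muleA; congr (_%:E * _ * _)%E; ring.
suff -> : (2%:E * (A * B) = A * B + A * B)%E by [].
by rewrite -[2]/(1 + 1) EFinD ge0_muleDl ?lee_fin// !mul1e.
Qed.

Lemma energy_integrable k u w : measurable_fun setT u -> measurable_fun setT w ->
  measurable_fun setT k -> (forall x, 0 <= k x) ->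
  (energy k u u < +oo)%E -> (energy k w w < +oo)%E ->
  (mu \x mu)%E.-integrable setT (fun z => (dprod u w z * k (z.1 - z.2))%:E).
Proof.
move=> mu_ mw mk k0 eu ew.
have ii v : measurable_fun setT v -> (energy k v v < +oo)%E ->
   (mu \x mu)%E.-integrable setT (EFin \o (fun z => dprod v v z * k (z.1 - z.2))).
  move=> mv ev; apply: ge0_integrable => //; first exact: measurable_dprod_kernel.
  by move=> z; rewrite mulr_ge0// dprod_ge0.
apply: (le_integrable _ _ _ (integrableD _ (ii u mu_ eu) (ii w mw ew))) => //.
- by apply/measurable_EFinP; exact: measurable_dprod_kernel.
- move=> z _ /=; rewrite lee_fin -mulrDl !normrM ler_wpM2r// /dprod -!normrM.
  rewrite ler_norml ger0_norm -?expr2 ?addr_ge0 ?sqr_ge0//.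
  have := sqr_ge0 (u z.1 - u z.2 + (w z.1 - w z.2)).
  have := sqr_ge0 (u z.1 - u z.2 - (w z.1 - w z.2)).
  have := sqr_ge0 (u z.1 - u z.2).
  have := sqr_ge0 (w z.1 - w z.2).
  rewrite !expr2 => ? ? ? ?; apply/andP; split; nra.
Qed.

Definition kform k u w : R := fine (energy k u w).

Lemma kformC k u w : kform k u w = kform k w u.
Proof.
by congr fine; apply: eq_integral => z _; congr EFin; congr (_ * _); rewrite mulrC.
Qed.

Lemma lin_funE a u w x : (a *: u + w) x = a * u x + w x.
Proof. by []. Qed.

Lemma kformDl k a u w v :
  (mu \x mu)%E.-integrable setT (fun z => (dprod u v z * k (z.1 - z.2))%:E) ->
  (mu \x mu)%E.-integrable setT (fun z => (dprod w v z * k (z.1 - z.2))%:E) ->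
  kform k (a *: u + w) v = a * kform k u v + kform k w v.
Proof.
move=> iu iw; have iau := integrableZl measurableT a iu.
rewrite -RintegralZl// -RintegralD//.
congr fine; apply: eq_integral => z _; congr EFin.
by rewrite !lin_funE; ring.
Qed.

Lemma energy_add k a u w : measurable_fun setT u -> measurable_fun setT w ->
  measurable_fun setT k -> (forall x, 0 <= k x) ->
  (energy k u u < +oo)%E -> (energy k w w < +oo)%E ->
  (energy k (a *: u + w)%R (a *: u + w)%R < +oo)%E.
Proof.
move=> mu_ mw mk k0 eu ew.
have i1 := energy_integrable mu_ mu_ mk k0 eu eu.
have i2 := energy_integrable mu_ mw mk k0 eu ew.
have i3 := energy_integrable mw mw mk k0 ew ew.
have i : (mu \x mu)%E.-integrable setT (fun z => (dprod (a *: u + w)%R (a *: u + w)%R z * k (z.1 - z.2))%:E).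
  apply: (@eq_integrable _ _ _ _ _ _ (fun z => (a ^+ 2)%:E * (dprod u u z * k (z.1 - z.2))%:E + ((2 * a)%:E * (dprod u w z * k (z.1 - z.2))%:E + (dprod w w z * k (z.1 - z.2))%:E))%E) => //.
    move=> z _; rewrite -!EFinM -!EFinD; congr EFin; rewrite /dprod !lin_funE; ring.
  apply: integrableD => //; first exact: integrableZl.
  by apply: integrableD => //; exact: integrableZl.
exact: integrable_lty i.
Qed.
End energies.

(** * The space H and the quadratic forms on it *)

Section space.
Context {R : realType} (n : nat) (s : R) (Omega : set 'rV[R]_n).
Hypotheses (n_ge1 : (1 <= n)%N) (s_gt0 : 0 < s) (s_lt1 : s < 1).
Local Notation E := 'rV[R]_n.
Local Notation mu := (lebesgue_rV n).
Local Notation c := (c_ns n s).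
Local Notation b := (b_ns n s).
Local Notation kp := (kernel_plus s : E -> R).
Local Notation km := (kernel_minus s : E -> R).
Local Notation ks := (kernel_s s : E -> R).
Local Notation H := (H0sLog s Omega).
Implicit Types u w v : E -> R.

Lemma H_measurable u : H u -> measurable_fun setT u.
Proof. by case=> /Lfun2E[]. Qed.

Lemma H_L2 u : H u -> (\int[mu]_x (u x ^+ 2)%:E < +oo)%E.
Proof. by case=> /Lfun2E[]. Qed.

Lemma energy_lty_L1 (k : E -> R) u : measurable_fun setT k -> (forall x, 0 <= k x) ->
  (\int[mu]_x (k x)%:E < +oo)%E -> H u -> (energy k u u < +oo)%E.
Proof.
move=> mk k0 ik Hu; apply: le_lt_trans (energy_le_L2 (H_measurable Hu) mk k0) _.
apply: lte_mul_pinfty; last exact: H_L2.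
  by rewrite mule_ge0//; apply: integral_ge0 => x _; rewrite lee_fin.
rewrite ge0_fin_numE; first by rewrite lte_mul_pinfty.
by rewrite mule_ge0//; apply: integral_ge0 => x _; rewrite lee_fin.
Qed.

Lemma H_energy_plus u : H u -> (energy kp u u < +oo)%E.
Proof. by case. Qed.

Lemma H_energy_minus u : H u -> (energy km u u < +oo)%E.
Proof.
apply: energy_lty_L1; first exact: measurable_kernel_minus.
  exact: kernel_minus_ge0.
by rewrite integral_kernel_minus// ltry.
Qed.

Lemma H_energy_far r u : 0 < r -> H u -> (energy (kernel_far s r) u u < +oo)%E.
Proof.
move=> r0; apply: energy_lty_L1; first exact: measurable_kernel_far.
  exact: kernel_far_ge0.
by rewrite integral_kernel_far// ltry.
Qed.

Lemma H_energy_err r u : 0 < r -> H u -> (energy (kernel_err s r) u u < +oo)%E.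
Proof.
move=> r0; apply: energy_lty_L1; first exact: measurable_kernel_err.
  exact: kernel_err_ge0.
have := integral_kernel_err n s_gt0 s_lt1 r0.
case: (\int[mu]_z _)%E => [x _||]; first exact: ltry.
  by rewrite mulry gtr0_sg// mul1e.
by [].
Qed.

(** The kernel of E_s is split at radius 1/2: inside, -ln |z| >= ln 2 and k_+ dominates; outside,
    the kernel is integrable. Thus finiteness of E_+, which is what membership in H provides,
    entails that of E_s. *)
Lemma energy_s_le u : H u ->
  (energy ks u u <= ((c * (- ln 2^-1))^-1)%:E * energy kp u u + energy (kernel_far s 2^-1) u u)%E.
Proof.
move=> Hu; have mu_ := H_measurable Hu.
have h0 : 0 < 2^-1 :> R by rewrite invr_gt0.
have h1 : 2^-1 < 1 :> R by rewrite invf_lt1// ltr1n.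
have mp := measurable_kernel_plus s (n := n) (R := R).
have mf := measurable_kernel_far s (n := n) (2^-1 : R).
set a := (c * (- ln 2^-1))^-1.
have a0 : 0 < c * (- ln 2^-1).
  by rewrite mulr_gt0 ?c_ns_gt0// oppr_gt0 ln_lt0// h0 h1.
apply: (@le_trans _ _ (energy (fun z => a * kp z + kernel_far s 2^-1 z) u u)).
  apply: energy_le => //; first exact: measurable_kernel_s.
    by apply: measurable_funD => //; exact: measurable_funM.
  move=> [x y] /=; rewrite mulr_ge0 ?dprod_ge0 ?kernel_s_ge0//= ler_wpM2l ?dprod_ge0//.
  set z := x - y; rewrite /kernel_far; have kp0 : 0 <= kp z by exact: kernel_plus_ge0.
  case: ltP => [_|zh]; first by rewrite lerDr mulr_ge0// invr_ge0 ltW.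
  have [z0|z0] := eqVneq (enorm z) 0.
    by rewrite kernel_s0// addr0 mulr_ge0// invr_ge0 ltW.
  rewrite addr0 /a ler_pdivlMl//; apply: kernel_plus_ge_s => //.
  by rewrite lt_neqAle eq_sym z0 enorm_ge0.
rewrite energyE.
rewrite (eq_integral (fun z => (a * (dprod u u z * kp (z.1 - z.2)) + dprod u u z * kernel_far s 2^-1 (z.1 - z.2))%:E)); last first.
  by move=> z _; congr EFin; ring.
have mP := measurable_dprod_kernel mu_ mu_ mp.
have mQ := measurable_dprod_kernel mu_ mu_ mf.
have P0 z : 0 <= dprod u u z * kp (z.1 - z.2) by rewrite mulr_ge0 ?dprod_ge0 ?kernel_plus_ge0.
rewrite ge0_integralD_R//; last 3 first.
- exact: measurable_funM.
- by move=> z _; rewrite mulr_ge0// invr_ge0 ltW.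
- by move=> z _; rewrite mulr_ge0 ?dprod_ge0 ?kernel_far_ge0.
under eq_integral do rewrite EFinM.
by rewrite ge0_integralZl_R//; rewrite invr_ge0 ltW.
Qed.

Lemma H_energy_s u : H u -> (energy ks u u < +oo)%E.
Proof.
move=> Hu; apply: le_lt_trans (energy_s_le Hu) _.
apply: lte_add_pinfty; last by apply: H_energy_far => //; rewrite invr_gt0.
rewrite lte_mul_pinfty ?H_energy_plus// lee_fin invr_ge0 mulr_ge0 ?(ltW (c_ns_gt0 _ _ _))//.
by rewrite oppr_ge0 ln_le0// invf_le1// ler1n.
Qed.

Lemma H_integrable_plus u w : H u -> H w ->
  (mu \x mu)%E.-integrable setT (fun z => (dprod u w z * kp (z.1 - z.2))%:E).
Proof.
move=> Hu Hw; apply: energy_integrable; do ?exact: H_measurable; do ?exact: H_energy_plus.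
  exact: measurable_kernel_plus.
exact: kernel_plus_ge0.
Qed.

Lemma H_integrable_minus u w : H u -> H w ->
  (mu \x mu)%E.-integrable setT (fun z => (dprod u w z * km (z.1 - z.2))%:E).
Proof.
move=> Hu Hw; apply: energy_integrable; do ?exact: H_measurable; do ?exact: H_energy_minus.
  exact: measurable_kernel_minus.
exact: kernel_minus_ge0.
Qed.

Lemma H_integrable_s u w : H u -> H w ->
  (mu \x mu)%E.-integrable setT (fun z => (dprod u w z * ks (z.1 - z.2))%:E).
Proof.
move=> Hu Hw; apply: energy_integrable; do ?exact: H_measurable; do ?exact: H_energy_s.
  exact: measurable_kernel_s.
exact: kernel_s_ge0.
Qed.

Lemma H_integrable_err r u w : 0 < r -> H u -> H w ->
  (mu \x mu)%E.-integrable setT (fun z => (dprod u w z * kernel_err s r (z.1 - z.2))%:E).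
Proof.
move=> r0 Hu Hw; apply: energy_integrable; do ?exact: H_measurable; do ?exact: H_energy_err.
  exact: measurable_kernel_err.
exact: kernel_err_ge0.
Qed.

Lemma H_lin a u w : H u -> H w -> H (a *: u + w).
Proof.
move=> Hu Hw; have mu_ := H_measurable Hu; have mw := H_measurable Hw; split.
- apply/Lfun2E; split; first by apply: measurable_funD => //; exact: measurable_funM.
  have i u' : H u' -> mu.-integrable setT (EFin \o (fun x => u' x ^+ 2)).
    by case=> /Lfun2_integrable_sqr.
  have mG : measurable_fun setT (fun x => 2 * a ^+ 2 * u x ^+ 2 + 2 * w x ^+ 2).
    by apply: measurable_funD; apply: measurable_funM => //; exact: measurable_funX.
  apply: (@le_lt_trans _ _ (\int[mu]_x (2 * a ^+ 2 * u x ^+ 2 + 2 * w x ^+ 2)%:E)%E).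
    apply: ge0_le_integral => //.
    + by move=> x _; rewrite lee_fin sqr_ge0.
    + apply/measurable_EFinP; apply: measurable_funX; apply: measurable_funD => //; exact: measurable_funM.
    + exact/measurable_EFinP.
    + move=> x _; rewrite lee_fin lin_funE -subr_ge0.
      by rewrite (_ : _ - _ = (a * u x - w x) ^+ 2) ?sqr_ge0//; ring.
  apply: integrable_lty => //.
  apply: (integrableD measurableT (integrableZl measurableT (2 * a ^+ 2) (i u Hu)) (integrableZl measurableT 2 (i w Hw))).
- apply: energy_add => //; [exact: measurable_kernel_plus|exact: kernel_plus_ge0|exact: H_energy_plus|exact: H_energy_plus].
- case: Hu => _ _ u0; case: Hw => _ _ w0; apply: filterS2 u0 w0 => x ux wx nOx.
  by rewrite lin_funE ux// wx// mulr0 addr0.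
Qed.

Lemma H_zero : H 0.
Proof.
split.
- apply/Lfun2E; split; first exact: measurable_cst.
  by under eq_integral do rewrite expr0n /=; rewrite integral0.
- rewrite energyE (eq_integral (cst 0%E)) ?integral0// => z _.
  by rewrite /dprod subrr !mul0r.
- by apply: aeW.
Qed.

Lemma H_opp u : H u -> H (- u).
Proof. by move=> Hu; have := H_lin (-1) Hu H_zero; rewrite scaleN1r addr0. Qed.

Lemma form_plus_lin a u w v : H u -> H w -> H v ->
  form_plus s (a *: u + w) v = a * form_plus s u v + form_plus s w v.
Proof. by move=> Hu Hw Hv; exact: (kformDl a (H_integrable_plus Hu Hv) (H_integrable_plus Hw Hv)). Qed.

Lemma form_plusC u w : form_plus s u w = form_plus s w u. Proof. exact: kformC. Qed.

Lemma form_sLogC u w : form_sLog s u w = form_sLog s w u.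
Proof. by rewrite /form_sLog; congr (_ - _ + _ * _); exact: kformC. Qed.

Lemma form_sLog_lin a u w v : H u -> H w -> H v ->
  form_sLog s (a *: u + w) v = a * form_sLog s u v + form_sLog s w v.
Proof.
move=> Hu Hw Hv; rewrite /form_sLog form_plus_lin//.
rewrite [form_minus s _ _](kformDl a (H_integrable_minus Hu Hv) (H_integrable_minus Hw Hv)).
rewrite [form_s s _ _](kformDl a (H_integrable_s Hu Hv) (H_integrable_s Hw Hv)).
rewrite -![kform km _ _]/(form_minus s _ _) -![kform ks _ _]/(form_s s _ _); ring.
Qed.

Lemma form_plus_ge0 u : 0 <= form_plus s u u.
Proof. by apply: fine_ge0; apply: energy_ge0 => x; exact: kernel_plus_ge0. Qed.

(** The pointwise inequality between the kernels may be multiplied by [dprod u w] when this is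
    nonnegative. Part (i) takes w = u, part (ii) takes for w a truncation of u. *)
Lemma form_sLog_ge r u w : 0 < r -> r < 1 -> H u -> H w ->
  (forall z, 0 <= dprod u w z) ->
  (1 - `|b| / (2 * ln (1 / r))) * form_plus s u w - kform (kernel_err s r) u w
  <= form_sLog s u w.
Proof.
move=> r0 r1 Hu Hw P0; set al := 1 - _.
have ip := H_integrable_plus Hu Hw; have im := H_integrable_minus Hu Hw.
have is_ := H_integrable_s Hu Hw; have ie := H_integrable_err r0 Hu Hw.
have iap := integrableZl measurableT al ip.
have ias := integrableZl measurableT (b * c / 2) is_.
have := @le_Rintegral _ _ _ (mu \x mu)%E setT
  (fun z => al * (dprod u w z * kp (z.1 - z.2)) - dprod u w z * kernel_err s r (z.1 - z.2))
  (fun z => dprod u w z * kp (z.1 - z.2) - dprod u w z * km (z.1 - z.2) + b * c / 2 * (dprod u w z * ks (z.1 - z.2))) measurableT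
  (integrableB measurableT iap ie) (integrableD measurableT (integrableB measurableT ip im) ias).
rewrite (RintegralB measurableT iap ie) (RintegralD measurableT (integrableB measurableT ip im) ias).
rewrite (RintegralB measurableT ip im) (RintegralZl _ measurableT ip) (RintegralZl _ measurableT is_); apply.
move=> z _; have := kernel_sLog_ge s_gt0 s_lt1 (z.1 - z.2) r0 r1.
rewrite -/al => /(ler_wpM2l (P0 z)); rewrite -subr_ge0 => h; rewrite -subr_ge0.
by move: h; congr (0 <= _); ring.
Qed.
End space.

Section ae_energy.
Context {R : realType} (n : nat).
Local Notation E := 'rV[R]_n.
Local Notation mu := (lebesgue_rV n).

Lemma ae_prod (P : E -> Prop) : {ae mu, forall x, P x} ->
  {ae (mu \x mu)%E, forall z : E * E, P z.1 /\ P z.2}.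
Proof.
move=> [N [mN N0 PN]].
have null (A B : set E) : measurable A -> measurable B ->
    mu A = 0%E \/ mu B = 0%E -> (mu \x mu)%E (A `*` B) = 0%E.
  move=> mA mB [|] e; rewrite [LHS]product_measure1E//.
    by rewrite [X in (X * _)%E]e mul0e.
  by rewrite [X in (_ * X)%E]e mule0.
exists ((N `*` setT) `|` (setT `*` N)); split.
- by apply: measurableU; exact: measurableX.
- rewrite measureU0; [|exact: measurableX|exact: measurableX|by apply: null; auto].
  by apply: null; auto.
move=> [x y] /= /not_andP[] nP; [left|right]; split => //=; exact: PN.
Qed.

Lemma energy_ae (k u w : E -> R) : measurable_fun setT u -> measurable_fun setT w ->
  measurable_fun setT k -> {ae mu, forall x, u x = w x} ->
  energy k u u = energy k w w.
Proof.
move=> mu_ mw mk uw; apply: ae_eq_integral => //.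
- by apply/measurable_EFinP; exact: (measurable_dprod_kernel mu_ mu_ mk).
- by apply/measurable_EFinP; exact: (measurable_dprod_kernel mw mw mk).
- by apply: filterS (ae_prod uw) => z [/= -> ->].
Qed.
End ae_energy.

(** * Poincare and Faber-Krahn inequalities *)

Section shift_difference.
Context {R : realType} (n : nat).
Local Notation E := 'rV[R]_n.
Local Notation mu := (lebesgue_rV n).
Variable u : E -> R.
Hypothesis mu_ : measurable_fun setT u.

Definition shift_diff (h : E) : \bar R := (\int[mu]_x ((u x - u (x - h)) ^+ 2)%:E)%E.

Lemma measurable_shift (h : E) : measurable_fun setT (fun x : E => u (x - h)).
Proof.
apply: (measurableT_comp mu_).
rewrite (_ : (fun x => _) = (fun x => 1 *: x + (- h))); first exact: measurable_affine_rV.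
by apply/funext => x; rewrite scale1r.
Qed.

Lemma measurable_shift_sqr (h : E) : measurable_fun setT (fun x : E => (u x - u (x - h)) ^+ 2).
Proof. by apply: measurable_funX; apply: measurable_funB => //; exact: measurable_shift. Qed.

(** k_+ sees only shifts shorter than 1, whereas moving Omega off itself may need a long one; long
    shifts are reached by repeated doubling, at the cost of a factor 4 each time. *)
Lemma shift_diff_double h : (shift_diff (2 *: h)%R <= 4%:E * shift_diff h)%E.
Proof.
have m1 := measurable_shift_sqr h; have m2 := measurable_shift_sqr (2 *: h).
have m3 : measurable_fun setT (fun x : E => (u (x - h) - u (x - h - h)) ^+ 2).
  apply: measurable_funX; apply: measurable_funB; first exact: measurable_shift.
  by rewrite (_ : (fun x => _) = (fun x => u (x - (h + h)))); [exact: measurable_shift|apply/funext => x; rewrite opprD addrA].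
apply: (@le_trans _ _ (\int[mu]_x (2 * (u x - u (x - h)) ^+ 2 + 2 * (u (x - h) - u (x - h - h)) ^+ 2)%:E)%E).
  apply: ge0_le_integral => //.
  - by move=> x _; rewrite lee_fin sqr_ge0.
  - exact/measurable_EFinP.
  - by apply/measurable_EFinP; apply: measurable_funD; exact: measurable_funM.
  - move=> x _; rewrite lee_fin -subr_ge0.
    have -> : x - 2 *: h = x - h - h by rewrite scaler_nat mulr2n opprD addrA.
    by rewrite (_ : _ - _ = (u x - u (x - h) - (u (x - h) - u (x - h - h))) ^+ 2) ?sqr_ge0//; ring.
rewrite ge0_integralD_R//; last 4 first.
- exact: measurable_funM.
- by move=> x _; rewrite mulr_ge0// sqr_ge0.
- exact: measurable_funM.
- by move=> x _; rewrite mulr_ge0// sqr_ge0.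
under eq_integral do rewrite EFinM.
under [X in (_ + X)%E]eq_integral do rewrite EFinM.
rewrite !ge0_integralZl_R//; last 2 first.
- by move=> x _; rewrite sqr_ge0.
- by move=> x _; rewrite sqr_ge0.
rewrite (@ge0_integral_translate _ _ (- h) (fun x => ((u x - u (x - h)) ^+ 2)%:E)); last 2 first.
- exact/measurable_EFinP.
- by move=> x; rewrite lee_fin sqr_ge0.
rewrite -/(shift_diff h) -ge0_muleDl ?lee_fin// -EFinD.
by rewrite (_ : 2 + 2 = 4 :> R)//; ring.
Qed.

Lemma shift_diff_pow k (h : E) : (shift_diff (2 ^+ k *: h)%R <= (4 ^+ k)%:E * shift_diff h)%E.
Proof.
elim: k => [|k IH]; first by rewrite !expr0 scale1r mul1e.
rewrite !exprS -scalerA (le_trans (shift_diff_double _))//.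
by rewrite EFinM -muleA lee_pmul2l.
Qed.

(** Substitution y = x - h, then Tonelli. *)
Lemma energy_shift_diff (k : E -> R) : measurable_fun setT k -> (forall x, 0 <= k x) ->
  energy k u u = (\int[mu]_h ((k h)%:E * shift_diff h))%E.
Proof.
move=> mk k0.
pose G (z : E * E) := ((k z.2) * (u z.1 - u (z.1 - z.2)) ^+ 2)%:E.
have mG : measurable_fun setT G.
  apply/measurable_EFinP; apply: measurable_funM; first exact: (measurable_fun_snd mk).
  apply: measurable_funX; apply: measurable_funB; [exact: (measurable_fun_fst mu_)|exact: (measurable_fun_diff mu_)].
have G0 z : (0 <= G z)%E by rewrite lee_fin mulr_ge0 ?sqr_ge0.
have me := measurable_dprod_kernel mu_ mu_ mk.
transitivity (\int[mu]_x \int[mu]_h G (x, h))%E.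
  rewrite energyE fubini_tonelli1//=; last 2 first.
  - exact/measurable_EFinP.
  - by move=> z; rewrite lee_fin mulr_ge0 ?dprod_ge0.
  apply: eq_integral => x _; rewrite /fubini_F /=.
  rewrite -[LHS](@ge0_integral_reflect _ _ x); last 2 first.
  - by apply/measurable_EFinP; apply: (measurableT_comp me).
  - by move=> z; rewrite lee_fin mulr_ge0 ?dprod_ge0.
  apply: eq_integral => h _; rewrite /G /dprod /=.
  have -> : x - (x - h) = h by rewrite opprB addrC subrK.
  by congr EFin; ring.
rewrite fubini_tonelli//; apply: eq_integral => h _; rewrite /G /shift_diff /=.
under eq_integral do rewrite EFinM.
rewrite ge0_integralZl_R//; first exact: measurable_shift_sqr.
by move=> x _; rewrite sqr_ge0.
Qed.

Lemma measurable_shift_diff : measurable_fun setT shift_diff.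
Proof.
pose G (z : E * E) := ((u z.1 - u (z.1 - z.2)) ^+ 2)%:E.
have mG : measurable_fun setT G.
  apply/measurable_EFinP.
  apply: measurable_funX; apply: measurable_funB; [exact: (measurable_fun_fst mu_)|exact: (measurable_fun_diff mu_)].
have G0 z : (0 <= G z)%E by rewrite lee_fin sqr_ge0.
exact: (measurable_fun_fubini_tonelli_G G mG G0).
Qed.

Lemma shift_diff_ge0 h : (0 <= shift_diff h)%E.
Proof. by apply: integral_ge0 => x _; rewrite lee_fin sqr_ge0. Qed.
End shift_difference.

Section poincare.
Context {R : realType} (n : nat) (s : R) (Omega : set 'rV[R]_n).
Hypotheses (n_ge1 : (1 <= n)%N) (s_gt0 : 0 < s) (s_lt1 : s < 1).
Hypothesis mOmega : measurable Omega.
Local Notation E := 'rV[R]_n.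
Local Notation mu := (lebesgue_rV n).
Local Notation c := (c_ns n s).
Local Notation kp := (kernel_plus s : E -> R).
Local Notation H := (H0sLog s Omega).

(* If h is in the box B, translation by [2^k h] moves Omega off itself, so that
   |u|_2^2 <= |u - u(. - 2^k h)|_2^2 <= 4^k |u - u(. - h)|_2^2; integrate over B against k_+. *)
Lemma poincare (M : R) : 0 < M -> (forall x, Omega x -> forall i, `|x ord0 i| <= M) ->
  exists2 C : R, 0 < C & forall u, H u ->
    (\int[mu]_x (u x ^+ 2)%:E <= C%:E * energy kp u u)%E.
Proof.
(* On the box [B] every coordinate is at least [a], and |h| <= n (2 a) = 1/2, where k_+ is at least
   [kap]. *)
move=> M0 OM; pose a : R := (4 * n%:R)^-1.
have n0 : 0 < n%:R :> R by rewrite ltr0n.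
have a0 : 0 < a by rewrite invr_gt0 mulr_gt0.
pose B : set E := [set h | forall i, a <= h ord0 i <= a + a].
have mB : measurable B by exact: measurable_box.
have muB : mu B = (a ^+ n)%:E by rewrite lebesgue_box ?addrK// lerDl ltW.
(* Each coordinate of 2^k h then exceeds 2 M, which bounds the width of Omega. *)
have [k kM] : exists k : nat, 2 * M < 2 ^+ k * a.
  exists (Num.truncn (2 * M / a)).+1; rewrite -ltr_pdivrMr//.
  apply: (lt_trans (truncnS_gt _)); rewrite -natrX ltr_nat; exact: ltn_expl.
pose kap := c * 2^-1 `^ (- n%:R - 2 * s) * (- ln 2^-1).
have h0 : 0 < 2^-1 :> R by rewrite invr_gt0.
have h1 : 2^-1 < 1 :> R by rewrite invf_lt1// ltr1n.
have kap0 : 0 < kap.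
  apply: mulr_gt0; first by apply: mulr_gt0; [exact: c_ns_gt0|exact: powR_gt0].
  by rewrite oppr_gt0 ln_lt0// h0 h1.
have kapB h : B h -> kap <= kp h.
  move=> Bh; apply: kernel_plus_ge => //.
    apply: (@lt_le_trans _ _ `|h ord0 (Ordinal n_ge1)|); last exact: coord_le_enorm.
    by rewrite normr_gt0 gt_eqF// (lt_le_trans a0)//; have /andP[] := Bh (Ordinal n_ge1).
  apply: (le_trans (enorm_le_coord (a := a + a) _ _)); first by rewrite addr_ge0// ltW.
    by move=> i; have /andP[h2 h3] := Bh i; rewrite ger0_norm// (le_trans (ltW a0)).
  by rewrite /a le_eqVlt; apply/orP; left; apply/eqP; field; rewrite gt_eqF.
exists (4 ^+ k / (kap * a ^+ n)).
  by rewrite divr_gt0// ?exprn_gt0// mulr_gt0// exprn_gt0.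
move=> u0 Hu0.
(* This representative vanishes everywhere outside Omega, not just almost everywhere; [key] uses
   this at the single point x - 2^k h. *)
pose u : E -> R := patch (cst 0) Omega u0.
have mu0 := H_measurable Hu0.
have mu_ : measurable_fun setT u.
  exact: (measurable_restrictT u0 mOmega).1 (measurable_funTS mu0).
have uu0 : {ae mu, forall x, u0 x = u x}.
  case: Hu0 => _ _; apply: filterS => x Ox; rewrite /u patchE.
  by case: ifPn => // /negP; rewrite inE => /Ox.
have mkp := measurable_kernel_plus s (n := n) (R := R).
have kp0 := kernel_plus_ge0 (n := n) s_gt0 s_lt1.
rewrite (energy_ae mu0 mu_ mkp uu0).
rewrite (ge0_ae_eq_integral (g := fun x => (u x ^+ 2)%:E))//; last 5 first.
- by apply/measurable_EFinP; exact: measurable_funX.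
- by apply/measurable_EFinP; exact: measurable_funX.
- by move=> x _; rewrite lee_fin sqr_ge0.
- by move=> x _; rewrite lee_fin sqr_ge0.
- by apply: filterS uu0 => x -> _.
set I := (\int[mu]_x _)%E; set En := energy _ _ _.
have key h : B h -> (I <= (4 ^+ k)%:E * shift_diff u h)%E.
  move=> Bh; apply: le_trans (shift_diff_pow mu_ k h).
  apply: ge0_le_integral => //.
  - by move=> x _; rewrite lee_fin sqr_ge0.
  - by apply/measurable_EFinP; exact: measurable_funX.
  - by apply/measurable_EFinP; exact: measurable_shift_sqr.
  - move=> x _; rewrite lee_fin {1}/u patchE; case: ifPn => [|_]; last by rewrite expr0n sqr_ge0.
    rewrite inE => Ox.
    suff -> : u (x - 2 ^+ k *: h) = 0 by rewrite subr0 /u patchE mem_set.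
    rewrite /u patchE memNset// => /OM /(_ (Ordinal n_ge1)); rewrite !mxE.
    have := OM _ Ox (Ordinal n_ge1); have /andP[ha _] := Bh (Ordinal n_ge1).
    rewrite !ler_norml => /andP[x1 x2] /andP[y1 y2].
    have : 2 ^+ k * a <= 2 ^+ k * h ord0 (Ordinal n_ge1) by rewrite ler_pM2l ?exprn_gt0.
    lra.
have I0 : (0 <= I)%E by apply: integral_ge0 => x _; rewrite lee_fin sqr_ge0.
have mD := measurable_shift_diff mu_; have D0 := shift_diff_ge0 u.
have main : ((kap * a ^+ n)%:E * I <= (4 ^+ k)%:E * En)%E.
  rewrite /En (energy_shift_diff mu_ mkp kp0) -[leRHS]ge0_integralZl//; last 2 first.
  - by apply: emeasurable_funM => //; exact/measurable_EFinP.
  - by move=> h _; rewrite mule_ge0 ?lee_fin.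
  apply: (@le_trans _ _ (\int[mu]_h ((\1_B h)%:E * (kap%:E * I)))%E).
    rewrite ge0_integralZr; last 4 first.
    + by [].
    + by apply/measurable_EFinP; exact: measurable_indic.
    + by move=> x _; rewrite lee_fin.
    + by rewrite mule_ge0// lee_fin ltW.
    by rewrite integral_indic// setIT [X in (_ <= X * _)%E]muB muleA -EFinM mulrC.
  apply: ge0_le_integral => //.
  - by move=> h _; rewrite mule_ge0 ?lee_fin// mule_ge0// lee_fin ltW.
  - by apply: emeasurable_funM => //; apply/measurable_EFinP; exact: measurable_indic.
  - by apply: measurable_funeM; apply: emeasurable_funM => //; exact/measurable_EFinP.
  - move=> h _; rewrite indicE; case: (boolP (h \in B)) => [|_]; last first.
      by rewrite mul0e !mule_ge0 ?lee_fin ?exprn_ge0.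
    rewrite inE => Bh; rewrite mul1e muleCA lee_pmul//; first by rewrite lee_fin ltW.
      by rewrite lee_fin kapB.
    exact: key.
have ka0 := mulr_gt0 kap0 (exprn_gt0 n a0).
rewrite -(@lee_pmul2l _ (kap * a ^+ n)%:E)//.
by rewrite (le_trans main)// muleA -EFinM mulrC divfK// gt_eqF.
Qed.

(* With rho the radius of the ball of measure 2 |A|, at least half of the ball of radius rho
   about x lies outside A. *)
Lemma faber_krahn : exists c0 m0 : R, [/\ 0 < c0, 0 < m0 &
  forall (A : set E) (m : R) (x : E), measurable A -> mu A = m%:E -> 0 < m -> m <= m0 ->
  ((c0 * m `^ (- (2 * s / n%:R)))%:E <= \int[mu]_y (\1_(~` A) y * kp (x - y))%:E)%E].
Proof.
have n0 : 0 < n%:R :> R by rewrite ltr0n.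
have w0 := omega_gt0 (R := R) n.
have c0 : 0 < c by exact: c_ns_gt0.
set e : R := 1 + 2 * s / n%:R.
(* With rho = (2m/omega)^(1/n), k_+ >= c rho^(-n-2s) on the ball once -ln rho >= 1, that is rho <=
   1/e; this is the condition m <= [m0]. Multiplied by the measure m outside A, the bound becomes c
   (2/omega)^(-e) m^(1-e), and 1 - e = -2s/n. *)
exists (c * (2 / omega n) `^ (- e)), (omega n * expR (-1) ^+ n / 2); split.
- by rewrite mulr_gt0// powR_gt0// divr_gt0.
- by rewrite divr_gt0// mulr_gt0// exprn_gt0// expR_gt0.
move=> A m x mA muA mgt0 mle.
have q0 : 0 < 2 * m / omega n by rewrite divr_gt0// mulr_gt0.
set rho := (2 * m / omega n) `^ (n%:R^-1).
have rho0 : 0 < rho by exact: powR_gt0.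
have rhon : omega n * rho ^+ n = 2 * m.
  rewrite /rho -powR_mulrn ?powR_ge0// -powRrM mulVf ?gt_eqF// powRr1 ?ltW//.
  by field; rewrite gt_eqF.
have rho1 : rho <= expR (-1).
  rewrite -(ler_pXn2r n_ge1) ?nnegrE ?(ltW rho0) ?expR_ge0//.
  by rewrite -(ler_pM2l w0) rhon; move: mle; rewrite ler_pdivlMr// mulrC.
have e1 : expR (-1) < 1 :> R by rewrite -[ltRHS]expR0 ltr_expR; lra.
have lnr : 1 <= - ln rho.
  by rewrite lerNr -[leRHS]expRK ler_ln ?posrE ?expR_gt0.
set q := - n%:R - 2 * s.
(* The centre x is removed as well, since the lower bound on k_+ excludes the origin. *)
pose D : set E := [set y | enorm (x - y) <= rho] `\` ([set x] `|` A).
have mball : measurable [set y : E | enorm (x - y) <= rho].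
  rewrite (_ : [set y | _] = (fun y => (-1) *: y + x) @^-1` eball n rho).
    by apply: measurable_set_affine_rV; exact: measurable_eball.
  by apply/seteqP; split=> y; rewrite /eball /= scaleN1r addrC.
have muball : mu [set y : E | enorm (x - y) <= rho] = (2 * m)%:E.
  rewrite -rhon -lebesgue_eball// -(@lebesgue_rV_affine _ n (-1) x (eball n rho)) ?oppr_eq0 ?oner_eq0//; last exact: measurable_eball.
  rewrite normrN1 expr1n mul1e; apply: (congr1 mu).
  by apply/seteqP; split=> y; rewrite /eball /= scaleN1r addrC.
have mx : measurable [set x].
  rewrite (_ : [set x] = (fun y => 1 *: y + (- x)) @^-1` eball n 0).
    by apply: measurable_set_affine_rV; exact: measurable_eball.
  apply/seteqP; split=> y; rewrite /eball /= scale1r.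
    by move=> ->; rewrite subrr /enorm /dotv big1 ?sqrtr0// => i _; rewrite mxE mul0r.
  move=> y0; apply/eqP; rewrite -subr_eq0; apply/eqP; apply: enorm_eq0; apply/eqP.
  by rewrite eq_le y0 enorm_ge0.
have mxA : measurable ([set x] `|` A) by exact: measurableU.
have mD : measurable D by exact: measurableD.
have muD : (m%:E <= mu D)%E.
  have : (mu [set y : E | (enorm (x - y) <= rho)%R] <= mu D + mu ([set x] `|` A))%E.
    apply: (le_trans _ (measureU2 _ mD mxA)); apply: le_measure; rewrite ?inE//.
      exact: measurableU.
    by move=> y yr; have [|] := pselect (([set x] `|` A) y); [right|left].
  have muxA : (mu ([set x] `|` A) <= m%:E)%E.
    by rewrite (le_trans (measureU2 _ mx mA))// [X in (X + _)%E](lebesgue_rV_set1 x n_ge1) add0e [X in (X <= _)%E]muA.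
  move=> H1; have : ((2 * m)%:E <= mu D + m%:E)%E.
    by rewrite -muball (le_trans H1)// leeD2l.
  rewrite -leeBlDr// -EFinB (_ : 2 * m - m = m)//; ring.
apply: (@le_trans _ _ (\int[mu]_y ((c * rho `^ q)%:E * (\1_D y)%:E))%E).
  rewrite ge0_integralZl_R//; last by rewrite mulr_ge0 ?powR_ge0// ltW.
  rewrite integral_indic// setIT.
  apply: (@le_trans _ _ ((c * rho `^ q)%:E * m%:E)%E); last first.
    by rewrite lee_pmul2l// lte_fin mulr_gt0// powR_gt0.
  rewrite -EFinM lee_fin le_eqVlt; apply/orP; left; apply/eqP.
  have qe : n%:R^-1 * q = - e by rewrite /q /e; field; rewrite gt_eqF.
  rewrite /rho -powRrM qe (_ : 2 * m / omega n = (2 / omega n) * m); last by field; rewrite gt_eqF.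
  have mE : m `^ (- e) * m = m `^ (- (2 * s / n%:R)).
    rewrite -{2}(powRr1 (ltW mgt0)) -powRD; last by rewrite (gt_eqF mgt0) implybT.
    by congr (_ `^ _); rewrite /e; ring.
  rewrite -mE [(_ * m) `^ _]powRM ?divr_ge0 ?(ltW w0) ?(ltW mgt0)//. ring.
apply: ge0_le_integral => //.
- by move=> y _; rewrite mule_ge0// lee_fin mulr_ge0 ?powR_ge0// ltW.
- apply/measurable_EFinP; apply: measurable_funM => //; exact: measurable_indic.
- apply/measurable_EFinP; apply: measurable_funM; first by apply: measurable_indic; exact: measurableC.
  apply: (measurableT_comp (measurable_kernel_plus s (n := n))).
  rewrite (_ : (fun y => _) = (fun y => (-1) *: y + x)); first exact: measurable_affine_rV.
  by apply/funext => y; rewrite scaleN1r addrC.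
- move=> y _; rewrite -EFinM lee_fin !indicE; case: (boolP (y \in D)) => [|_]; last first.
    by rewrite mulr0 mulr_ge0// kernel_plus_ge0.
  rewrite inE => -[/= yr /not_orP[yx yA]]; rewrite mulr1 mem_set// mul1r.
  have xy0 : 0 < enorm (x - y).
    rewrite lt_neqAle enorm_ge0 andbT; apply/eqP => /esym/enorm_eq0/eqP.
    by rewrite subr_eq0 => /eqP xy; apply: yx.
  apply: le_trans (kernel_plus_ge s_gt0 s_lt1 xy0 yr (le_lt_trans rho1 e1)).
  by rewrite ler_peMr// mulr_ge0 ?powR_ge0// ltW.
Qed.
End poincare.

(** * Completeness and well-posedness *)

Section riesz.
Context {R : realType} (X : lmodType R).
Variables (H : X -> Prop) (a : X -> X -> R) (F : X -> R) (C : R).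
Hypotheses (H0 : H 0) (Hlin : forall t u w, H u -> H w -> H (t *: u + w)).
Hypothesis aC : forall u w, H u -> H w -> a u w = a w u.
Hypothesis a_lin : forall t u w v, H u -> H w -> H v ->
  a (t *: u + w) v = t * a u v + a w v.
Hypothesis a_ge0 : forall u, H u -> 0 <= a u u.
Hypothesis F_lin : forall t u w, H u -> H w -> F (t *: u + w) = t * F u + F w.
Hypothesis F_bound : forall u, H u -> F u ^+ 2 <= C * a u u.
Hypothesis a_complete : forall x : nat -> X, (forall k, H (x k)) ->
  (forall e, 0 < e -> exists N, forall i j, (N <= i)%N -> (N <= j)%N ->
     a (x i - x j) (x i - x j) <= e) ->
  exists u, H u /\ forall e, 0 < e -> exists N, forall k, (N <= k)%N ->
     a (x k - u) (x k - u) <= e.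

Let a_linr t u w v : H u -> H w -> H v -> a v (t *: u + w) = t * a v u + a v w.
Proof. by move=> Hu Hw Hv; rewrite aC ?a_lin ?(aC Hu) ?(aC Hw)//; exact: Hlin. Qed.

Let a_sq t u w : H u -> H w ->
  a (t *: u + w) (t *: u + w) = t ^+ 2 * a u u + 2 * t * a u w + a w w.
Proof.
move=> Hu Hw; rewrite a_lin//; last exact: Hlin.
by rewrite !a_linr// (aC Hw Hu); ring.
Qed.

Let HB u w : H u -> H w -> H (u - w).
Proof. by move=> Hu Hw; rewrite addrC -scaleN1r; exact: Hlin. Qed.

(** Minimization of J w = a(w, w) - 2 F w over H. The form is only semidefinite, elements of H being
    functions rather than classes, and completeness is assumed for the form itself. *)
Lemma riesz_representation : exists u, H u /\ forall v, H v -> a u v = F v.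
Proof.
pose J w := a w w - 2 * F w.
(* Since F w ^ 2 <= |C| a(w, w), 2 F w is at most a(w, w) + |C| by the inequality of the two
   means. *)
have Jlb w : H w -> - `|C| <= J w.
  move=> Hw; have Fb := F_bound Hw; have aw := a_ge0 Hw.
  rewrite /J lerBrDr addrC lerBlDr.
  have {}Fb : F w ^+ 2 <= `|C| * a w w by rewrite (le_trans Fb)// ler_wpM2r// ler_norm.
  have [Fn|Fp] := leP (2 * F w) 0; first by rewrite (le_trans Fn)// addr_ge0.
  rewrite -(@ler_pXn2r _ 2) ?nnegrE ?addr_ge0// ?(ltW Fp)//.
  have := sqr_ge0 (a w w - `|C|); rewrite !expr2 in Fb *; nra.
pose S := [set J w | w in [set w | H w]].
have hinf : has_inf S.
  split; first by exists (J 0); exists 0.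
  by exists (- `|C|) => _ [w Hw <-]; exact: Jlb.
have mP w : H w -> inf S <= J w.
  by move=> Hw; apply: ge_inf; [exact: hinf.2|exists w].
have /choice[x xP] : forall k : nat, exists w, H w /\ J w < inf S + k.+1%:R^-1.
  move=> k; have k0 : 0 < k.+1%:R^-1 :> R by rewrite invr_gt0.
  by have [_ [w Hw <-] ?] := inf_adherent k0 hinf; exists w.
have Hx k : H (x k) by have [] := xP k.
have [u [Hu ux]] : exists u, H u /\ forall e, 0 < e -> exists N, forall k, (N <= k)%N ->
     a (x k - u) (x k - u) <= e.
  apply: a_complete => // e e0.
  exists (Num.truncn (4 / e)) => i j iN jN.
  have inv k : (Num.truncn (4 / e) <= k)%N -> k.+1%:R^-1 <= e / 4.
    move=> kN; rewrite -[e / 4]invrK lef_pV2 ?posrE ?invr_gt0 ?divr_gt0// invf_div.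
    by apply: ltW; rewrite -truncn_le_nat.
  (* Parallelogram law: as J at the midpoint is at least the infimum, a(x i - x j, x i - x j) is at
     most twice the sum of the excesses of J (x i) and J (x j) over it, each at most e/4. *)
  pose mid := 2^-1 *: x i + (2^-1 *: x j + 0).
  have Hj : H (2^-1 *: x j + 0) by exact: Hlin.
  have Hmid : H mid by exact: Hlin.
  have E : a (x i - x j) (x i - x j) = 2 * (J (x i) + J (x j) - 2 * J mid).
    rewrite -[x i - x j]addrC -scaleN1r a_sq// /J /mid a_sq// !F_lin// addr0.
    have a0 : a (2^-1 *: x j) (2^-1 *: x j) = 2^-1 ^+ 2 * a (x j) (x j).
      have := a_sq 2^-1 (Hx j) H0; rewrite addr0 => ->.
      by have := a_lin 1 H0 H0 H0; have := a_linr 1 H0 H0 (Hx j); rewrite scaler0 addr0; lra.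
    have a1 : a (x i) (2^-1 *: x j) = 2^-1 * a (x i) (x j).
      have := a_linr 2^-1 (Hx j) H0 (Hx i); rewrite addr0 => ->.
      by have := a_linr 1 H0 H0 (Hx i); rewrite scaler0 addr0; lra.
    have F0 : F 0 = 0 by have := F_lin 1 H0 H0; rewrite scaler0 addr0; lra.
    rewrite a0 a1 F0 (aC (Hx j) (Hx i)); by field.
  have := inv i iN; have := inv j jN; have [_] := xP i; have [_] := xP j; have := mP _ Hmid.
  rewrite E; move: (i.+1%:R^-1) (j.+1%:R^-1) => ? ?; lra.
exists u; split=> // v Hv.
have av := a_ge0 Hv.
set g := a u v - F v.
(* First variation, performed at x k rather than at the limit u: J (t v + x k) is at least the
   infimum. The error 2 t a(x k - u, v) is absorbed by a(x k - u, x k - u) + t^2 a(v, v), which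
   doubles the quadratic term. *)
have key t : 0 <= 2 * t * g + 2 * t ^+ 2 * a v v.
  apply/ler_addgt0Pr => e e0.
  have e20 : 0 < e / 2 by rewrite divr_gt0.
  have [N uN] := ux (e / 2) e20.
  pose k := maxn N (Num.truncn (2 / e)).
  have kN := uN k (leq_maxl _ _).
  have ke : k.+1%:R^-1 <= e / 2.
    rewrite -[e / 2]invrK lef_pV2 ?posrE ?invr_gt0 ?divr_gt0// invf_div.
    by apply: ltW; rewrite -truncn_le_nat leq_maxr.
  have Hd : H (x k - u) by exact: HB.
  have [_ xk] := xP k.
  have := mP _ (Hlin t Hv (Hx k)).
  have axv : a (x k) v = a u v + a (x k - u) v.
    by have := a_lin (-1) Hu (Hx k) Hv; rewrite scaleN1r addrC => ->; ring.
  have Y : 0 <= a (x k - u) (x k - u) + t ^+ 2 * a v v - 2 * t * a (x k - u) v.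
    have := a_ge0 (Hlin (- t) Hv Hd); rewrite a_sq// (aC Hv Hd) sqrrN; lra.
  rewrite {1}/J a_sq// F_lin// (aC Hv (Hx k)) axv.
  move: xk; rewrite /J /g; move: (k.+1%:R^-1) ke kN Y => q ke kN Y; nra.
apply/eqP; rewrite -subr_eq0 -/g -sqrf_eq0; apply/eqP.
(* Nearly the minimizer in t; the [+ 1] allows for a(v, v) = 0. *)
have := key (- g / (2 * (a v v + 1))).
have A1 : 0 < a v v + 1 by rewrite ltr_wpDl.
rewrite (_ : _ + _ = - (g ^+ 2 * (a v v + 2) / (2 * (a v v + 1) ^+ 2))); last first.
  by field; rewrite gt_eqF.
rewrite oppr_ge0 pmulr_lle0; last by rewrite invr_gt0 mulr_gt0// exprn_gt0.
rewrite pmulr_lle0; last by rewrite ltr_wpDl.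
by move=> g0; apply/eqP; rewrite eq_le g0 sqr_ge0.
Qed.
End riesz.

(** * Fatou's lemma and almost everywhere convergent subsequences in L^2 *)

Section L2_complete.
Context d (T : measurableType d) (R : realType) (m : {measure set T -> \bar R}).

Lemma fatou_le (f : nat -> T -> R) (g : T -> R) (e : \bar R) N :
  (forall k, measurable_fun setT (f k)) -> (forall k x, 0 <= f k x) ->
  (forall x, f k x @[k --> \oo] --> g x) ->
  (forall k, (N <= k)%N -> (\int[m]_x (f k x)%:E <= e)%E) ->
  (\int[m]_x (g x)%:E <= e)%E.
Proof.
move=> mf f0 fg fe.
have E x : limn_einf (fun k => (f k x)%:E) = (g x)%:E.
  have cv : (fun k => (f k x)%:E) @ \oo --> (g x)%:E.
    by apply: cvg_EFin; [exact: nearW|exact: fg].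
  by rewrite (cvg_limn_einf_sup cv).
under eq_integral do rewrite -E.
apply: le_trans (fatou m measurableT (f := fun k x => (f k x)%:E) _ _) _.
- by move=> k; exact/measurable_EFinP.
- by move=> k x _; rewrite lee_fin.
rewrite limn_einf_lim; apply: lime_le; first exact: is_cvg_einfs.
exists N => // k Nk /=; apply: le_trans (fe k Nk).
by apply: ereal_inf_lbound; exists k => //=.
Qed.

(** Times 4^j this is 2^(-j-1), whose sum is 1. *)
Let bnd (j : nat) : R := ((4 ^+ j) * 2 ^+ j.+1)^-1.

(** The series of 4^j (v_{j+1} - v_j)^2 has integral at most 1, so its sum B is finite almost
    everywhere. There |v_{j+1} - v_j| <= (B + 1) 2^-j, with B + 1 standing in for the square root of
    B, and the telescoping series converges. *)
Lemma ae_cvg_fast (v : nat -> T -> R) : (forall j, measurable_fun setT (v j)) ->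
  (forall j, (\int[m]_x ((v j.+1 x - v j x) ^+ 2)%:E <= (bnd j)%:E)%E) ->
  {ae m, forall x, cvgn (v ^~ x)}.
Proof.
move=> mv vb.
pose f j x : \bar R := (4 ^+ j * (v j.+1 x - v j x) ^+ 2)%:E.
have mf j : measurable_fun setT (f j).
  apply/measurable_EFinP; apply: measurable_funM => //; apply: measurable_funX; exact: measurable_funB.
have f0 j x : (0 <= f j x)%E.
  by rewrite lee_fin; apply: mulr_ge0; [exact: exprn_ge0|exact: sqr_ge0].
have If : (\int[m]_x (\sum_(j <oo) f j x) < +oo)%E.
  rewrite integral_nneseries//.
  apply: (@le_lt_trans _ _ (1%:E)); last exact: ltry.
  apply: le_trans (epsilon_trick0 xpredT (@ler01 R)).
  apply: lee_nneseries => [j _ _|j _]; first exact: integral_ge0.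
  rewrite /f; under eq_integral do rewrite EFinM.
  rewrite ge0_integralZl_R; last 4 first.
  - by [].
  - by apply: measurable_funX; exact: measurable_funB.
  - by move=> x _; rewrite sqr_ge0.
  - by rewrite exprn_ge0.
  apply: (@le_trans _ _ ((4 ^+ j)%:E * (bnd j)%:E)%E).
    by rewrite lee_pmul2l// lte_fin exprn_gt0.
  rewrite -EFinM lee_fin /bnd invfM mulrA divff ?mul1r ?natrX// gt_eqF// exprn_gt0//.
have Ii : m.-integrable setT (fun x => \sum_(j <oo) f j x)%E.
  apply/integrableP; split.
    apply: ge0_emeasurable_sum => //.
  by under eq_integral do rewrite gee0_abs ?nneseries_ge0//.
apply: filterS (integrable_ae measurableT Ii) => x /(_ Logic.I) fx.
set B := fine (\sum_(j <oo) f j x)%E.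
have fB j : 4 ^+ j * (v j.+1 x - v j x) ^+ 2 <= B.
  rewrite -lee_fin fineK//.
  apply: le_trans (nneseries_lim_ge j.+1 _) => //; rewrite big_mkcond big_mkord big_ord_recr /=.
  by rewrite leeDr// sume_ge0.
have B0 : 0 <= B by apply: le_trans (fB 0%N); apply: mulr_ge0; [exact: exprn_ge0|exact: sqr_ge0].
have dB j : `|v j.+1 x - v j x| <= (B + 1) * 2^-1 ^+ j.
  rewrite -(@ler_pXn2r _ 2) ?nnegrE ?mulr_ge0 ?addr_ge0 ?exprn_ge0 ?invr_ge0//.
  rewrite real_normK ?num_real// exprMn -exprM mulnC exprM exprVn.
  rewrite (_ : 2 ^+ 2 = 4 :> R); last by rewrite expr2; ring.
  rewrite exprVn ler_pdivlMr ?exprn_gt0// mulrC (le_trans (fB j))//.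
  by rewrite expr2; nra.
have cs : cvgn (series (fun j => v j.+1 x - v j x)).
  apply: normed_cvg; apply: (@series_le_cvg _ _ (fun j => (B + 1) * 2^-1 ^+ j)).
  - by move=> j /=.
  - by move=> j; rewrite mulr_ge0 ?addr_ge0 ?exprn_ge0 ?invr_ge0.
  - exact: dB.
  - by apply: (@is_cvg_geometric_series R (B + 1) 2^-1); rewrite ger0_norm ?invr_ge0// invf_lt1// ltr1n.
have E : (fun j => series (fun j => v j.+1 x - v j x) j + v 0%N x) = v^~ x.
  apply/funext => j; have := telescopeK (v^~ x); rewrite /telescope => /(congr1 (fun g => g j)) ->.
  by rewrite /= subrK.
suff : cvgn (fun j => series (fun j => v j.+1 x - v j x) j + v 0%N x) by rewrite E.
by apply: (is_cvgD cs); exact: is_cvg_cst.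
Qed.

(* [v j] is [x (phi j)] modified on a null set so as to converge everywhere. *)
Lemma L2_complete (x : nat -> T -> R) : (forall k, measurable_fun setT (x k)) ->
  (forall e : R, 0 < e -> exists N, forall i j, (N <= i)%N -> (N <= j)%N ->
     (\int[m]_t ((x i t - x j t) ^+ 2)%:E <= e%:E)%E) ->
  exists (phi : nat -> nat) (v : nat -> T -> R) (u : T -> R),
   [/\ forall j, (j <= phi j)%N, forall j, measurable_fun setT (v j), measurable_fun setT u,
    forall j, {ae m, forall t, x (phi j) t = v j t} & forall t, v j t @[j --> \oo] --> u t].
Proof.
move=> mx xC.
have /choice[N NP] : forall k : nat, exists N, forall i j, (N <= i)%N -> (N <= j)%N ->
     (\int[m]_t ((x i t - x j t) ^+ 2)%:E <= (bnd k)%:E)%E.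
  by move=> k; apply: xC; rewrite invr_gt0 mulr_gt0// exprn_gt0.
(* The sum puts both phi j and phi (j+1) beyond N j; the summand j makes phi j >= j. *)
pose phi j := (\sum_(i < j.+1) N i + j)%N.
have phiN j : (N j <= phi j)%N.
  by rewrite /phi big_ord_recr /= -addnA addnC -addnA leq_addr.
have phiS j : (N j <= phi j.+1)%N.
  by rewrite /phi 2!big_ord_recr /= -!addnA addnC -!addnA leq_addr.
have [A [mA A0 Asub]] := @ae_cvg_fast (fun j => x (phi j)) (fun j => mx _) (fun j => NP j _ _ (phiS j) (phiN j)).
pose v j t := if t \in A then 0 else x (phi j) t.
have mv j : measurable_fun setT (v j).
  apply: measurable_fun_ifT => //.
  by apply: (measurable_fun_bool true); rewrite setTI (_ : _ @^-1` _ = A)//; by apply/seteqP; split => t /= tA; [exact: set_mem tA|exact: mem_set].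
have cv t : cvgn (v ^~ t).
  have [tA|tA] := boolP (t \in A).
    have E : cst 0 = v ^~ t by apply/funext => j; rewrite /v tA.
    suff : cvgn (cst 0 : nat -> R) by rewrite E.
    exact: is_cvg_cst.
  have E : (fun j => x (phi j) t) = v ^~ t by apply/funext => j; rewrite /v (negbTE tA).
  suff : cvgn (fun j => x (phi j) t) by rewrite E.
  apply: contrapT => nc; move/negP : tA; apply; rewrite inE; exact: Asub.
exists phi, v, (fun t => limn (v ^~ t)); split=> //.
- by move=> j; rewrite leq_addl.
- by apply: (measurable_fun_cvg mv) => t _; exact: cv.
- move=> j; exists A; split => // t /= xv; apply: contrapT => tA; apply: xv.
  by rewrite /v; case: ifPn => //; rewrite inE.
Qed.
End L2_complete.

Section complete.
Context {R : realType} (n : nat) (s : R) (Omega : set 'rV[R]_n) (C : R).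
Hypotheses (n_ge1 : (1 <= n)%N) (s_gt0 : 0 < s) (s_lt1 : s < 1).
Local Notation E := 'rV[R]_n.
Local Notation mu := (lebesgue_rV n).
Local Notation kp := (kernel_plus s : E -> R).
Local Notation H := (H0sLog s Omega).
Hypothesis C_gt0 : 0 < C.
Hypothesis poincareC : forall u, H u ->
  (\int[mu]_x (u x ^+ 2)%:E <= C%:E * energy kp u u)%E.

Lemma energy_plusE u : H u -> energy kp u u = (form_plus s u u)%:E.
Proof.
move=> Hu; rewrite fineK// ge0_fin_numE; first exact: H_energy_plus Hu.
by apply: energy_ge0 => x; exact: kernel_plus_ge0.
Qed.

Lemma H_sub u w : H u -> H w -> H (u - w).
Proof. by move=> Hu Hw; rewrite addrC -scaleN1r; exact: H_lin. Qed.

Lemma sub_funE (u w : E -> R) x : (u - w) x = u x - w x. Proof. by []. Qed.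

(** The Poincare inequality makes the sequence Cauchy in L^2, whence a subsequence with an almost
    everywhere limit u. Fatou's lemma along it bounds E_+ of x i - u by the Cauchy bound for every
    large i, so the whole sequence converges to u in energy. *)
Lemma H_complete (x : nat -> E -> R) : (forall k, H (x k)) ->
  (forall e : R, 0 < e -> exists N, forall i j, (N <= i)%N -> (N <= j)%N ->
     form_plus s (x i - x j) (x i - x j) <= e) ->
  exists u, H u /\ forall e : R, 0 < e -> exists N, forall k, (N <= k)%N ->
     form_plus s (x k - u) (x k - u) <= e.
Proof.
move=> Hx xC; have mx k := H_measurable (Hx k).
have mkp := measurable_kernel_plus s (n := n) (R := R).
have kp0 := kernel_plus_ge0 (n := n) s_gt0 s_lt1.
have L2e i j e : form_plus s (x i - x j) (x i - x j) <= e ->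
    (\int[mu]_t ((x i t - x j t) ^+ 2)%:E <= (C * e)%:E)%E.
  move=> xe; have Hij := H_sub (Hx i) (Hx j).
  by apply: le_trans (poincareC Hij) _; rewrite energy_plusE// -EFinM lee_fin ler_pM2l.
have [] := @L2_complete _ _ _ mu x mx.
  move=> e e0; have eC : 0 < e / C by rewrite divr_gt0.
  have [N NP] := xC _ eC; exists N => i j iN jN.
  by apply: le_trans (L2e _ _ _ (NP _ _ iN jN)) _; rewrite mulrC divfK// gt_eqF.
move=> phi [v [u [phi_ge mv mu_ xv vu]]].
have mxv i k : measurable_fun setT (x i - v k) by exact: measurable_funB.
have mxu i : measurable_fun setT (x i - u) by exact: measurable_funB.
have lim_en e N i : (forall k, (N <= k)%N -> form_plus s (x i - x (phi k)) (x i - x (phi k)) <= e) ->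
    (energy kp (x i - u)%R (x i - u)%R <= e%:E)%E.
  move=> ie; rewrite energyE.
  apply: (@fatou_le _ _ _ (mu \x mu)%E (fun k z => dprod (x i - v k)%R (x i - v k)%R z * kp (z.1 - z.2)) _ _ N).
  - by move=> k; exact: measurable_dprod_kernel.
  - by move=> k z; rewrite mulr_ge0 ?dprod_ge0.
  - move=> z; apply: cvgMl; rewrite /dprod !sub_funE.
    by apply: cvgM; apply: cvgB; apply: cvgB; (exact: cvg_cst || exact: vu).
  - move=> k /ie; rewrite -lee_fin -energy_plusE; last exact: H_sub.
    rewrite -energyE (@energy_ae _ _ _ (x i - x (phi k)) (x i - v k))//.
      by apply: measurable_funB.
    by apply: filterS (xv k) => t; rewrite !sub_funE => ->.
have lim_L2 e N i : (forall k, (N <= k)%N -> form_plus s (x i - x (phi k)) (x i - x (phi k)) <= e) ->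
    (\int[mu]_t ((x i t - u t) ^+ 2)%:E <= (C * e)%:E)%E.
  move=> ie; apply: (@fatou_le _ _ _ mu (fun k t => (x i t - v k t) ^+ 2) _ _ N).
  - by move=> k; apply: measurable_funX; exact: mxv.
  - by move=> k t; exact: sqr_ge0.
  - by move=> t; rewrite expr2; apply: cvgM; apply: cvgB; (exact: cvg_cst || exact: vu).
  - move=> k /ie /L2e; rewrite (ge0_ae_eq_integral (f := fun t => ((x i t - x (phi k) t) ^+ 2)%:E) (g := fun t => ((x i t - v k t) ^+ 2)%:E))//.
    + by apply/measurable_EFinP; apply: measurable_funX; exact: measurable_funB.
    + by apply/measurable_EFinP; apply: measurable_funX; exact: mxv.
    + by move=> t _; rewrite lee_fin sqr_ge0.
    + by move=> t _; rewrite lee_fin sqr_ge0.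
    + by apply: filterS (xv k) => t -> _.
have Hxu e i : (exists N, forall k, (N <= k)%N -> form_plus s (x i - x (phi k)) (x i - x (phi k)) <= e) -> H (x i - u).
  move=> [N ie]; split.
  - by apply/Lfun2E; split=> //; exact: le_lt_trans (lim_L2 _ _ _ ie) (ltry _).
  - exact: le_lt_trans (lim_en _ _ _ ie) (ltry _).
  - have : {ae mu, forall t k, ~ Omega t -> x k t = 0}.
      by apply: ae_foralln => k; have [] := Hx k.
    have : {ae mu, forall t k, x (phi k) t = v k t} by exact: ae_foralln.
    apply: filterS2 => t xvt x0 Ot; rewrite sub_funE x0// sub0r.
    suff -> : u t = 0 by rewrite oppr0.
    have E0 : v^~ t = cst 0 by apply/funext => k; rewrite -xvt x0.
    rewrite -(cvg_lim (@Rhausdorff R) (vu t)) E0.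
    by apply: cvg_lim => //; exact: cvg_cst.
have tail e : 0 < e -> exists N, forall i, (N <= i)%N -> forall k, (N <= k)%N -> form_plus s (x i - x (phi k)) (x i - x (phi k)) <= e.
  by move=> /xC[N NP]; exists N => i Ni k Nk; apply: NP => //; exact: leq_trans (phi_ge k).
have [N1 tail1] := tail 1 ltr01.
exists u; split.
  have : H (x N1 - (x N1 - u)) by apply: H_sub => //; apply: (Hxu 1); exists N1; exact: tail1.
  by rewrite opprB addrC subrK.
move=> e /tail[N NP]; exists N => k Nk.
rewrite -lee_fin -energy_plusE; last by apply: (Hxu e); exists N; exact: NP.
by apply: (lim_en e N); exact: NP.
Qed.
End complete.

Lemma Rintegral_ae_ge0 d (T : measurableType d) (R : realType)
    (m : {measure set T -> \bar R}) (f : T -> R) :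
  m.-integrable setT (EFin \o f) -> {ae m, forall x, 0 <= f x} ->
  0 <= \int[m]_x f x.
Proof.
move=> /integrableP[/measurable_EFinP mf _] f0; apply: fine_ge0.
rewrite (ae_eq_integral (fun x => `|f x|%:E))//.
- by apply: integral_ge0 => x _; rewrite lee_fin.
- exact/measurable_EFinP.
- by apply/measurable_EFinP; exact: measurableT_comp.
- by apply: filterS f0 => x fx _; rewrite ger0_norm.
Qed.

(** * The potential term *)

Section potential.
Context {R : realType} (n : nat) (s : R) (Omega : set 'rV[R]_n).
Local Notation E := 'rV[R]_n.
Local Notation mu := (lebesgue_rV n).
Local Notation H := (H0sLog s Omega).
Variables (V : E -> R) (M : R).
Hypotheses (mV : measurable_fun setT V) (M_ge0 : 0 <= M) (VM : {ae mu, forall x, `|V x| <= M}).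

(** Taken over all of R^n, since it is applied to the extension of V by zero
    ([integral_patch_pot]). *)
Definition pot (u w : E -> R) : R := \int[mu]_x (V x * u x * w x).

Lemma H_integrable_mul u w : H u -> H w -> mu.-integrable setT (EFin \o (fun x => u x * w x)).
Proof. by move=> [Hu _ _] [Hw _ _]; apply/Lfun1_integrable; exact: Lfun2_mul_Lfun1. Qed.

Lemma pot_integrable u w : H u -> H w ->
  mu.-integrable setT (EFin \o (fun x => V x * u x * w x)).
Proof.
move=> Hu Hw; have i := H_integrable_mul Hu Hw.
apply: (@ae_le_integrable _ _ _ _ _ (fun x => M * `|u x * w x|)).
- apply: measurable_funM; last exact: H_measurable Hw.
  by apply: measurable_funM => //; exact: H_measurable Hu.
- by apply: filterS VM => x Vx; rewrite -mulrA normrM ler_wpM2r.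
- exact: (integrableZl measurableT M (integrable_norm i)).
Qed.

Lemma potC u w : pot u w = pot w u.
Proof. by apply: eq_Rintegral => x _; rewrite mulrAC. Qed.

Lemma pot_lin a u w v : H u -> H w -> H v ->
  pot (a *: u + w) v = a * pot u v + pot w v.
Proof.
move=> Hu Hw Hv; have iu := pot_integrable Hu Hv; have iw := pot_integrable Hw Hv.
have iau := integrableZl measurableT a iu.
rewrite -RintegralZl// -RintegralD//; apply: eq_Rintegral => x _.
rewrite lin_funE; ring.
Qed.

Lemma H_integral_sqr u : H u ->
  (\int[mu]_x (u x ^+ 2)%:E = (\int[mu]_x (u x ^+ 2))%:E)%E.
Proof.
move=> Hu; rewrite /Rintegral fineK// ge0_fin_numE; first exact: H_L2 Hu.
by apply: integral_ge0 => x _; rewrite lee_fin sqr_ge0.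
Qed.

Lemma pot_ge K u : H u -> {ae mu, forall x, Omega x -> K <= V x} ->
  K * \int[mu]_x (u x ^+ 2) <= pot u u.
Proof.
move=> Hu VK; have [Hu2 _ u0] := Hu.
have i2 := integrableZl measurableT K (Lfun2_integrable_sqr Hu2).
have iu := pot_integrable Hu Hu.
rewrite -RintegralZl//; last exact: Lfun2_integrable_sqr.
rewrite -subr_ge0 /pot -RintegralB//; apply: Rintegral_ae_ge0; first exact: (integrableB measurableT iu i2).
apply: filterS2 VK u0 => x VKx ux.
rewrite (_ : _ - _ = (V x - K) * u x ^+ 2); last by ring.
have [Ox|Ox] := pselect (Omega x); last by rewrite ux// expr0n mulr0.
by apply: mulr_ge0; [rewrite subr_ge0; exact: VKx|exact: sqr_ge0].
Qed.

Lemma pot_le_mul u w : H u -> H w -> (forall x, 0 <= u x * w x) ->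
  `|pot u w| <= M * \int[mu]_x (u x * w x).
Proof.
move=> Hu Hw uw0; have i2 := H_integrable_mul Hu Hw; have iu := pot_integrable Hu Hw.
have iM := integrableZl measurableT M i2.
rewrite -RintegralZl// ler_norml -subr_ge0 opprK -[X in _ && X]subr_ge0 /pot.
rewrite -RintegralD// -RintegralB//; apply/andP; split.
- apply: Rintegral_ae_ge0; first exact: (integrableD measurableT iu iM).
  apply: filterS VM => x; rewrite ler_norml => /andP[Vx _].
  by rewrite -mulrA -mulrDl mulr_ge0//; lra.
- apply: Rintegral_ae_ge0; first exact: (integrableB measurableT iM iu).
  apply: filterS VM => x; rewrite ler_norml => /andP[_ Vx].
  by rewrite -mulrA -mulrBl mulr_ge0// subr_ge0.
Qed.

Lemma pot_le u : H u -> pot u u <= M * \int[mu]_x (u x ^+ 2).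
Proof.
move=> Hu; apply: le_trans (ler_norm _) _.
by apply: pot_le_mul => // x; rewrite -expr2 sqr_ge0.
Qed.
End potential.

Lemma integral_patch_pot {R : realType} n (Omega : set 'rV[R]_n) (V u phi : 'rV[R]_n -> R) :
  \int[lebesgue_rV n]_(x in Omega) (V x * u x * phi x) = pot (patch (cst 0) Omega V) u phi.
Proof.
rewrite Rintegral_mkcond; apply: eq_Rintegral => x _; rewrite !patchE.
by case: ifP => // _; rewrite !mul0r.
Qed.

(** * Coercivity, existence, uniqueness and the estimate *)

Section well_posedness.
Context {R : realType} (n : nat) (s : R) (Omega : set 'rV[R]_n).
Hypotheses (n_ge1 : (1 <= n)%N) (s_gt0 : 0 < s) (s_lt1 : s < 1).
Hypothesis mOmega : measurable Omega.
Local Notation E := 'rV[R]_n.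
Local Notation mu := (lebesgue_rV n).
Local Notation c := (c_ns n s).
Local Notation b := (b_ns n s).
Local Notation kp := (kernel_plus s : E -> R).
Local Notation H := (H0sLog s Omega).
Variables (M : R) (C : R).
Hypothesis C_gt0 : 0 < C.
Hypothesis poincareC : forall u, H u ->
  (\int[mu]_x (u x ^+ 2)%:E <= C%:E * energy kp u u)%E.
Variables (V : E -> R) (F : (E -> R) -> R) (r : R).
Hypotheses (mV : measurable_fun setT V) (M_ge0 : 0 <= M) (VM : {ae mu, forall x, `|V x| <= M}).
Hypotheses (r_gt0 : 0 < r) (r_lt : r < expR (- (`|b| / 2))).
Hypothesis FP : dualH s Omega F.

Local Notation alpha := (1 - `|b| / (2 * ln (1 / r))).
Local Notation a := (fun u w => form_sLog s u w + pot V u w).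

Lemma radius_lt1 : r < 1.
Proof.
by apply: (lt_le_trans r_lt); rewrite -expR0 ler_expR oppr_le0 divr_ge0.
Qed.

Lemma alpha_gt0 : 0 < alpha.
Proof.
rewrite subr_gt0 div1r lnV ?posrE//.
have lr : `|b| / 2 < - ln r.
  by rewrite ltrNr -[X in _ < X]expRK ltr_ln ?posrE ?expR_gt0.
have lr0 : 0 < - ln r by apply: le_lt_trans lr; rewrite divr_ge0.
rewrite ltr_pdivrMr ?mulr_gt0// mul1r; lra.
Qed.

Lemma sqr_le_form_plus u : H u -> \int[mu]_x (u x ^+ 2) <= C * form_plus s u u.
Proof.
move=> Hu; rewrite -lee_fin -(H_integral_sqr Hu); have := poincareC Hu.
by rewrite (energy_plusE s_gt0 s_lt1 Hu).
Qed.

Lemma kform_err_le u : H u -> kform (kernel_err s r) u u <=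
  (c * (n%:R * omega n) / s ^+ 2 + `|b| * c / s * (n%:R * omega n) * r `^ (- (2 * s))) * \int[mu]_x (u x ^+ 2).
Proof.
move=> Hu; rewrite -lee_fin fineK; last first.
  rewrite ge0_fin_numE; first exact: H_energy_err Hu.
  by apply: energy_ge0 => x; exact: kernel_err_ge0.
rewrite EFinM -integral_kernel_err// -(H_integral_sqr Hu).
apply: energy_le_L2; [exact: H_measurable Hu|exact: measurable_kernel_err|exact: kernel_err_ge0].
Qed.

(** Completeness is known for E_+; this upper bound turns convergence in E_+ into convergence in the
    form to which Riesz is applied. E_- only lowers the form, and E_s and the potential are
    controlled by [energy_s_le] and the Poincare inequality. *)
Lemma form_sLog_le : exists2 A : R, 0 <= A & forall u, H u -> a u u <= A * form_plus s u u.
Proof.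
have h0 : 0 < 2^-1 :> R by rewrite invr_gt0.
have c0 : 0 < c by exact: c_ns_gt0.
pose K1 := (c * - ln 2^-1)^-1.
have K10 : 0 <= K1.
  rewrite invr_ge0; apply: mulr_ge0; first exact: ltW.
  by rewrite oppr_ge0 ln_le0// invf_le1// ler1n.
pose f := n%:R * omega n * 2^-1 `^ (- (2 * s)) / (2 * s).
have f0 : 0 <= f.
  apply: divr_ge0; last by rewrite mulr_ge0 ?(ltW s_gt0).
  by apply: mulr_ge0; [apply: mulr_ge0; [by []|exact: ltW (omega_gt0 _)]|exact: powR_ge0].
have bc0 : 0 <= `|b| * c / 2 by rewrite divr_ge0// mulr_ge0// ltW.
exists (1 + `|b| * c / 2 * (K1 + 4 * f * C) + M * C).
  have f4 : 0 <= 4 * f * C by apply: mulr_ge0; [exact: mulr_ge0|exact: ltW].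
  have Kf : 0 <= `|b| * c / 2 * (K1 + 4 * f * C) by apply: mulr_ge0 => //; exact: addr_ge0.
  by apply: addr_ge0; [exact: addr_ge0|apply: mulr_ge0 => //; exact: ltW].
move=> u Hu.
have sP := sqr_le_form_plus Hu.
have potP := pot_le mV VM Hu.
have m0 : 0 <= form_minus s u u.
  by apply: fine_ge0; apply: energy_ge0 => x; exact: kernel_minus_ge0.
have s0 : 0 <= form_s s u u.
  by apply: fine_ge0; apply: energy_ge0 => x; exact: kernel_s_ge0.
have sL : form_s s u u <= (K1 + 4 * f * C) * form_plus s u u.
  rewrite -lee_fin /form_s fineK; last first.
    rewrite ge0_fin_numE; first exact: H_energy_s Hu.
    by apply: energy_ge0 => x; exact: kernel_s_ge0.
  apply: le_trans (energy_s_le s_gt0 s_lt1 Hu) _.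
  rewrite mulrDl EFinD (energy_plusE s_gt0 s_lt1 Hu) -EFinM leeD2l//.
  apply: le_trans (energy_le_L2 (H_measurable Hu) (measurable_kernel_far s _) (kernel_far_ge0 s _)) _.
  rewrite (integral_kernel_far n s_gt0 h0) -/f (H_integral_sqr Hu) -!EFinM lee_fin.
  have f4 : 0 <= 4 * f by exact: mulr_ge0.
  by rewrite -(mulrA (4 * f)) ler_wpM2l.
have bL : b * c / 2 * form_s s u u <= `|b| * c / 2 * form_s s u u.
  by rewrite !ler_wpM2r ?invr_ge0 ?(ltW c0)// ler_norm.
have bL2 : `|b| * c / 2 * form_s s u u <= `|b| * c / 2 * ((K1 + 4 * f * C) * form_plus s u u).
  by rewrite ler_wpM2l.
have mL : M * \int[mu]_x (u x ^+ 2) <= M * (C * form_plus s u u) by rewrite ler_wpM2l.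
cbv beta; rewrite /form_sLog.
rewrite ![in leRHS]mulrDl mul1r; lra.
Qed.

Hypothesis V_ge : {ae mu, forall x, Omega x ->
  c * (n%:R * omega n) / s ^+ 2 + `|b| * c / s * (n%:R * omega n) * r `^ (- (2 * s)) <= V x}.

Lemma coercive u : H u -> alpha * form_plus s u u <= a u u.
Proof.
move=> Hu; have := form_sLog_ge s_gt0 s_lt1 r_gt0 radius_lt1 Hu Hu (dprod_ge0 u).
have := kform_err_le Hu; have := pot_ge mV VM Hu V_ge; lra.
Qed.

Lemma normH_sqr (u : E -> R) : normH s u ^+ 2 = form_plus s u u.
Proof. by rewrite sqr_sqrtr// form_plus_ge0. Qed.

Lemma dual_zero : F 0 = 0.
Proof.
have H0 := H_zero s Omega.
by have := FP.1 1 0 0 H0 H0; rewrite scaler0 addr0 mul1r; lra.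
Qed.

Lemma dual_norm_bound u : H u -> `|F u| <= dual_norm s Omega F * normH s u.
Proof.
move=> Hu; have [linF [K FK]] := FP.
(* Without a norm to divide by, boundedness of F gives F u = 0. *)
have [u0|u0] := eqVneq (normH s u) 0.
  by have := FK _ Hu; rewrite u0 !mulr0.
have up : 0 < normH s u by rewrite lt_neqAle eq_sym u0 sqrtr_ge0.
have H0 := H_zero s Omega.
pose t := (normH s u)^-1; have t0 : 0 < t by rewrite invr_gt0.
have Ht : H (t *: u) by have := H_lin s_gt0 s_lt1 t Hu H0; rewrite addr0.
have nt : normH s (t *: u) = 1.
  rewrite /normH; have -> : form_plus s (t *: u) (t *: u) = t ^+ 2 * form_plus s u u.
    have l v w : H v -> H w -> form_plus s (t *: v) w = t * form_plus s v w.
      move=> Hv Hw; have := form_plus_lin s_gt0 s_lt1 t Hv H0 Hw; rewrite addr0 => ->.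
      by have := form_plus_lin s_gt0 s_lt1 1 H0 H0 Hw; rewrite scaler0 addr0; lra.
    by rewrite l// form_plusC l//; ring.
  by rewrite sqrtrM ?sqr_ge0// sqrtr_sqr gtr0_norm// /t mulVf.
have Ft : F (t *: u) = t * F u.
  by have := linF t u 0 Hu H0; rewrite addr0 dual_zero addr0.
have : `|F (t *: u)| <= dual_norm s Omega F.
  apply: ub_le_sup; last by exists (t *: u) => //; split=> //; rewrite nt.
  exists `|K| => _ [w [Hw w1] <-]; apply: (le_trans (FK _ Hw)).
  apply: (@le_trans _ _ (`|K| * normH s w)); first by rewrite ler_wpM2r ?sqrtr_ge0// ler_norm.
  by rewrite ler_piMr.
by rewrite Ft normrM gtr0_norm// /t mulrC ler_pdivrMr.
Qed.

Lemma form_pot_lin t u w v : H u -> H w -> H v ->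
  a (t *: u + w) v = t * a u v + a w v.
Proof.
move=> Hu Hw Hv; cbv beta.
rewrite (form_sLog_lin s_gt0 s_lt1 t Hu Hw Hv) (pot_lin mV VM t Hu Hw Hv); ring.
Qed.

Lemma form_plus_zero u : H u -> form_plus s u u <= 0 -> {ae mu, forall x, u x = 0}.
Proof.
move=> Hu u0; have := poincareC Hu; rewrite (energy_plusE s_gt0 s_lt1 Hu).
have -> : form_plus s u u = 0 by apply/eqP; rewrite eq_le u0 form_plus_ge0.
rewrite mule0 => I0; have mu2 : measurable_fun setT (fun x => (u x ^+ 2)%:E).
  by apply/measurable_EFinP; apply: measurable_funX; exact: H_measurable Hu.
have : (\int[mu]_x `|(u x ^+ 2)%:E| = 0)%E.
  apply/eqP; rewrite eq_le integral_ge0// andbT; apply: le_trans I0.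
  by rewrite le_eqVlt; apply/orP; left; apply/eqP; apply: eq_integral => x _; rewrite gee0_abs// lee_fin sqr_ge0.
move/(ae_eq_integral_abs mu measurableT mu2).1; apply: filterS => x /(_ Logic.I)[] /eqP.
by rewrite sqrf_eq0 => /eqP.
Qed.

(** On H the form is symmetric and equivalent to E_+ by [coercive] and [form_sLog_le], so Riesz
    applies to it directly. Coercivity on the difference of two solutions gives uniqueness; tested
    with u itself it gives the estimate. *)
Lemma well_posed : exists u, [/\ H u /\ (forall phi, H phi -> a u phi = F phi),
  forall v, H v /\ (forall phi, H phi -> a v phi = F phi) -> v = u %[ae mu] &
  normH s u <= alpha^-1 * dual_norm s Omega F].
Proof.
have H0 := H_zero s Omega; have al0 := alpha_gt0.
have [linF [K FK]] := FP.
have [A A0 Ale] := form_sLog_le.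
have [|||||||u [Hu uF]] := @riesz_representation R _ H a F (K ^+ 2 / alpha) H0.
- by move=> t u w; exact: H_lin.
- by move=> u w _ _; rewrite form_sLogC potC.
- exact: form_pot_lin.
- move=> u Hu; apply: le_trans (coercive Hu); apply: mulr_ge0; first exact: ltW.
  exact: form_plus_ge0.
- exact: linF.
- move=> u Hu; rewrite -mulrA.
  apply: (@le_trans _ _ (K ^+ 2 * form_plus s u u)).
    rewrite -normH_sqr -exprMn -real_normK ?num_real//.
    have := FK _ Hu => Fu; rewrite lerXn2r// nnegrE//; exact: le_trans Fu.
  by rewrite ler_wpM2l ?sqr_ge0// ler_pdivlMl// coercive.
- move=> x Hx xC.
  have [|u [Hu ux]] := @H_complete _ _ s Omega C s_gt0 s_lt1 C_gt0 poincareC x Hx.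
    move=> e e0; have [N NP] := xC _ (mulr_gt0 al0 e0); exists N => i j iN jN.
    have Hij := H_sub s_gt0 s_lt1 (Hx i) (Hx j).
    by rewrite -(ler_pM2l al0) (le_trans (coercive Hij))// NP.
  exists u; split=> // e e0.
  have A1 : 0 < A + 1 by rewrite ltr_wpDl.
  have [N NP] := ux _ (divr_gt0 e0 A1); exists N => k kN.
  have Hk := H_sub s_gt0 s_lt1 (Hx k) Hu.
  apply: le_trans (Ale _ Hk) _; have := NP _ kN; rewrite ler_pdivlMr//.
  by have := form_plus_ge0 s_gt0 s_lt1 (x k - u); lra.
exists u; split=> //.
- move=> v [Hv vF]; have Hd := H_sub s_gt0 s_lt1 Hv Hu.
  have : a (v - u) (v - u) = 0.
    have := form_pot_lin (-1) Hu Hv Hd; rewrite scaleN1r (addrC (- u) v) => ->.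
    by rewrite uF// vF//; ring.
  have := coercive Hd; move=> /[swap] ->; rewrite pmulr_rle0// => /(form_plus_zero Hd).
  by apply: filterS => x; rewrite sub_funE => /eqP; rewrite subr_eq0 => /eqP vu _.
- have nu0 : 0 <= normH s u by exact: sqrtr_ge0.
  have := coercive Hu; rewrite uF// -normH_sqr.
  have := le_trans (ler_norm _) (dual_norm_bound Hu) => h1 h2.
  have {}h1 := le_trans h2 h1.
  (* If the norm is 0 it cannot be cancelled; what remains to be seen is that the supremum
     [dual_norm] is nonnegative, and it dominates |F 0|. *)
  have [u0|u0] := eqVneq (normH s u) 0.
    rewrite u0 mulr_ge0 ?invr_ge0 ?(ltW al0)//.
    have : `|F 0| <= dual_norm s Omega F.
      apply: ub_le_sup; last first.
        exists 0 => //; split => //.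
        have : form_plus s (0 : E -> R) 0 = 0.
          by have := form_plus_lin s_gt0 s_lt1 1 H0 H0 H0; rewrite scaler0 addr0; lra.
        by rewrite /normH => ->; rewrite sqrtr0.
      exists `|K| => _ [w [Hw w1] <-]; apply: (le_trans (FK _ Hw)).
      apply: (@le_trans _ _ (`|K| * normH s w)); first by rewrite ler_wpM2r ?sqrtr_ge0// ler_norm.
      by rewrite ler_piMr.
    by apply: le_trans.
  have up : 0 < normH s u by rewrite lt_neqAle eq_sym u0.
  rewrite ler_pdivlMl//; rewrite expr2 mulrA in h1.
  by rewrite -(ler_pM2r up).
Qed.
End well_posedness.

(** * Boundedness of solutions *)

Section stampacchia.
Context {R : realType}.

(** Iteration along levels increasing from M to 2 M. The factor k/(h - k) is invariant under scaling
    of the levels, so wider steps gain nothing; the smallness that starts the iteration comes from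
    a(k) -> 0. *)
Lemma stampacchia (a : R -> R) (C k0 eps : R) : 0 < C -> 0 < k0 -> 0 < eps ->
  (forall k, 0 <= a k) -> (forall k h, 0 < k -> k <= h -> a h <= a k) ->
  (forall d : R, 0 < d -> exists K, forall k, K <= k -> a k <= d) ->
  (forall k h, k0 <= k -> k < h -> h <= 2 * k ->
     a h <= C * (k / (h - k)) ^+ 2 * a k `^ (1 + eps)) ->
  exists2 M, 0 < M & a M = 0.
Proof.
move=> C0 k00 eps0 a0 amono acvg aH.
(* Ratio of the geometric decay: th^(eps j) = 4^-j cancels the growth 4^j of the squared level
   ratio. *)
pose th : R := 4 `^ (- eps^-1); have th0 : 0 < th by exact: powR_gt0.
have th1 : th < 1.
  rewrite /th powRN invf_lt1 ?powR_gt0//.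
  rewrite [ltLHS](_ : 1 = 1 `^ eps^-1); last by rewrite powR1.
  by apply: gt0_ltr_powR; rewrite ?invr_gt0 ?nnegrE// ltr1n.
have thE : th `^ eps = 4^-1.
  by rewrite /th -powRrM mulNr mulVf ?gt_eqF// powR_inv1.
(* Chosen so that 16 C de^eps = th, which closes the induction step. *)
pose de := (th / (16 * C)) `^ (eps^-1).
have tC : 0 < th / (16 * C) by rewrite divr_gt0// mulr_gt0.
have [K KP] := acvg de (powR_gt0 _ tC).
pose M := Num.max k0 K.
have M0 : 0 < M by rewrite lt_max k00.
have aM : 16 * C * a M `^ eps <= th.
  have : a M `^ eps <= de `^ eps.
    by rewrite ge0_ler_powR ?nnegrE ?a0 ?powR_ge0 ?(ltW eps0)// KP// le_max lexx orbT.
  rewrite /de -powRrM mulVf ?gt_eqF// powRr1 ?(ltW tC)// ler_pdivlMr ?mulr_gt0//.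
  by rewrite mulrC.
pose kk j := M * (2 - 2^-1 ^+ j).
have q0 j : 0 < 2^-1 ^+ j :> R by rewrite exprn_gt0// invr_gt0.
have q1 j : 2^-1 ^+ j <= 1 :> R by rewrite exprn_ile1// ?invr_ge0// invf_le1// ler1n.
have kkM j : M <= kk j by rewrite /kk ler_peMr ?(ltW M0)//; have := q1 j; lra.
have kk2M j : kk j <= 2 * M by rewrite /kk mulrC ler_pM2r//; have := q0 j; lra.
have ind j : a (kk j) <= a M * th ^+ j.
  elim: j => [|j IH]; first by rewrite /kk !expr0 mulr1 (_ : 2 - 1 = 1) ?mulr1//; ring.
  have dkk : kk j.+1 - kk j = M * 2^-1 ^+ j.+1 by rewrite /kk exprS; field.
  have dkk0 : 0 < kk j.+1 - kk j by rewrite dkk mulr_gt0.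
  have kh : kk j < kk j.+1 by rewrite -subr_gt0.
  apply: (le_trans (aH (kk j) (kk j.+1) _ kh _)).
  - by apply: le_trans (kkM j); rewrite le_max lexx.
  - by apply: le_trans (kk2M _) _; rewrite ler_pM2l.
  (* The level is at most 2 M and the gap is M 2^(-j-1), so their ratio is at most 2^(j+2). *)
  have ratio : (kk j / (kk j.+1 - kk j)) ^+ 2 <= 16 * 4 ^+ j.
    have -> : 16 * 4 ^+ j = (2 ^+ j.+2) ^+ 2 :> R.
      rewrite -exprM mulnC exprM (_ : 2 ^+ 2 = 4 :> R); last by rewrite expr2; ring.
      by rewrite !exprS; ring.
    rewrite lerXn2r ?nnegrE ?exprn_ge0// ?divr_ge0 ?(ltW dkk0) ?(le_trans (ltW M0))//.
    rewrite ler_pdivrMr// dkk (le_trans (kk2M j))// mulrCA exprS.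
    by rewrite -mulrA -exprMn mulfV// expr1n mulr1 mulrC.
  have pw : a (kk j) `^ (1 + eps) <= a M * th ^+ j * (a M `^ eps * (4 ^+ j)^-1).
    apply: (@le_trans _ _ ((a M * th ^+ j) `^ (1 + eps))).
      by rewrite ge0_ler_powR ?nnegrE ?a0 ?mulr_ge0 ?a0 ?exprn_ge0 ?addr_ge0 ?(ltW eps0) ?(ltW th0).
    have [->|aM0] := eqVneq (a M) 0.
      by rewrite !mul0r powR0// gt_eqF// ltr_wpDl.
    have aMp : 0 < a M by rewrite lt_neqAle eq_sym aM0 a0.
    have p0 : 0 < a M * th ^+ j by rewrite mulr_gt0// exprn_gt0.
    rewrite powRD ?(gt_eqF p0) ?implybT// powRr1 ?(ltW p0)// ler_wpM2l ?(ltW p0)//.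
    rewrite powRM ?a0 ?exprn_ge0 ?(ltW th0)// ler_wpM2l ?powR_ge0//.
    rewrite -powR_mulrn ?(ltW th0)// -powRrM (mulrC j%:R) powRrM thE powR_mulrn ?invr_ge0//.
    by rewrite exprVn.
  apply: (@le_trans _ _ (C * (16 * 4 ^+ j) * (a M * th ^+ j * (a M `^ eps * (4 ^+ j)^-1)))).
    apply: ler_pM => //.
    - by rewrite mulr_ge0 ?(ltW C0)// sqr_ge0.
    - exact: powR_ge0.
    - by rewrite ler_pM2l.
  have -> : C * (16 * 4 ^+ j) * (a M * th ^+ j * (a M `^ eps * (4 ^+ j)^-1)) =
      (16 * C * a M `^ eps) * (a M * th ^+ j).
    by field; rewrite gt_eqF// exprn_gt0.
  rewrite exprS (mulrCA (a M)) ler_wpM2r// mulr_ge0 ?a0 ?exprn_ge0 ?(ltW th0)//.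
exists (2 * M); first by rewrite mulr_gt0.
have le0 j : a (2 * M) <= a M * th ^+ j by apply: le_trans (ind j); apply: amono => //; exact: lt_le_trans (kkM j).
apply/eqP; rewrite eq_le a0 andbT.
have thl : (fun j => a M * th ^+ j) @ \oo --> a M * 0.
  by apply: cvgMr; apply: cvg_expr; rewrite ger0_norm ?(ltW th0).
rewrite -(mulr0 (a M)) -(cvg_lim (@Rhausdorff R) thl).
apply: limr_ge; first by apply/cvg_ex; exists (a M * 0).
exact: nearW.
Qed.
End stampacchia.

(** * Truncations and level sets *)

Section truncation.
Context {R : realType}.
Implicit Types t u k d : R.

Definition trunc k d t : R := Num.min (Num.max (t - k) 0) d.

Lemma trunc_ge0 k d t : 0 <= d -> 0 <= trunc k d t.
Proof. by move=> d0; rewrite le_min d0 le_max lexx orbT. Qed.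

Lemma trunc_le k d t : trunc k d t <= d.
Proof. by rewrite ge_min lexx orbT. Qed.

Lemma trunc_eq0 k d t : 0 <= d -> t <= k -> trunc k d t = 0.
Proof. by move=> d0 tk; rewrite /trunc max_r ?subr_le0// min_l. Qed.

Lemma trunc_eqd k d t : 0 <= d -> k + d <= t -> trunc k d t = d.
Proof.
move=> d0 tk; rewrite /trunc min_r// le_max; apply/orP; left; lra.
Qed.

Lemma trunc_le_norm k d t : 0 <= k -> 0 <= d -> trunc k d t <= `|t|.
Proof.
move=> k0 d0; rewrite ge_min ge_max normr_ge0 andbT; apply/orP; left.
by rewrite (le_trans _ (ler_norm _))// lerBlDr lerDl.
Qed.

(** Monotone and 1-Lipschitz. Monotonicity gives the sign of [dprod u T], the Lipschitz bound keeps
    truncations in H. *)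
Lemma trunc_incr k d t u : 0 <= d -> t <= u -> 0 <= trunc k d u - trunc k d t <= u - t.
Proof.
move=> d0 tu; rewrite /trunc /Num.min /Num.max.
by do !case: ifPn; rewrite -?leNgt => *; apply/andP; split; lra.
Qed.

Lemma trunc_dprod_ge0 k d t u : 0 <= d -> 0 <= (t - u) * (trunc k d t - trunc k d u).
Proof.
move=> d0; have [tu|ut] := leP t u.
  have /andP[h _] := trunc_incr k d0 tu.
  by rewrite -mulrNN !opprB mulr_ge0// subr_ge0.
have /andP[h _] := trunc_incr k d0 (ltW ut).
by rewrite mulr_ge0// subr_ge0 ltW.
Qed.

Lemma trunc_sqr_le k d t u : 0 <= d ->
  (trunc k d t - trunc k d u) * (trunc k d t - trunc k d u) <= (t - u) * (t - u).
Proof.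
move=> d0; have [tu|ut] := leP t u.
  have /andP[h h'] := trunc_incr k d0 tu.
  by rewrite -mulrNN -[leRHS]mulrNN !opprB ler_pM.
have /andP[h h'] := trunc_incr k d0 (ltW ut).
by rewrite ler_pM.
Qed.
End truncation.

Section level_sets.
Context {R : realType} (n : nat) (s : R) (Omega : set 'rV[R]_n).
Hypotheses (n_ge1 : (1 <= n)%N) (s_gt0 : 0 < s) (s_lt1 : s < 1).
Local Notation E := 'rV[R]_n.
Local Notation mu := (lebesgue_rV n).
Local Notation kp := (kernel_plus s : E -> R).
Local Notation H := (H0sLog s Omega).
Variable u : E -> R.
Hypothesis Hu : H u.

Definition level (k : R) : set E := [set x | k < u x].
Definition level_measure (k : R) : R := fine (mu (level k)).

Lemma measurable_level k : measurable (level k).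
Proof.
rewrite -[X in measurable X]setTI.
have := H_measurable Hu measurableT (measurable_itv (`]k, +oo[ : interval R)).
by congr (measurable (_ `&` _)); apply/seteqP; split=> x /=; rewrite in_itv/= andbT.
Qed.

(** Chebyshev's inequality; it yields both the finiteness and the decay to 0 of the level
    measures. *)
Lemma level_le k : 0 < k -> (mu (level k) <= (k ^- 2 * \int[mu]_x (u x ^+ 2))%:E)%E.
Proof.
move=> k0; rewrite EFinM -(H_integral_sqr Hu).
rewrite -ge0_integralZl_R//; last 3 first.
- by apply: measurable_funX; exact: H_measurable Hu.
- by move=> x _; rewrite sqr_ge0.
- by rewrite invr_ge0 exprn_ge0// ltW.
rewrite -(setIT (level k)) -(integral_indic mu measurableT (measurable_level k)).
apply: ge0_le_integral => //.
- by apply/measurable_EFinP; apply: measurable_indic; exact: measurable_level.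
- by apply: measurable_funeM; apply/measurable_EFinP; apply: measurable_funX; exact: H_measurable Hu.
- move=> x _; rewrite -EFinM lee_fin indicE; case: (boolP (x \in _)) => [|_]; last first.
    by apply: mulr_ge0; [rewrite invr_ge0 exprn_ge0// ltW|exact: sqr_ge0].
  rewrite inE /level/= => kx; rewrite ler_pdivlMl ?exprn_gt0// mulr1.
  by rewrite lerXn2r ?nnegrE ?ltW// (lt_trans k0).
Qed.

Lemma level_lty k : 0 < k -> (mu (level k) < +oo)%E.
Proof. by move=> k0; apply: le_lt_trans (level_le k0) (ltry _). Qed.

Lemma level_measureE k : 0 < k -> mu (level k) = (level_measure k)%:E.
Proof. by move=> k0; rewrite fineK// ge0_fin_numE// level_lty. Qed.

Lemma level_measure_ge0 k : 0 <= level_measure k.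
Proof. exact: fine_ge0. Qed.

Lemma level_measure_le k h : 0 < k -> k <= h -> level_measure h <= level_measure k.
Proof.
move=> k0 kh; have h0 := lt_le_trans k0 kh.
rewrite -lee_fin -!level_measureE//; apply: le_measure; rewrite ?inE; do ?exact: measurable_level.
by move=> x /= ; exact: le_lt_trans.
Qed.

Lemma level_measure_cvg d : 0 < d -> exists K, forall k, K <= k -> level_measure k <= d.
Proof.
move=> d0; set I := \int[mu]_x (u x ^+ 2).
have I0 : 0 <= I by apply: fine_ge0; apply: integral_ge0 => x _; rewrite lee_fin sqr_ge0.
exists (1 + I / d) => k Kk; have Id : 0 <= I / d by rewrite divr_ge0// ltW.
have k1 : 1 <= k by lra.
have k0 : 0 < k by lra.
rewrite -lee_fin -level_measureE//; apply: le_trans (level_le k0) _.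
rewrite lee_fin -/I ler_pdivrMl ?exprn_gt0//.
have : I <= k * d by rewrite -ler_pdivrMr//; lra.
by move=> Ikd; rewrite (le_trans Ikd)// ler_pM2r// expr2 ler_peMl// ltW.
Qed.

Lemma trunc_H k d : 0 <= k -> 0 <= d -> H (trunc k d \o u).
Proof.
move=> k0 d0; have mu_ := H_measurable Hu.
have mt : measurable_fun setT (trunc k d \o u).
  apply: measurable_minr => //; apply: measurable_maxr => //; exact: measurable_funB.
have mkp := measurable_kernel_plus s (n := n) (R := R).
split.
- apply/Lfun2E; split=> //; apply: le_lt_trans (H_L2 Hu); apply: ge0_le_integral => //.
  + by move=> x _; rewrite lee_fin sqr_ge0.
  + by apply/measurable_EFinP; exact: measurable_funX.
  + by apply/measurable_EFinP; exact: measurable_funX.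
  + move=> x _; rewrite lee_fin -[leRHS]real_normK ?num_real// lerXn2r ?nnegrE ?trunc_ge0//.
    exact: trunc_le_norm.
- apply: le_lt_trans (H_energy_plus Hu); apply: energy_le => //.
  move=> z; rewrite mulr_ge0 ?dprod_ge0 ?kernel_plus_ge0//= ler_wpM2r ?kernel_plus_ge0//.
  exact: trunc_sqr_le.
- by case: Hu => _ _; apply: filterS => x /[apply]; move=> ux; rewrite /= ux trunc_eq0.
Qed.

(** Only pairs with y outside the level set are kept; there the integrand is at least P x k_+(x -
    y), and integrating in y first produces G. P is (u - k) T in [level_decay] and (h - k)^2 on {u >
    h} in [level_decay_supercritical]. *)
Lemma energy_level_ge (w : E -> R) (P : E -> R) (k G : R) : 
  measurable_fun setT w -> measurable_fun setT P -> (forall x, 0 <= P x) -> 0 <= G ->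
  (forall z, 0 <= dprod u w z) ->
  (forall x y, ~ level k y -> P x <= dprod u w (x, y)) ->
  (forall x, (G%:E <= \int[mu]_y (\1_(~` level k) y * kp (x - y))%:E)%E) ->
  (G%:E * \int[mu]_x (P x)%:E <= energy kp u w)%E.
Proof.
move=> mw mP P0 G0 d0 Pd GP; have mkp := measurable_kernel_plus s (n := n) (R := R).
have kp0 := kernel_plus_ge0 (n := n) s_gt0 s_lt1.
have mu_ := H_measurable Hu.
have mI : measurable_fun setT (\1_(~` level k) : E -> R).
  by apply: measurable_indic; apply: measurableC; exact: measurable_level.
pose f (z : E * E) := (P z.1 * (\1_(~` level k) z.2 * kp (z.1 - z.2)))%:E.
have mf : measurable_fun setT f.
  apply/measurable_EFinP; apply: measurable_funM; first exact: (measurable_fun_fst mP).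
  apply: measurable_funM; [exact: (measurable_fun_snd mI)|exact: (measurable_fun_diff mkp)].
have f0 z : (0 <= f z)%E by rewrite lee_fin; apply: mulr_ge0 => //; exact: mulr_ge0.
apply: (@le_trans _ _ (\int[mu \x mu]_z f z)%E); last first.
  apply: ge0_le_integral => //.
  - by apply/measurable_EFinP; exact: measurable_dprod_kernel.
  - move=> [x y] _; rewrite lee_fin /= indicE; case: (boolP (y \in _)) => [|_]; last first.
      by rewrite mul0r mulr0 mulr_ge0// (d0 (x, y)).
    by rewrite inE mul1r => yk; rewrite ler_wpM2r// Pd.
rewrite fubini_tonelli1// -ge0_integralZl_R//; last first.
apply: ge0_le_integral => //.
- by move=> x _; rewrite -EFinM lee_fin mulr_ge0.
- by apply: measurable_funeM; exact/measurable_EFinP.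
- exact: measurable_fun_fubini_tonelli_F.
- move=> x _; rewrite /fubini_F /f /=.
  under eq_integral do rewrite EFinM.
  rewrite ge0_integralZl_R//; last 2 first.
  + apply: measurable_funM => //; apply: (measurableT_comp mkp).
    rewrite (_ : (fun y => _) = (fun y => (-1) *: y + x)); first exact: measurable_affine_rV.
    by apply/funext => y; rewrite scaleN1r addrC.
  + by move=> y _; rewrite mulr_ge0.
  by rewrite muleC lee_wpmul2l// lee_fin.
Qed.
End level_sets.

(** * Decay of the level measures *)

Section boundedness.
Context {R : realType} (n : nat) (s : R) (Omega : set 'rV[R]_n).
Hypotheses (n_ge1 : (1 <= n)%N) (s_gt0 : 0 < s) (s_lt1 : s < 1).
Local Notation E := 'rV[R]_n.
Local Notation mu := (lebesgue_rV n).
Local Notation c := (c_ns n s).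
Local Notation b := (b_ns n s).
Local Notation kp := (kernel_plus s : E -> R).
Local Notation H := (H0sLog s Omega).

Lemma ge0_integral_prod (f g : E -> R) : measurable_fun setT f -> measurable_fun setT g ->
  (forall x, 0 <= f x) -> (forall x, 0 <= g x) ->
  (\int[mu \x mu]_z (f z.1 * g z.2)%:E = \int[mu]_x (f x)%:E * \int[mu]_x (g x)%:E)%E.
Proof.
move=> mf mg f0 g0; rewrite fubini_tonelli1//=; last 2 first.
- by apply/measurable_EFinP; apply: measurable_funM; [exact: (measurable_fun_fst mf)|exact: (measurable_fun_snd mg)].
- by move=> z; rewrite lee_fin mulr_ge0.
rewrite -ge0_integralZr//; last 3 first.
- exact/measurable_EFinP.
- by move=> x _; rewrite lee_fin.
- by apply: integral_ge0 => x _; rewrite lee_fin.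
apply: eq_integral => x _; rewrite /fubini_F /=.
under eq_integral do rewrite EFinM.
by rewrite ge0_integralZl_R.
Qed.

Lemma integrable_EFin_Rintegral (f : E -> R) : mu.-integrable setT (EFin \o f) ->
  (\int[mu]_x (f x)%:E = (\int[mu]_x f x)%:E)%E.
Proof. by move=> i; rewrite fineK//; exact: integrable_fin_num. Qed.

(* The cross terms are decoupled by
   [2 |u x| T y L(x - y) <= T y L(x - y) + (sup L) (u x)^2 T y]. *)
Lemma kform_err_le_mul r (u : E -> R) : 0 < r -> H u ->
  exists la C1 : R, [/\ 0 <= la, 0 <= C1 & forall T : E -> R, H T ->
    (forall x, 0 <= T x) -> (forall x, 0 <= u x * T x) -> (forall z, 0 <= dprod u T z) ->
    mu.-integrable setT (EFin \o T) ->
    kform (kernel_err s r) u T <= la * \int[mu]_x (u x * T x) + C1 * \int[mu]_x T x].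
Proof.
move=> r0 Hu; have mu_ := H_measurable Hu.
pose L := kernel_err s r : E -> R.
have mL : measurable_fun setT L by exact: measurable_kernel_err.
have L0 z : 0 <= L z by exact: kernel_err_ge0.
pose S := c + `|b| * c / 2 * r `^ (- n%:R - 2 * s).
have LS z : L z <= S by exact: kernel_err_le.
have S0 : 0 <= S by exact: le_trans (L0 0) (LS 0).
have [ka kaE] : exists ka : R, (\int[mu]_z (L z)%:E = ka%:E)%E.
  have := integral_kernel_err n s_gt0 s_lt1 r0; rewrite -/L.
  case: (\int[mu]_z _)%E => [x _||]; [by exists x|by rewrite mulry gtr0_sg// mul1e => /(congr1 (fun x => x \is a fin_num))|].
  by rewrite mulrNy gtr0_sg// mul1e => /(congr1 (fun x => x \is a fin_num)).
have ka0 : 0 <= ka by rewrite -lee_fin -kaE; apply: integral_ge0 => z _; rewrite lee_fin.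
pose I2 := \int[mu]_x (u x ^+ 2).
have I20 : 0 <= I2 by apply: fine_ge0; apply: integral_ge0 => x _; rewrite lee_fin sqr_ge0.
(* Both constants are independent of T, hence of the level. By symmetry the decoupled bound counts
   the integrals of [f1] against L and of [h] against T twice: 2 ka (int u T + (int T)/2) + 2 (S/2)
   I2 int T. *)
exists (2 * ka), (ka + S * I2); split.
- exact: mulr_ge0.
- by apply: addr_ge0 => //; exact: mulr_ge0.
move=> T HT T0 uT0 d0 iT; have mT := H_measurable HT.
pose f1 x := u x * T x + 2^-1 * T x; pose h x := S / 2 * u x ^+ 2.
have mf1 : measurable_fun setT f1 by apply: measurable_funD; apply: measurable_funM.
have mh : measurable_fun setT h by apply: measurable_funM => //; exact: measurable_funX.
have f10 x : 0 <= f1 x by rewrite addr_ge0// mulr_ge0// invr_ge0.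
have h0 x : 0 <= h x by apply: mulr_ge0; [rewrite divr_ge0|exact: sqr_ge0].
have iuT := H_integrable_mul Hu HT.
have f1E : (\int[mu]_x (f1 x)%:E = (\int[mu]_x (u x * T x) + 2^-1 * \int[mu]_x T x)%:E)%E.
  have i2 := integrableZl measurableT 2^-1 iT.
  by rewrite -RintegralZl// -RintegralD// -integrable_EFin_Rintegral//; exact: (integrableD measurableT iuT i2).
have hE : (\int[mu]_x (h x)%:E = (S / 2 * I2)%:E)%E.
  rewrite /h; under eq_integral do rewrite EFinM.
  rewrite ge0_integralZl_R//; [|exact: measurable_funX|by move=> x _; rewrite sqr_ge0|exact: divr_ge0].
  by rewrite (H_integral_sqr Hu) -EFinM.
have TE := integrable_EFin_Rintegral iT.
have m1 : measurable_fun setT (fun z : E * E => f1 z.1 * L (z.1 - z.2)).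
  by apply: measurable_funM; [exact: (measurable_fun_fst mf1)|exact: (measurable_fun_diff mL)].
have m2 : measurable_fun setT (fun z : E * E => f1 z.2 * L (z.1 - z.2)).
  by apply: measurable_funM; [exact: (measurable_fun_snd mf1)|exact: (measurable_fun_diff mL)].
have m3 : measurable_fun setT (fun z : E * E => h z.1 * T z.2).
  by apply: measurable_funM; [exact: (measurable_fun_fst mh)|exact: (measurable_fun_snd mT)].
have m4 : measurable_fun setT (fun z : E * E => T z.1 * h z.2).
  by apply: measurable_funM; [exact: (measurable_fun_fst mT)|exact: (measurable_fun_snd mh)].
rewrite -lee_fin fineK; last first.
  exact: integrable_fin_num (H_integrable_err s_gt0 s_lt1 r0 Hu HT).
apply: (@le_trans _ _ (\int[mu \x mu]_z ((f1 z.1 * L (z.1 - z.2) + f1 z.2 * L (z.1 - z.2)) + (h z.1 * T z.2 + T z.1 * h z.2))%:E)%E).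
  apply: ge0_le_integral => //.
  - by move=> z _; rewrite lee_fin mulr_ge0// d0.
  - by apply/measurable_EFinP; exact: measurable_dprod_kernel.
  - by apply/measurable_EFinP; apply: measurable_funD; exact: measurable_funD.
  - move=> [x y] _; rewrite lee_fin -[kernel_err _ _ _]/(L (x - y)) /f1 /h /=.
    have := LS (x - y); have := L0 (x - y); move: (L (x - y)) => l l0 lS.
    have cross t v : 0 <= v -> - (t * v) * l <= 2^-1 * v * l + S / 2 * t ^+ 2 * v.
      move=> v0; apply: (@le_trans _ _ (2^-1 * (1 + t ^+ 2) * (v * l))).
        rewrite -mulNr -mulrA ler_wpM2r ?mulr_ge0//.
        by have := sqr_ge0 (t + 1); rewrite !expr2; lra.
      have : 2^-1 * t ^+ 2 * v * l <= 2^-1 * t ^+ 2 * v * S.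
        by rewrite ler_wpM2l// mulr_ge0// mulr_ge0 ?sqr_ge0// invr_ge0.
      rewrite !expr2; lra.
    have := cross (u x) (T y) (T0 y); have := cross (u y) (T x) (T0 x).
    rewrite !expr2; nra.
rewrite ge0_integralD_R//; last 4 first.
- exact: measurable_funD.
- by move=> z _; rewrite addr_ge0// mulr_ge0.
- exact: measurable_funD.
- by move=> z _; rewrite addr_ge0// mulr_ge0.
rewrite !ge0_integralD_R//; last 4 first.
- by move=> z _; rewrite mulr_ge0.
- by move=> z _; rewrite mulr_ge0.
- by move=> z _; rewrite mulr_ge0.
- by move=> z _; rewrite mulr_ge0.
rewrite (ge0_integral_conv1 mf1 mL)// (ge0_integral_conv2 mf1 mL)//.
rewrite (ge0_integral_prod mh mT)// (ge0_integral_prod mT mh)//.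
rewrite f1E hE TE kaE -!EFinM -!EFinD lee_fin le_eqVlt; apply/orP; left; apply/eqP.
by rewrite -/I2; field.
Qed.

Section level_decay.
Variables (u V : E -> R) (M r : R).
Hypothesis Hu : H u.
Hypotheses (mV : measurable_fun setT V) (M_ge0 : 0 <= M) (VM : {ae mu, forall x, `|V x| <= M}).
Hypotheses (r_gt0 : 0 < r) (r_lt1 : r < 1) (al_gt0 : 0 < 1 - `|b| / (2 * ln (1 / r))).
Variables (g : E -> R) (q : R).
Hypotheses (q_gt1 : 1 < q) (q_gt : n%:R / (2 * s) < q) (mg : measurable_fun setT g).
Hypothesis gq : (\int[mu]_x (`|g x| `^ q)%:E < +oo)%E.
Hypothesis weak : forall phi, H phi -> mu.-integrable setT (EFin \o (fun x => g x * phi x)) /\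
  form_sLog s u phi + pot V u phi = \int[mu]_x (g x * phi x).

Local Notation a := (level_measure u).

(* Pointwise [t <= m^(-1/q) + t^q m^((q-1)/q)]; on the level set this replaces Hoelder's inequality. *)
Lemma powR_young (m t : R) : 0 < m -> 0 <= t ->
  t <= m `^ (- q^-1) + t `^ q * m `^ (1 - q^-1).
Proof.
move=> m0 t0; set v := m `^ (- q^-1); have v0 : 0 < v by exact: powR_gt0.
have q0 : 0 < q by exact: lt_trans q_gt1.
have vE : m `^ (1 - q^-1) = v `^ (1 - q).
  by rewrite /v -powRrM; congr (_ `^ _); field; rewrite gt_eqF.
have [tv|vt] := leP t v; first by rewrite (le_trans tv)// lerDl mulr_ge0 ?powR_ge0.
have tp : 0 < t by exact: lt_trans vt.
apply: (@le_trans _ _ (t `^ q * m `^ (1 - q^-1))); last by rewrite lerDr ltW.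
rewrite vE -[leLHS]mulr1.
have -> : t `^ q = t * t `^ (q - 1).
  by rewrite -{2}(powRr1 t0) -powRD ?(gt_eqF tp) ?implybT//; congr (_ `^ _); ring.
rewrite -mulrA ler_pM2l// (_ : 1 - q = - (q - 1)); last by ring.
rewrite powRN ler_pdivlMr ?powR_gt0// mul1r ge0_ler_powR ?nnegrE ?(ltW v0)// ?subr_ge0 ltW//.
Qed.

(** With d = h - k and D the integral of (u - k) T, E_+(u, T) dominates D times a large constant,
    while all other terms reduce to a multiple of D and to integrals over {u > k} of size d k
    a(k)^(1-1/q). *)
Lemma level_decay : exists C k0 eps : R, [/\ 0 < C, 0 < k0, 0 < eps &
  forall k h, k0 <= k -> k < h -> h <= 2 * k ->
    a h <= C * (k / (h - k)) ^+ 2 * a k `^ (1 + eps)].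
Proof.
have [c0 [m0 [c00 m00 FK]]] := faber_krahn n_ge1 s_gt0 s_lt1.
have [la1 [C1 [la10 C10 errP]]] := kform_err_le_mul r_gt0 Hu.
have al0 := al_gt0; set al := 1 - `|b| / (2 * ln (1 / r)) in al0 *.
pose la := la1 + M; have la0 : 0 <= la by exact: addr_ge0.
have n0 : 0 < n%:R :> R by rewrite ltr0n.
have q0 : 0 < q by exact: lt_trans q_gt1.
pose be := 2 * s / n%:R; have be0 : 0 < be by rewrite divr_gt0// mulr_gt0.
pose Nq := \int[mu]_x (`|g x| `^ q).
have mgq : measurable_fun setT (fun x => `|g x| `^ q).
  by apply: (measurableT_comp (measurable_powR _)); exact: measurableT_comp.
have igq : mu.-integrable setT (EFin \o (fun x => `|g x| `^ q)).
  by apply: ge0_integrable => // x; exact: powR_ge0.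
have Nq0 : 0 <= Nq by apply: fine_ge0; apply: integral_ge0 => x _; rewrite lee_fin powR_ge0.
pose eps := be - q^-1.
have eps0 : 0 < eps.
  rewrite subr_gt0 invf_plt ?posrE// /be invf_div//.
(* For a(k) <= m1, al c0 a(k)^(-be) is at least 2 la + 1, so half of the term gained exceeds la
   D. *)
pose m1 := (al * c0 / (2 * la + 1)) `^ (be^-1).
have la21 : 0 < 2 * la + 1 by lra.
have alc : 0 < al * c0 by exact: mulr_gt0.
have m1arg : 0 < al * c0 / (2 * la + 1) by exact: divr_gt0.
have m10 : 0 < m1 by exact: powR_gt0.
(* [m0] admits the bound on the k_+-mass, [m1] the absorption, and 1 gives a(k) <= a(k)^(1-1/q). *)
pose ms := Num.min m0 (Num.min m1 1).
have ms0 : 0 < ms by rewrite !lt_min m00 m10 ltr01.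
have [K KP] := level_measure_cvg Hu ms0.
pose C2 := 1 + Nq + la + C1; have C20 : 0 < C2.
  by rewrite /C2; lra.
exists (2 * C2 / (al * c0)), (Num.max 1 K), eps; split=> //.
- by rewrite divr_gt0// mulr_gt0.
- by rewrite lt_max ltr01.
move=> k h; rewrite ge_max => /andP[k1 Kk] kh h2k.
have k0 : 0 < k by exact: lt_le_trans k1.
have h0 : 0 < h by exact: lt_trans kh.
set d := h - k; have d0 : 0 < d by rewrite subr_gt0.
have dk : d <= k by rewrite /d; lra.
have kd1 : 1 <= k / d by rewrite ler_pdivlMr// mul1r.
have ah0 : 0 <= a h by exact: level_measure_ge0.
have ahk : a h <= a k by apply: (level_measure_le Hu k0); exact: ltW.
have := KP k Kk; rewrite !le_min => /andP[am0 /andP[am1 a1]].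
have [ak0|ak0] := eqVneq (a k) 0.
  have -> : a h = 0 by apply/eqP; rewrite eq_le ah0 andbT -ak0.
  apply: mulr_ge0; last exact: powR_ge0.
  by apply: mulr_ge0; [apply: divr_ge0; apply: mulr_ge0 => //; exact: ltW|exact: sqr_ge0].
have akp : 0 < a k by rewrite lt_neqAle eq_sym ak0 level_measure_ge0.
pose T := trunc k d \o u.
have HT : H T by apply: (trunc_H s_gt0 s_lt1 Hu); exact: ltW.
have mT := H_measurable HT; have mu_ := H_measurable Hu.
have T0 x : 0 <= T x by apply: trunc_ge0; exact: ltW.
have Tout x : u x <= k -> T x = 0 by apply: trunc_eq0; exact: ltW.
have Td x : T x <= d by exact: trunc_le.
have uT0 x : 0 <= u x * T x.
  have [uk|uk] := leP (u x) k; first by rewrite Tout// mulr0.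
  by apply: mulr_ge0 => //; exact: ltW (lt_trans k0 uk).
have ukT0 x : 0 <= (u x - k) * T x.
  have [uk|uk] := leP (u x) k; first by rewrite Tout// mulr0.
  by apply: mulr_ge0 => //; rewrite subr_ge0 ltW.
have dp0 z : 0 <= dprod u T z by apply: trunc_dprod_ge0; exact: ltW.
pose A := level u k; have mA : measurable A by exact: (measurable_level Hu).
pose IA := \1_A : E -> R.
have TIA x : T x <= d * IA x.
  rewrite /IA indicE; case: (boolP (x \in A)) => [_|]; first by rewrite mulr1.
  by move/negP; rewrite inE /A /level /= => /negP; rewrite -leNgt => /Tout ->; rewrite mulr0.
have muA : mu A = (a k)%:E by exact: (level_measureE Hu k0).
have iIA : mu.-integrable setT (EFin \o IA).
  apply: ge0_integrable => //; first exact: measurable_indic.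
  by rewrite integral_indic// setIT [X in (X < _)%E]muA ltry.
have IAE : \int[mu]_x IA x = a k by rewrite /Rintegral integral_indic// setIT.
have iT : mu.-integrable setT (EFin \o T).
  apply: (le_integrable measurableT _ _ (integrableZl measurableT d iIA)) => //; first exact/measurable_EFinP.
  by move=> x _ /=; rewrite lee_fin ger0_norm// (le_trans (TIA x))// ler_norm.
have iuT := H_integrable_mul Hu HT.
set iT_ := \int[mu]_x T x; set iuT_ := \int[mu]_x (u x * T x).
pose D := iuT_ - k * iT_.
have ikT := integrableZl measurableT k iT.
have iD : mu.-integrable setT (EFin \o (fun x => (u x - k) * T x)).
  apply: (eq_integrable measurableT _ _ _ (integrableB measurableT iuT ikT)) => x _ /=.
  by congr EFin; rewrite /=; ring.
have DE : \int[mu]_x ((u x - k) * T x) = D.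
  rewrite /D -RintegralZl// -RintegralB//; apply: eq_Rintegral => x _; ring.
have iT_le : iT_ <= d * a k.
  by rewrite -IAE -RintegralZl//; apply: le_Rintegral => //; exact: (integrableZl measurableT d iIA).
(* On {u > h} both factors of (u - k) T are at least d. *)
have D_ge : d ^+ 2 * a h <= D.
  have mB : measurable (level u h) by exact: (measurable_level Hu).
  have muB : mu (level u h) = (a h)%:E by exact: (level_measureE Hu h0).
  have iIB : mu.-integrable setT (EFin \o (\1_(level u h) : E -> R)).
    apply: ge0_integrable => //.
    by rewrite integral_indic// setIT [X in (X < _)%E]muB ltry.
  have <- : \int[mu]_x (\1_(level u h) : E -> R) x = a h.
    by rewrite /Rintegral integral_indic// setIT.
  rewrite -RintegralZl// -DE; apply: le_Rintegral => //; first exact: (integrableZl measurableT (d ^+ 2) iIB).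
  move=> x _; rewrite indicE; case: (boolP (x \in _)) => [|_]; last by rewrite mulr0.
  rewrite inE /level /= => hx; rewrite mulr1 expr2.
  have -> : T x = d by apply: trunc_eqd; rewrite ?(ltW d0)//= /d; lra.
  by rewrite ler_pM2r// /d; lra.
have D0 : 0 <= D by rewrite (le_trans _ D_ge)// mulr_ge0// sqr_ge0.
pose G := c0 * a k `^ (- be).
have G0 : 0 < G by rewrite mulr_gt0// powR_gt0.
have S1 : G * D <= form_plus s u T.
  have mD : measurable_fun setT (fun x => (u x - k) * T x).
    by apply: measurable_funM => //; exact: measurable_funB.
  have := @energy_level_ge _ _ s Omega s_gt0 s_lt1 u Hu T (fun x => (u x - k) * T x) k G mT mD ukT0 (ltW G0) dp0.
  rewrite integrable_EFin_Rintegral// DE -EFinM.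
  have -> : energy kp u T = (form_plus s u T)%:E.
    by rewrite fineK//; apply: integrable_fin_num => //; exact: (H_integrable_plus s_gt0 s_lt1 Hu HT).
  rewrite lee_fin; apply.
  - move=> x y yk; have uyk : u y <= k by rewrite leNgt; apply/negP.
    by rewrite /dprod /= (Tout y uyk) subr0 ler_wpM2r// lerB.
  - by move=> x; apply: FK.
have [igT wk] := weak HT.
have S2 := form_sLog_ge s_gt0 s_lt1 r_gt0 r_lt1 Hu HT dp0.
have S3 := pot_le_mul mV VM Hu HT uT0.
have S4 := errP T HT T0 uT0 dp0 iT.
rewrite -/iuT_ -/iT_ in S3 S4.
have S5 : \int[mu]_x (g x * T x) <= d * (a k `^ (1 - q^-1) * (1 + Nq)).
  pose v := a k `^ (- q^-1); pose w := a k `^ (1 - q^-1).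
  have vw : v * a k = w.
    by rewrite /v -{2}(powRr1 (ltW akp)) -powRD ?(gt_eqF akp) ?implybT//; congr (_ `^ _); ring.
  have i1 := integrableZl measurableT (d * v) iIA.
  have i2 := integrableZl measurableT (d * w) igq.
  have -> : d * (w * (1 + Nq)) = \int[mu]_x (d * v * IA x + d * w * `|g x| `^ q).
    by rewrite RintegralD// RintegralZl// RintegralZl// IAE -/Nq -(mulrA d v) vw; ring.
  apply: le_Rintegral => //; first exact: (integrableD measurableT i1 i2).
  move=> x _; apply: (@le_trans _ _ (`|g x| * T x)); first by rewrite ler_wpM2r// ler_norm.
  have [uk|uk] := leP (u x) k.
    by rewrite Tout// mulr0 addr_ge0// !mulr_ge0 ?powR_ge0 ?(ltW d0)//.
  have -> : IA x = 1 by rewrite /IA indicE mem_set.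
  rewrite mulr1 -!mulrA -mulrDr mulrC ler_pM ?normr_ge0//.
  by rewrite [X in _ + X]mulrC; exact: powR_young.
have alG : 2 * la <= al * G.
  have H1 : a k `^ be <= al * c0 / (2 * la + 1).
    have -> : al * c0 / (2 * la + 1) = m1 `^ be.
      by rewrite /m1 -powRrM mulVf ?gt_eqF// powRr1// ltW.
    by rewrite ge0_ler_powR ?nnegrE ?(ltW be0) ?(ltW akp) ?(ltW m10).
  rewrite /G powRN mulrA ler_pdivlMr ?powR_gt0//.
  by move: H1; rewrite ler_pdivlMr//; have := powR_ge0 (a k) be; lra.
(* Here int u T = D + k int T: the D part is absorbed by half of al G D, and the other part is the
   source of the factor k. *)
have main : al * G / 2 * D <= (la * k + C1) * iT_ + d * (a k `^ (1 - q^-1) * (1 + Nq)).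
  have h1 : al * (G * D) <= al * form_plus s u T by rewrite ler_pM2l.
  have h2 : - (M * iuT_) <= pot V u T by move: S3; rewrite ler_norml => /andP[].
  have h3 : 2 * la * D <= al * G * D by rewrite ler_wpM2r.
  have h4 : iuT_ = D + k * iT_ by rewrite /D; ring.
  have h5 : al * (G * D) <= la * iuT_ + C1 * iT_ + d * (a k `^ (1 - q^-1) * (1 + Nq)).
    by rewrite /la; move: S2 S4 S5; rewrite -wk -/al; lra.
  rewrite h4 in h5; lra.
pose w := a k `^ (1 - q^-1).
have w0 : 0 <= w by exact: powR_ge0.
have akw : a k <= w.
  by apply: ger1_powR; rewrite ?akp ?a1// gerBl invr_ge0 ltW.
have main2 : al * G / 2 * (d ^+ 2 * a h) <= d * (k * (C2 * w)).
  apply: (@le_trans _ _ (al * G / 2 * D)).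
    by rewrite ler_wpM2l// divr_ge0// mulr_ge0// ltW.
  apply: (le_trans main).
  have e1 : (la * k + C1) * iT_ <= (la * k + C1) * (d * w).
    rewrite ler_wpM2l//; first by rewrite addr_ge0// mulr_ge0// ltW.
    by rewrite (le_trans iT_le)// ler_pM2l.
  apply: (le_trans (lerD e1 (lexx _))).
  rewrite -/w [leLHS](_ : _ = d * ((la * k + C1 + (1 + Nq)) * w)); last by ring.
  rewrite ler_pM2l// mulrA ler_wpM2r// (_ : k * C2 = k + k * Nq + la * k + k * C1); last by rewrite /C2; ring.
  have := ler_wpM2r C10 k1; have := ler_wpM2r Nq0 k1; lra.
have Ge : a k `^ (1 + eps) = a k `^ be * w.
  rewrite /w -powRD ?(gt_eqF akp) ?implybT//; congr (_ `^ _); rewrite /eps; ring.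
(* The bound at hand is linear in k/d; since h <= 2 k gives k/d >= 1, it is weakened to the square
   required by [stampacchia]. *)
apply: (@le_trans _ _ (2 * C2 / (al * c0) * (k / d) * a k `^ (1 + eps))); last first.
  rewrite ler_wpM2r ?powR_ge0// ler_wpM2l//; first by rewrite divr_ge0// ?mulr_ge0// ltW.
  by rewrite expr2 ler_peMl// (le_trans ler01).
have abe : 0 < a k `^ be by exact: powR_gt0.
have d20 : 0 < al * c0 / 2 * d ^+ 2 / a k `^ be.
  by rewrite divr_gt0// mulr_gt0// ?exprn_gt0// divr_gt0.
rewrite Ge -(ler_pM2l d20).
have -> : al * c0 / 2 * d ^+ 2 / a k `^ be * a h = al * G / 2 * (d ^+ 2 * a h).
  by rewrite /G powRN; field; rewrite gt_eqF.
apply: (le_trans main2); rewrite le_eqVlt; apply/orP; left; apply/eqP.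
by field; rewrite !gt_eqF.
Qed.
End level_decay.
End boundedness.

(** * From decay of the level measures to upper bounds *)

Section bounded_above.
Context {R : realType} (n : nat) (s : R) (Omega : set 'rV[R]_n).
Hypotheses (n_ge1 : (1 <= n)%N) (s_gt0 : 0 < s) (s_lt1 : s < 1).
Local Notation E := 'rV[R]_n.
Local Notation mu := (lebesgue_rV n).
Local Notation kp := (kernel_plus s : E -> R).
Local Notation H := (H0sLog s Omega).

(** For x in {u > h} and y outside {u > k}, (u x - u y)^2 >= (h - k)^2, so (h - k)^2 a(h) is at most
    a multiple of E_+(u, u) a(k)^(2s/n); and 2s/n already exceeds 1. *)
Lemma level_decay_supercritical (u : E -> R) : n%:R < 2 * s -> H u ->
  exists C k0 eps : R, [/\ 0 < C, 0 < k0, 0 < eps &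
  forall k h, k0 <= k -> k < h -> h <= 2 * k ->
    level_measure u h <= C * (k / (h - k)) ^+ 2 * level_measure u k `^ (1 + eps)].
Proof.
move=> ns Hu; have mu_ := H_measurable Hu.
have [c0 [m0 [c00 m00 FK]]] := faber_krahn n_ge1 s_gt0 s_lt1.
have [K KP] := level_measure_cvg Hu m00.
have n0 : 0 < n%:R :> R by rewrite ltr0n.
pose En := form_plus s u u; have En0 : 0 <= En by exact: form_plus_ge0.
(* En + 1 keeps the constant positive when the energy is 0; k >= 1 turns 1/(h - k) into k/(h -
   k). *)
exists ((En + 1) / c0), (Num.max 1 K), (2 * s / n%:R - 1); split.
- by rewrite divr_gt0// ltr_wpDl.
- by rewrite lt_max ltr01.
- by rewrite subr_gt0 ltr_pdivlMr// mul1r.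
move=> k h; rewrite ge_max => /andP[k1 Kk] kh h2k.
have k0 : 0 < k by exact: lt_le_trans k1.
have h0 : 0 < h by exact: lt_trans kh.
set d := h - k; have d0 : 0 < d by rewrite subr_gt0.
have am0 := KP k Kk.
set ah := level_measure u h; set ak := level_measure u k in am0 *.
have ah0 : 0 <= ah by exact: level_measure_ge0.
have ahk : ah <= ak by apply: (level_measure_le Hu k0); exact: ltW.
have [ak0|ak0] := eqVneq ak 0.
  have -> : ah = 0 by apply/eqP; rewrite eq_le ah0 andbT -ak0.
  apply: mulr_ge0; last exact: powR_ge0.
  by apply: mulr_ge0; [apply: divr_ge0; [exact: addr_ge0|exact: ltW]|exact: sqr_ge0].
have akp : 0 < ak by rewrite lt_neqAle eq_sym ak0 level_measure_ge0.
rewrite (_ : 1 + (2 * s / n%:R - 1) = 2 * s / n%:R); last by ring.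
set be := 2 * s / n%:R.
have abe : 0 < ak `^ be by exact: powR_gt0.
have mB := measurable_level Hu h.
have muB : mu (level u h) = ah%:E by exact: (level_measureE Hu h0).
have mA := measurable_level Hu k.
have muA : mu (level u k) = ak%:E by exact: (level_measureE Hu k0).
pose P x : R := d ^+ 2 * (\1_(level u h) : E -> R) x.
have P0 x : 0 <= P x by rewrite mulr_ge0// sqr_ge0.
have mP : measurable_fun setT P by apply: measurable_funM => //; exact: measurable_indic.
pose G := c0 * ak `^ (- be); have G0 : 0 < G by rewrite mulr_gt0// powR_gt0.
have key : G * (d ^+ 2 * ah) <= En.
  have := @energy_level_ge _ _ s Omega s_gt0 s_lt1 u Hu u P k G mu_ mP P0 (ltW G0) (dprod_ge0 u).
  rewrite (energy_plusE s_gt0 s_lt1 Hu).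
  have -> : (\int[mu]_x (P x)%:E = (d ^+ 2 * ah)%:E)%E.
    rewrite /P; under eq_integral do rewrite EFinM.
    rewrite ge0_integralZl_R//; last exact: sqr_ge0.
    by rewrite integral_indic// setIT [X in (_ * X)%E]muB -EFinM.
  rewrite -EFinM lee_fin; apply.
  - move=> x y yk; rewrite /P indicE; case: (boolP (x \in _)) => [|_]; last by rewrite mulr0 dprod_ge0.
    rewrite inE /level/= => hx; have uyk : u y <= k by rewrite leNgt; apply/negP.
    rewrite mulr1 /dprod /= -expr2 lerXn2r ?nnegrE ?(ltW d0)//; rewrite /d; lra.
  - by move=> x; apply: FK.
have kd1 : 1 / d <= k / d by rewrite ler_pM2r ?invr_gt0.
have kd : (1 / d) ^+ 2 <= (k / d) ^+ 2.
  by rewrite lerXn2r ?nnegrE ?divr_ge0 ?(ltW d0) ?(ltW k0).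
apply: (@le_trans _ _ ((En + 1) / c0 * (1 / d) ^+ 2 * ak `^ be)); last first.
  by rewrite ler_wpM2r ?(ltW abe)// ler_wpM2l// divr_ge0 ?(ltW c00)// addr_ge0.
have d20 : 0 < G * d ^+ 2 by rewrite mulr_gt0// exprn_gt0.
rewrite -(ler_pM2l d20) -[leLHS]mulrA (le_trans key)//.
have -> : G * d ^+ 2 * ((En + 1) / c0 * (1 / d) ^+ 2 * ak `^ be) = En + 1.
  by rewrite /G powRN; field; rewrite !gt_eqF.
by rewrite lerDl.
Qed.

Lemma ae_bounded_above (u : E -> R) : H u ->
  (exists C k0 eps : R, [/\ 0 < C, 0 < k0, 0 < eps &
  forall k h, k0 <= k -> k < h -> h <= 2 * k ->
    level_measure u h <= C * (k / (h - k)) ^+ 2 * level_measure u k `^ (1 + eps)]) ->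
  exists M, {ae mu, forall x, u x <= M}.
Proof.
move=> Hu [C [k0 [eps [C0 k00 eps0 dec]]]].
have [M M0 aM] := stampacchia C0 k00 eps0 (level_measure_ge0 u)
  (level_measure_le Hu) (level_measure_cvg Hu) dec.
exists M, (level u M); split; first exact: (measurable_level Hu).
  by rewrite (level_measureE Hu M0) aM.
by move=> x /= /negP; rewrite -ltNge.
Qed.
End bounded_above.

Section bounded_domain.
Context {R : realType}.

Lemma coord_le_norm n (x : 'rV[R]_n) i : `|x ord0 i| <= `|x| + 1.
Proof.
have : ball (0 : 'rV[R]_n) (`|x| + 1) x.
  by rewrite -ball_normE /ball_ /= sub0r normrN ltrDl.
by case=> _ /(_ ord0 i); rewrite /ball/= mxE sub0r normrN => /ltW.
Qed.

Lemma bounded_coord n (Omega : set 'rV[R]_n) : bounded_set Omega ->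
  exists2 M : R, 0 < M & forall x, Omega x -> forall i, `|x ord0 i| <= M.
Proof.
move=> /pinfty_ex_gt0[M M0 OM]; exists (M + 1); first by rewrite addr_gt0.
by move=> x /OM /= xM i; rewrite (le_trans (coord_le_norm x i))// lerD2r.
Qed.

Lemma bounded_lebesgue_lty n (Omega : set 'rV[R]_n) : measurable Omega ->
  bounded_set Omega -> (lebesgue_rV n Omega < +oo)%E.
Proof.
move=> mO /bounded_coord[M M0 OM].
apply: (@le_lt_trans _ _ (lebesgue_rV n [set x | forall i, - M <= x ord0 i <= M])).
  apply: le_measure; rewrite ?inE//; first exact: measurable_box.
  by move=> x /OM xM i /=; rewrite -ler_norml.
by rewrite lebesgue_box ?ltry// lerNl (le_trans _ (ltW M0))// oppr_le0 ltW.
Qed.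

(** Provides the real exponent used in [level_decay]: a finite q is kept, and for q = +oo a bounded
    function on a set of finite measure lies in L^(p0+1). *)
Lemma Lq_finite_exponent n (Omega : set 'rV[R]_n) (g : 'rV[R]_n -> R) (q : \bar R) (p0 : R) :
  measurable Omega -> (lebesgue_rV n Omega < +oo)%E -> Lq Omega q g -> 1 <= p0 ->
  (p0%:E < q)%E ->
  exists p : R, [/\ p0 < p, measurable_fun setT (patch (cst 0) Omega g) &
    (\int[lebesgue_rV n]_x (`|patch (cst 0) Omega g x| `^ p)%:E < +oo)%E].
Proof.
move=> mO Ofin; rewrite /Lq; set G := patch _ _ _; case: q => [p Lg p01|Lg p01|//].
  rewrite lte_fin => p0p; exists p.
  have [mG Gfin] := (Lfun_finiteE (lebesgue_rV n) G (lt_trans (lt_le_trans ltr01 p01) p0p)).1 Lg.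
  by split.
move=> _; have [mG [M [M0 GM]]] := Lfun_ooP Lg.
exists (p0 + 1); split => //; first by rewrite ltrDl.
have p10 : 0 < p0 + 1 by rewrite addr_gt0// (lt_le_trans ltr01).
apply: (@le_lt_trans _ _ (\int[lebesgue_rV n]_x ((M `^ (p0 + 1))%:E * (\1_Omega x)%:E))%E); last first.
  rewrite ge0_integralZl_R//; last exact: powR_ge0.
  rewrite integral_indic// setIT lte_mul_pinfty// ?lee_fin ?powR_ge0//.
apply: ae_ge0_le_integral => //.
- apply/measurable_EFinP; apply: (measurableT_comp (measurable_powR _)); exact: measurableT_comp.
- by move=> x _; rewrite mule_ge0// lee_fin powR_ge0.
- by apply: measurable_funeM; apply/measurable_EFinP; exact: measurable_indic.
- apply: filterS GM => x Gx _; rewrite -EFinM lee_fin indicE.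
  case: (boolP (x \in Omega)) => [_|xO].
    by rewrite mulr1 ge0_ler_powR ?nnegrE// ltW.
  by rewrite mulr0 /G patchE (negbTE xO) normr0 powR0// gt_eqF.
Qed.
End bounded_domain.

Section sup_bound.
Context {R : realType} (n : nat) (s : R) (Omega : set 'rV[R]_n).
Hypotheses (n_ge1 : (1 <= n)%N) (s_gt0 : 0 < s) (s_lt1 : s < 1).
Local Notation E := 'rV[R]_n.
Local Notation mu := (lebesgue_rV n).
Local Notation b := (b_ns n s).
Local Notation H := (H0sLog s Omega).
Variables (V : E -> R) (M r : R).
Hypotheses (mV : measurable_fun setT V) (M_ge0 : 0 <= M) (VM : {ae mu, forall x, `|V x| <= M}).
Hypotheses (r_gt0 : 0 < r) (r_lt1 : r < 1) (al_gt0 : 0 < 1 - `|b| / (2 * ln (1 / r))).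

(** Integrability of the source is asked for only if 2s <= n, where n/(2s) >= 1 and therefore q > 1.
    The borderline n = 2s falls under [level_decay]. *)
Lemma solution_ae_le (u g : E -> R) : H u ->
  (2 * s <= n%:R -> exists q : R, [/\ 1 < q, n%:R / (2 * s) < q, measurable_fun setT g &
     (\int[mu]_x (`|g x| `^ q)%:E < +oo)%E]) ->
  (forall phi, H phi -> mu.-integrable setT (EFin \o (fun x => g x * phi x)) /\
     form_sLog s u phi + pot V u phi = \int[mu]_x (g x * phi x)) ->
  exists K, {ae mu, forall x, u x <= K}.
Proof.
move=> Hu gP weak; apply: (ae_bounded_above Hu).
have [ns|sn] := ltP (n%:R) (2 * s).
  exact: (level_decay_supercritical n_ge1 s_gt0 s_lt1 ns Hu).
have [q [q1 nq mg gq]] := gP sn.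
exact: (level_decay n_ge1 s_gt0 s_lt1 Hu mV M_ge0 VM r_gt0 r_lt1 al_gt0 q1 nq mg gq weak).
Qed.
End sup_bound.

Theorem theorem1p4 (R : realType) (n : nat) (s : R) (Omega : set 'rV[R]_n)
    (V : 'rV[R]_n -> R) (F : ('rV[R]_n -> R) -> R) (r : R)
    (n_ge1 : (1 <= n)%N) (s_gt0 : 0 < s) (s_lt1 : s < 1)
    (OmegaP : bounded_lipschitz_domain Omega)
    (VP : Lq Omega +oo%E V)
    (FP : dualH s Omega F)
    (r_gt0 : 0 < r) (r_lt : r < expR (- (`|b_ns n s| / 2))) :
  let alpha := 1 - `|b_ns n s| / (2 * ln (1 / r)) in
  let c := c_ns n s in
  let b := b_ns n s in
  let S := surface_measure (unit_sphere R n) in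
  [/\ 0 < alpha,
      ((c * S / s ^+ 2 + `|b| * c / s * S * r `^ (- (2 * s)))%:E
         <= ess_inf_on Omega V)%E ->
      exists u, [/\ weak_solution s Omega V F u,
        forall v, weak_solution s Omega V F v -> v = u %[ae lebesgue_rV n] &
        normH s u <= alpha^-1 * dual_norm s Omega F]
    & forall u, weak_solution s Omega V F u ->
      forall q : \bar R, ((n%:R / (2 * s))%:E < q)%E ->
        dual_in_Lq s Omega q F -> Lq Omega +oo%E u].
Proof.
move=> alpha c b S.
have [[oO _ _] bO _] := OmegaP.
have mO : measurable Omega by exact: open_measurable_rV.
have Ofin := bounded_lebesgue_lty mO bO.
have [K K0 OK] := bounded_coord bO.
have [C C0 PC] := poincare n_ge1 s_gt0 s_lt1 mO K0 OK.
pose V' := patch (cst 0) Omega V.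
have [mV [M [M0 VM]]] := Lfun_ooP VP.
have al0 : 0 < alpha by exact: alpha_gt0 r_gt0 r_lt.
have r1 : r < 1 by exact: radius_lt1 r_lt.
have wE u phi : form_sLog s u phi + \int[lebesgue_rV n]_(x in Omega) (V x * u x * phi x)
    = form_sLog s u phi + pot V' u phi by rewrite integral_patch_pot.
split => //.
- move=> VK; rewrite /S surface_measure_sphere// in VK.
  have VK' : {ae lebesgue_rV n, forall x, Omega x ->
     c * (n%:R * omega n) / s ^+ 2 + `|b| * c / s * (n%:R * omega n) * r `^ (- (2 * s)) <= V' x}.
    have /ess_infP := VK; apply: filterS => x /= + Ox.
    by rewrite /V' /patch mem_set//= lee_fin.
  have [u [[Hu uF] uniq nu]] := well_posed s_gt0 s_lt1 C0 PC mV M0 VM r_gt0 r_lt FP VK'.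
  exists u; split => //.
  + by split=> // phi Hphi; rewrite wE; exact: uF.
  + move=> v [Hv vF]; apply: uniq; split=> // phi Hphi.
    by rewrite -wE; exact: vF.
- move=> u [Hu uF] q nq [g gq gF].
  have mu_ := H_measurable Hu; have H0 := H_zero s Omega.
  pose G := patch (cst 0) Omega g.
  have GE phi : H0sLog s Omega phi ->
     (lebesgue_rV n).-integrable setT (EFin \o (fun x => G x * phi x)) /\
     F phi = \int[lebesgue_rV n]_x (G x * phi x).
    move=> /gF[ig ->]; have E : (EFin \o (fun x => g x * phi x)) \_ Omega = EFin \o (fun x => G x * phi x).
      by apply/funext => x; rewrite /G /= !patchE; case: ifP => //; rewrite mul0r.
    split; first by rewrite -E; exact: (integrable_mkcond _ mO).1 ig.
    rewrite Rintegral_mkcond; apply: eq_Rintegral => x _; rewrite /G !patchE.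
    by case: ifP => //; rewrite mul0r.
  have weak1 phi : H0sLog s Omega phi ->
     (lebesgue_rV n).-integrable setT (EFin \o (fun x => G x * phi x)) /\
     form_sLog s u phi + pot V' u phi = \int[lebesgue_rV n]_x (G x * phi x).
    by move=> Hphi; have [iG <-] := GE _ Hphi; split=> //; rewrite -wE; exact: uF.
  have GP : 2 * s <= n%:R -> exists p : R, [/\ 1 < p, n%:R / (2 * s) < p, measurable_fun setT G &
      (\int[lebesgue_rV n]_x (`|G x| `^ p)%:E < +oo)%E].
    move=> sn; have p01 : 1 <= n%:R / (2 * s) by rewrite ler_pdivlMr ?mul1r// mulr_gt0.
    have [p [p0p mG Gp]] := Lq_finite_exponent mO Ofin gq p01 nq.
    by exists p; split=> //; exact: le_lt_trans p0p.
  have [K1 uK1] := solution_ae_le n_ge1 s_gt0 s_lt1 mV M0 VM r_gt0 r1 al0 Hu GP weak1.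
  (* A lower bound for u is an upper bound for -u, which solves the problem with source -G. *)
  have HNu : H0sLog s Omega (- u) by exact: H_opp.
  have GP2 : 2 * s <= n%:R -> exists p : R, [/\ 1 < p, n%:R / (2 * s) < p, measurable_fun setT (\- G) &
      (\int[lebesgue_rV n]_x (`|(\- G) x| `^ p)%:E < +oo)%E].
    move=> /GP[p [p1 np mG Gp]]; exists p; split; [exact: p1|exact: np|exact: measurable_funN|].
    by under eq_integral do rewrite normrN.
  have weak2 phi : H0sLog s Omega phi ->
     (lebesgue_rV n).-integrable setT (EFin \o (fun x => (\- G) x * phi x)) /\
     form_sLog s (- u) phi + pot V' (- u) phi = \int[lebesgue_rV n]_x ((\- G) x * phi x).
    move=> Hphi; have [iG wk] := weak1 _ Hphi.
    have E : (fun x => (\- G) x * phi x) = (fun x => -1 * (G x * phi x)).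
      by apply/funext => x; rewrite mulN1r mulNr.
    rewrite E; split; first exact: (integrableZl measurableT (-1) iG).
    rewrite RintegralZl// -wk.
    (* [Z] says that the form vanishes when its first argument is 0. *)
    have Z := form_pot_lin s_gt0 s_lt1 mV VM 1 H0 H0 Hphi.
    have := form_pot_lin s_gt0 s_lt1 mV VM (-1) Hu H0 Hphi.
    move: Z; cbv beta; rewrite !scaler0 !addr0 scaleN1r; rewrite -/V'; lra.
  have [K2 uK2] := solution_ae_le n_ge1 s_gt0 s_lt1 mV M0 VM r_gt0 r1 al0 HNu GP2 weak2.
  apply: (@Lfun_ooI _ _ _ _ _ (Num.max 0 (Num.max K1 K2))).
    exact: (measurable_restrictT u mO).1 (measurable_funTS mu_).
  apply: filterS2 uK1 uK2 => x x1 x2; rewrite patchE; case: ifP => _.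
    have x2' : - u x <= K2 by exact: x2.
    by rewrite ler_norml lerNl !le_max x1 x2' !orbT.
  by rewrite normr0 le_max lexx.
Qed.
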